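(* Let $T=(T_1,\dots,T_n)$ be a commutative family of generalized scalar operators on a Banach space $\mathcal{X}$, let $\alpha$ be the order of $T$, and let $c$ be the balanced Hausdorff dimension of the joint spectrum $\sigma(T)$. If $g\in A_\alpha(\mathbb{T}^n)$ is a Lipschitz function and $V=g(T)$, then $$\operatorname{asc}V\le[c/2+\alpha]+1 .$$
   Context: An element $a$ of a unital Banach algebra is generalized scalar if there are constants $C$ and $s$ with $\|e^{ita}\|\le C(1+|t|)^s$ for all $t\in\mathbb{R}$; then $a$ has order $s$. A generalized scalar operator on $\mathcal{X}$ is a generalized scalar element of the algebra of bounded operators on $\mathcal{X}$. The order of a commutative family $T=(T_1,\dots,T_n)$ of generalized scalar operators is $\alpha=s_1+\dots+s_n$, where $s_i$ is the order of $T_i$. $\sigma(T)\subset\mathbb{R}^n$ is the joint spectrum of $T$ (all classical definitions of joint spectrum, e.g. Taylor's, coincide for such families). For $\alpha\ge0$, $A_\alpha(\mathbb{T}^n)$ is the algebra of functions $f\in C(\mathbb{T}^n)$ with $f(t)=\sum_{k\in\mathbb{Z}^n}\hat f(k)e^{ik\cdot t}$ and $\|f\|_{A_\alpha}=\sum_{k}|\hat f(k)|(1+|k|)^\alpha<\infty$, where $k\cdot t=\sum k_jt_j$ and $|k|=(\sum k_j^2)^{1/2}$. The family $T$ admits the functional calculus $f(T)=\sum_{m\in\mathbb{Z}^n}\hat f(m)\exp(imT)$, with $mT=\sum_jm_jT_j$, for $f\in A_\alpha(\mathbb{T}^n)$. The ascent $\operatorname{asc}\Delta$ of a linear operator $\Delta$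 is the least positive integer $m$ such that $\ker\Delta^m=\ker\Delta^{m+1}$. $[\cdot]$ denotes the integer part. The balanced Hausdorff dimension of a compact set $S\subset\mathbb{R}^n$ is the infimum of all positive numbers $c$ with the following property: there exist constants $N,P>0$ such that for all sufficiently small $\delta>0$ there is a finite covering $S\subset\bigsqcup_{j=1}^m\beta_j$ by pairwise disjoint sets $\beta_j\subset\mathbb{R}^n$ satisfying (i) $\delta/P<\operatorname{diam}\beta_j<\delta$ for all $1\le j\le m$, and (ii) $\sum_{j=1}^m(\operatorname{diam}\beta_j)^c\le N$. *)

(* Defs.v *)
From HB Require Import structures.
From mathcomp Require Import all_boot all_order all_algebra.
From mathcomp Require Import finmap.
From mathcomp Require Export complex.
From mathcomp Require Import all_classical all_reals all_analysis.

Set Implicit Arguments.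
Unset Strict Implicit.
Unset Printing Implicit Defensive.

Import Order.TTheory GRing.Theory Num.Theory numFieldNormedType.Exports.

Local Open Scope classical_set_scope.
Local Open Scope ring_scope.
Local Open Scope complex_scope.

(* In a normed space over R[i] the norm is an element of R[i]; rnorm is the
   same norm, seen as a real number. *)
Definition rnorm (R : realType) (V : normedModType R[i]) (x : V) : R :=
  complex.Re `|x|.

Definition enorm (R : realType) n (x : 'rV[R]_n) : R :=
  Num.sqrt (\sum_j x 0 j ^+ 2).

(* Unconditional sum: the limit of the net of finite partial sums, finite sets
   of indices being directed by inclusion. *)
Definition finite_subsets (I : choiceType) : set_system {fset I} :=
  filter_from [set: {fset I}] (fun A => [set B | (A `<=` B)%fset]).
Arguments finite_subsets : clear implicits.

Definition usum (K : numFieldType) (V : normedModType K) (I : choiceType)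
    (f : I -> V) : V :=
  lim ((fun A : {fset I} => \sum_(i <- A) f i) @ finite_subsets I).

Section Operators.
Variables (R : realType) (X : completeNormedModType R[i]).

Definition expop (A : X -> X) (x : X) : X :=
  lim (series (fun k => (k`!%:R : R[i])^-1 *: iter k A x) @ \oo).

(* t *i is the purely imaginary number it; the bound on the operator norm is
   spelled out. *)
Definition generalized_scalar (A : X -> X) (s : R) : Prop :=
  exists C : R, forall (t : R) (x : X),
    rnorm (expop (fun y => (t *i) *: A y) x)
      <= C * (1 + `|t|) `^ s * rnorm x.

Definition commutative_family n (T : 'I_n -> X -> X) : Prop :=
  forall i j x, T i (T j x) = T j (T i x).

(* Coboundary of the Koszul complex of B on X (x) Lambda(C^n): the function f
   stands for \sum_S f S (x) e_S, where e_S is the wedge product of the e_j,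
   j in S, in increasing order, and x (x) w is mapped to
   \sum_j B j x (x) (e_j /\ w). *)
Definition koszul n (B : 'I_n -> X -> X) (f : {ffun {set 'I_n} -> X}) :
    {ffun {set 'I_n} -> X} :=
  [ffun S : {set 'I_n} => \sum_(j in S)
     (-1) ^+ #|[set k in S | (k < j)%N]| *: B j (f (S :\ j)%SET)].

(* All degrees of the Koszul complex are treated at once: it is exact iff
   every element of the kernel of the total coboundary is a coboundary. *)
Definition taylor_spectrum n (T : 'I_n -> X -> X) : set 'rV[R[i]]_n :=
  [set z | ~ (forall f : {ffun {set 'I_n} -> X},
     koszul (fun j x => T j x - z 0 j *: x) f = 0 ->
     exists g, f = koszul (fun j x => T j x - z 0 j *: x) g)].

(* For commutative families of generalized scalar operators the Taylor
   spectrum consists of points with real coordinates; here it is seen as a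
   subset of R^n. *)
Definition joint_spectrum n (T : 'I_n -> X -> X) : set 'rV[R]_n :=
  [set z | taylor_spectrum T (map_mx (fun u : R => u%:C) z)].

Definition is_ascent (D : X -> X) (m : nat) : Prop :=
  let stable k := forall x, iter k D x = 0 <-> iter k.+1 D x = 0 in
  [/\ (0 < m)%N, stable m & forall k, (0 < k)%N -> stable k -> (m <= k)%N].

End Operators.

(* Functions on the torus T^n are 2pi-periodic functions on R^n. *)
Section Torus.
Variables (R : realType) (n : nat).

Definition int_point (k : 'rV[int]_n) : 'rV[R]_n :=
  map_mx (fun z : int => z%:~R) k.

Definition character (k : 'rV[int]_n) (t : 'rV[R]_n) : R[i] :=
  let u := \sum_j int_point k 0 j * t 0 j in cos u +i* sin u.

Definition periodic (f : 'rV[R]_n -> R[i]) : Prop :=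
  forall t (k : 'rV[int]_n), f (t + (2 * pi) *: int_point k) = f t.

Fixpoint cube_integral d : ('rV[R]_d -> R) -> R :=
  match d return ('rV[R]_d -> R) -> R with
  | 0 => fun F => F 0
  | d'.+1 => fun F =>
      \int[lebesgue_measure]_(u in `[0, 2 * pi])
        cube_integral (fun t : 'rV[R]_d' => F (row_mx (\row_(_ < 1) u) t))
  end.

Definition fourier_coef (f : 'rV[R]_n -> R[i]) (k : 'rV[int]_n) : R[i] :=
  let F t := f t * character (- k) t in
  let mean u := ((2 * pi) ^+ n)^-1 * cube_integral u in
  mean (fun t => complex.Re (F t)) +i* mean (fun t => complex.Im (F t)).

Definition in_A (alpha : R) (f : 'rV[R]_n -> R[i]) : Prop :=
  [/\ continuous (f : 'rV[R]_n -> R[i]^o),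
      periodic f,
      (\esum_(k in [set: 'rV[int]_n])
         (rnorm (fourier_coef f k : R[i]^o)
            * (1 + enorm (int_point k)) `^ alpha)%:E < +oo)%E &
      forall t, f t =
        usum (fun k => fourier_coef f k * character k t : R[i]^o)].

(* For a periodic function this is the same as being Lipschitz for the
   quotient metric of the torus. *)
Definition lipschitz_fun (f : 'rV[R]_n -> R[i]) : Prop :=
  exists L : R, forall t u,
    rnorm (f t - f u : R[i]^o) <= L * enorm (t - u).

Definition fcalc (X : completeNormedModType R[i]) (f : 'rV[R]_n -> R[i])
    (T : 'I_n -> X -> X) (x : X) : X :=
  usum (fun m : 'rV[int]_n => fourier_coef f m *:
    expop (fun y => 'i%C *: \sum_j (m 0 j)%:~R *: T j y) x).

End Torus.

Section BalancedDimension.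
Variables (R : realType) (n : nat).

(* As sup is 0 on sets that are empty or not bounded above, a set of positive
   diam is nonempty and bounded. *)
Definition diam (S : set 'rV[R]_n) : R :=
  sup [set enorm (x - y) | x in S & y in S].

Definition balanced_coverings (S : set 'rV[R]_n) (c : R) : Prop :=
  exists N P : R, [/\ 0 < N, 0 < P &
    \forall delta \near (0 : R)^'+,
      exists m (beta : 'I_m -> set 'rV[R]_n),
        [/\ S `<=` \bigcup_j beta j,
            trivIset setT beta,
            forall j, delta / P < diam (beta j) < delta &
            \sum_j diam (beta j) `^ c <= N]].

Definition balanced_dim (S : set 'rV[R]_n) : R :=
  inf [set c : R | 0 < c /\ balanced_coverings S c].

End BalancedDimension.

(* Main.v *)
Require Import Defs.
From mathcomp Require Import all_boot all_order all_algebra.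
From HB Require Import structures.
From mathcomp Require Import finmap.
From mathcomp Require Import all_classical all_reals all_analysis.
From mathcomp Require Import ring lra zify.
Import Order.TTheory GRing.Theory Num.Theory numFieldNormedType.Exports.
Local Open Scope classical_set_scope.
Local Open Scope ring_scope.
Local Open Scope complex_scope.
Set Implicit Arguments.
Unset Strict Implicit.
Unset Printing Implicit Defensive.

(* Dividing T by a large integer M puts the joint spectrum inside a small cube,
   so that V = sum_k c_k U_{Mk} for the group U_k = exp(i k.T/M), k in Z^n, and
   g becomes the Lipschitz function t |-> g(M t).  For a product of powers of
   sinc with scale eta let S_p x be the sum of bump(eta k) e^{-i k.p} U_k x: the
   part of x living near the point p of the torus.

   - S_p x = 0 for small eta unless p is close to the spectrum: off the
     spectrum x is a combination of the (U_{e_j} - e^{i z_j}) y_j, and a product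
     of l such letters, which vanish at z, has norm tending to 0 with l when it
     is localized near z by S_p.
   - In the same way, V x = 0 forces S_p x = 0 unless p is close to a zero of g.
   - Halving eta by sinc u = cos(u/2) sinc(u/2) splits S_p into the S_{p'} with
     p' close to p, so S_p x <> 0 produces by bisection a point z near p at
     which neither of the two vanishing statements applies.

   Hence if V^l x = 0, V^m x is up to small errors an average over a grid of
   g(M p)^m S_p x, where only points within O(eta) of the spectrum and of the
   zeros of g contribute.  There |g(M p)| = O(eta); the coverings put these
   points into O(eta^{-c}) cubes of side O(eta), and Cauchy-Schwarz
   with Parseval on the grid gives |V^m x| = O(eta^{m - alpha - c/2}), which
   tends to 0 when m > alpha + c/2. *)

(** * Norms and unconditional sums *)

(** Sinc serves three purposes at once. Its powers are transforms of measures on a box of side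
    O(eta), so a coefficient of P(U) S_p never exceeds the maximum of |P| on that box, and no
    smoothness of g is called for; they decay fast enough to be summed against the growth of U_k;
    and they halve exactly. The bisection stands in for a compactness argument: the vanishing near z
    holds only below a scale depending on z, and bisection yields one z at which arbitrarily small
    scales survive. Division by M prevents wrapping around the torus: for |z_j| <= 1/2 the letter
    e^{iT_j/M} - e^{iz_j} is T_j - M z_j times an invertible operator, so that exactness of the
    Koszul complex passes to the letters. For the exponent, Cauchy-Schwarz meets a fraction
    O(eta^{n-c}) of the grid points, where |g|^{2m} = O(eta^{2m}), and a weighted square sum of the
    bump of size O(eta^{-n-2 alpha}); the root of the product is eta^{m-alpha-c/2}. As g is an
    infinite series, this is done for powers of truncations, with constants independent of the
    truncation. *)

Section RealNorm.
Variable R : realType.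

Section NormedModule.
Variable V : normedModType R[i].
Implicit Types (x y : V) (c : R[i]).

Lemma rnormE x : `|x| = (rnorm x)%:C.
Proof. by rewrite /rnorm RRe_real // ger0_real. Qed.

Lemma rnorm_ge0 x : 0 <= rnorm x.
Proof. by rewrite -ler0c -rnormE. Qed.

Lemma rnorm_eq0 x : (rnorm x == 0) = (x == 0).
Proof. by rewrite -(normr_eq0 x) rnormE eq_complex /= eqxx andbT. Qed.

Lemma rnorm0 : rnorm (0 : V) = 0.
Proof. by apply/eqP; rewrite rnorm_eq0. Qed.

Lemma rnorm0_eq0 x : rnorm x = 0 -> x = 0.
Proof. by move/eqP; rewrite rnorm_eq0 => /eqP. Qed.

Lemma rnormN x : rnorm (- x) = rnorm x.
Proof. by rewrite /rnorm normrN. Qed.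

Lemma rdistC x y : rnorm (x - y) = rnorm (y - x).
Proof. by rewrite -rnormN opprB. Qed.

Lemma ler_rnormD x y : rnorm (x + y) <= rnorm x + rnorm y.
Proof. by rewrite -lecR rmorphD /= -!rnormE ler_normD. Qed.

Lemma ler_rnormB x y : rnorm (x - y) <= rnorm x + rnorm y.
Proof. by rewrite -[rnorm y]rnormN ler_rnormD. Qed.

Lemma ler_rdistD (z x y : V) : rnorm (x - y) <= rnorm (x - z) + rnorm (z - y).
Proof. by rewrite -[x - y](subrKA z) ler_rnormD. Qed.

Lemma ler_rnorm_sum I (r : seq I) (P : pred I) (F : I -> V) :
  rnorm (\sum_(i <- r | P i) F i) <= \sum_(i <- r | P i) rnorm (F i).
Proof.
elim/big_ind2: _ => //; first by rewrite rnorm0.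
by move=> a b c d ab cd; rewrite (le_trans (ler_rnormD _ _)) ?lerD.
Qed.

Lemma rnorm_le0_eq0 x : (forall e : R, 0 < e -> rnorm x <= e) -> x = 0.
Proof.
move=> xe; apply: rnorm0_eq0; apply/eqP; rewrite eq_le rnorm_ge0 andbT.
by apply/ler_addgt0Pl => e e0; rewrite addr0; exact: xe.
Qed.

End NormedModule.

Definition cnorm (c : R[i]) : R := rnorm (c : R[i]^o).

Lemma cnormE (c : R[i]) : `|c| = (cnorm c)%:C.
Proof. exact: (@rnormE R[i]^o). Qed.

Lemma cnorm_ge0 c : 0 <= cnorm c. Proof. exact: rnorm_ge0. Qed.

Lemma cnorm_eq0 c : (cnorm c == 0) = (c == 0). Proof. exact: rnorm_eq0. Qed.

Lemma cnorm0 : cnorm 0 = 0. Proof. exact: rnorm0. Qed.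

Lemma cnormN c : cnorm (- c) = cnorm c. Proof. exact: rnormN. Qed.

Lemma ler_cnormD c d : cnorm (c + d) <= cnorm c + cnorm d.
Proof. exact: (@ler_rnormD R[i]^o). Qed.

Lemma ler_cnormB c d : cnorm (c - d) <= cnorm c + cnorm d.
Proof. exact: (@ler_rnormB R[i]^o). Qed.

Lemma ler_cnorm_sum I (r : seq I) (P : pred I) (F : I -> R[i]) :
  cnorm (\sum_(i <- r | P i) F i) <= \sum_(i <- r | P i) cnorm (F i).
Proof. exact: (@ler_rnorm_sum R[i]^o). Qed.

Lemma cnormM c d : cnorm (c * d) = cnorm c * cnorm d.
Proof. by apply: complexI; rewrite rmorphM /= -!cnormE normrM. Qed.

Lemma cnorm1 : cnorm 1 = 1.
Proof. by apply: complexI; rewrite -cnormE normr1. Qed.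

Lemma cnormX c n : cnorm (c ^+ n) = cnorm c ^+ n.
Proof. by elim: n => [|n IH]; rewrite ?expr0 ?cnorm1 // !exprS cnormM IH. Qed.

Lemma cnormV c : cnorm c^-1 = (cnorm c)^-1.
Proof. by apply: complexI; rewrite fmorphV /= -!cnormE normfV. Qed.

Lemma cnormR (r : R) : cnorm r%:C = `|r|.
Proof.
by apply: complexI; rewrite -cnormE normc_def /= expr0n /= addr0 sqrtr_sqr.
Qed.

Lemma cnorm_sqr c : cnorm c ^+ 2 = complex.Re c ^+ 2 + complex.Im c ^+ 2.
Proof. by apply: complexI; rewrite add_Re2_Im2 cnormE rmorphXn. Qed.

Lemma cnorm_nat n : cnorm n%:R = n%:R.
Proof. by rewrite -[n%:R in LHS](rmorph_nat (real_complex R)) cnormR normr_nat. Qed.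

Lemma Re_le_cnorm c : `|complex.Re c| <= cnorm c.
Proof. by rewrite -lecR -cnormE; exact: normc_ge_Re. Qed.

Lemma Im_le_cnorm c : `|complex.Im c| <= cnorm c.
Proof.
rewrite -(ler_pXn2r (n := 2)) // ?nnegrE ?cnorm_ge0 ?normr_ge0 //.
by rewrite cnorm_sqr real_normK ?num_real // lerDr sqr_ge0.
Qed.

Lemma cnorm_le c : cnorm c <= `|complex.Re c| + `|complex.Im c|.
Proof.
have := ler_cnormD (complex.Re c)%:C ('i * (complex.Im c)%:C).
rewrite -complexE cnormM !cnormR => /le_trans; apply.
rewrite lerD2l -[leRHS]mul1r ler_wpM2r //.
rewrite -(ler_pXn2r (n := 2)) // ?nnegrE ?cnorm_ge0 //.
by rewrite cnorm_sqr /= expr0n /= add0r.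
Qed.

Lemma rnormZ (V : normedModType R[i]) c (x : V) : rnorm (c *: x) = cnorm c * rnorm x.
Proof. by apply: complexI; rewrite rmorphM /= -cnormE -!rnormE normrZ. Qed.

Lemma cvg_rnormP (V : normedModType R[i]) T (F : set_system T) (FF : Filter F)
    (f : T -> V) (l : V) :
  f @ F --> l <-> forall e : R, 0 < e -> \forall t \near F, rnorm (l - f t) <= e.
Proof.
split=> [/cvgrPdist_le fl e e0|fl].
  have := fl e%:C; rewrite ltcR => /(_ e0); apply: filterS => t.
  by rewrite rnormE lecR.
apply/cvgrPdist_le => e e0.
have [e1 ee] : 0 < complex.Re e /\ e = (complex.Re e)%:C.
  have ee : (complex.Re e)%:C = e by rewrite RRe_real // gtr0_real.
  by rewrite -ltcR ee; split.
have := fl _ e1; apply: filterS => t.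
by rewrite rnormE {2}ee lecR.
Qed.

Lemma cauchy_rnormP (V : normedModType R[i]) (F : set_system V) (FF : ProperFilter F) :
  (forall e : R, 0 < e -> exists x, F [set y | rnorm (x - y) <= e]) -> cauchy F.
Proof.
move=> H; apply: cauchy_exP => e e0.
have [e1 ee] : 0 < complex.Re e /\ e = (complex.Re e)%:C.
  have ee : (complex.Re e)%:C = e by rewrite RRe_real // gtr0_real.
  by rewrite -ltcR ee; split.
have [|x Fx] := H (complex.Re e / 2); first by rewrite divr_gt0.
exists x; apply: filterS Fx => y /=; rewrite -ball_normE /= => xy.
rewrite rnormE ee ltcR (le_lt_trans xy) // ltr_pdivrMr // ltr_pMr // ltrDl ltr01 //.
Qed.

End RealNorm.

Lemma complex_complete (R : realType) (F : set_system R[i]^o) :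
  ProperFilter F -> cauchy F -> cvg F.
Proof.
move=> FF Fc.
have Fc' (e : R) : 0 < e -> exists c, F [set d : R[i]^o | cnorm (c - d) < e].
  move=> e0; have /cauchyP := Fc.
  move=> /(_ e%:C); rewrite ltcR => /(_ e0)[c Fce]; exists c.
  apply: filterS Fce => d; rewrite -ball_normE /=.
  by rewrite (@rnormE _ R[i]^o) ltcR.
have cvgP (h : R[i]^o -> R) : (forall c d, `|h c - h d| <= cnorm (c - d)) -> cvg (h @ F).
  move=> hl; apply: R_complete; apply: cauchy_exP => e e0.
  have [c Fce] := Fc' _ e0; exists (h c).
  change (F (h @^-1` ball (h c) e)).
  apply: filterS Fce => d /= cd; rewrite -ball_normE /=.
  exact: le_lt_trans (hl _ _) cd.
have /cvg_ex[a /cvgrPdist_le Fa] : cvg ((@complex.Re R : R[i]^o -> R) @ F).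
  by apply: cvgP => c d; have := Re_le_cnorm (c - d); case: c d => [a b] [c d].
have /cvg_ex[b /cvgrPdist_le Fb] : cvg ((@complex.Im R : R[i]^o -> R) @ F).
  by apply: cvgP => c d; have := Im_le_cnorm (c - d); case: c d => [? b] [c d].
apply/cvg_ex; exists (a +i* b : R[i]^o); rewrite -[F]/(id @ F).
apply/cvg_rnormP => e e0.
have e2 : 0 < e / 2 by rewrite divr_gt0.
have : F ([set c | `|a - complex.Re c| <= e / 2] `&`
          [set c | `|b - complex.Im c| <= e / 2]).
  exact: (filterI (Fa _ e2) (Fb _ e2)).
apply: filterS => -[c d] /= [ac bd].
apply: le_trans (cnorm_le ((a +i* b) - (c +i* d))) _ => /=.
by rewrite [e]splitr lerD.
Qed.

(* R^o for R : realType already carries the canonical completeness instance of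
   GRing.regular, hence the alias for R[i]^o. *)
Definition complex_line (R : realType) : Type := R[i]^o.
HB.instance Definition _ (R : realType) := NormedModule.copy (complex_line R) R[i]^o.
HB.instance Definition _ (R : realType) :=
  Uniform_isComplete.Build (complex_line R) (@complex_complete R).

Section UnconditionalSum.
Variable R : realType.

Definition abs_summable (V : normedModType R[i]) (I : choiceType) (F : I -> V) :=
  exists M : R, forall A : {fset I}, \sum_(i <- A) rnorm (F i) <= M.

Global Instance finite_subsets_filter (I : choiceType) :
  ProperFilter (finite_subsets I).
Proof.
apply: filter_from_proper; last by move=> A _; exists A => /=.
apply: filter_from_filter; first by exists fset0.
move=> A B _ _; exists (A `|` B)%fset => // C /= ABC; split => /=.
  exact: fsubset_trans (fsubsetUl A B) ABC.
exact: fsubset_trans (fsubsetUr A B) ABC.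
Qed.

Lemma big_fsetD (W : zmodType) (I : choiceType) (F : I -> W) (A B : {fset I}) :
  (A `<=` B)%fset ->
  \sum_(i <- B) F i = \sum_(i <- A) F i + \sum_(i <- (B `\` A)%fset) F i.
Proof.
by move=> AB; rewrite (big_fsetID _ (mem A)) /=; congr (_ + _);
  apply: eq_fbigl => i; rewrite !inE /=; [|by rewrite andbC];
  apply/andP/idP => [[]//|iA]; split => //; exact: (fsubsetP AB).
Qed.

Lemma ler_sum_fsub (I : choiceType) (F : I -> R) (A B : {fset I}) :
  (forall i, 0 <= F i) -> (A `<=` B)%fset ->
  \sum_(i <- A) F i <= \sum_(i <- B) F i.
Proof. by move=> F0 AB; rewrite (big_fsetD F AB) lerDl sumr_ge0. Qed.

(** Any A whose sum is within e of the supremum of all finite sums works: a disjoint B with a larger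
    sum would push A and B together above the supremum. *)
Lemma sum_fset_tail (I : choiceType) (F : I -> R) (M e : R) :
  (forall i, 0 <= F i) -> (forall A : {fset I}, \sum_(i <- A) F i <= M) -> 0 < e ->
  exists A : {fset I}, forall B : {fset I}, [disjoint A & B]%fset ->
    \sum_(i <- B) F i <= e.
Proof.
move=> F0 FM e0; pose S := [set \sum_(i <- A) F i | A in [set: {fset I}]].
have hS : has_sup S.
  split; first by exists (\sum_(i <- fset0) F i), fset0.
  by exists M => _ [A _ <-].
have [_ [A _ <-] SA] := sup_adherent e0 hS.
exists A => B AB.
have : \sum_(i <- (A `|` B)%fset) F i <= sup S.
  by apply: sup_upper_bound => //; exists (A `|` B)%fset.
rewrite (big_fsetD F (fsubsetUl A B)) fsetDUl fsetDv fset0U.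
have -> : (B `\` A)%fset = B by apply/fsetDidPl; rewrite fdisjoint_sym.
by move: SA; lra.
Qed.

Section Complete.
Variables (V : completeNormedModType R[i]) (I : choiceType).
Implicit Types F G : I -> V.

Lemma usum_eqP F (l : V) :
  (forall e : R, 0 < e -> exists A : {fset I}, forall B : {fset I},
     (A `<=` B)%fset -> rnorm (l - \sum_(i <- B) F i) <= e) ->
  usum F = l.
Proof.
move=> H; apply: cvg_lim => //; apply/cvg_rnormP => e e0.
by have [A HA] := H _ e0; exists A.
Qed.

Lemma usum_near F (e : R) : abs_summable F -> 0 < e ->
  exists A : {fset I}, forall B : {fset I},
     (A `<=` B)%fset -> rnorm (usum F - \sum_(i <- B) F i) <= e.
Proof.
move=> [M FM] e0.
suff /cvg_ex[l Fl] : cvg ((fun A : {fset I} => \sum_(i <- A) F i) @ finite_subsets I).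
  rewrite /usum (cvg_lim _ Fl) //.
  by move/cvg_rnormP : Fl => /(_ _ e0)[A _ HA]; exists A.
apply: cauchy_cvg; apply: cauchy_rnormP => d d0.
have [A HA] := sum_fset_tail (fun i => rnorm_ge0 (F i)) FM d0.
exists (\sum_(i <- A) F i); exists A => // B /= AB.
rewrite (big_fsetD F AB) opprD addrA subrr sub0r rnormN.
by rewrite (le_trans (ler_rnorm_sum _ _ _)) // HA //; apply/fdisjointP => i iA; rewrite inE iA.
Qed.

Lemma usum_le F (M : R) :
  (forall A : {fset I}, \sum_(i <- A) rnorm (F i) <= M) -> rnorm (usum F) <= M.
Proof.
move=> FM; apply/ler_addgt0Pr => e e0.
have [A HA] := usum_near (ex_intro _ M FM) e0.
have := HA A (fsubset_refl A); rewrite -[in X in _ -> X](subrK (\sum_(i <- A) F i) (usum F)).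
move=> le; apply: le_trans (ler_rnormD _ _) _; rewrite addrC lerD //.
exact: le_trans (ler_rnorm_sum _ _ _) (FM A).
Qed.

Lemma usum_fset F (A : {fset I}) :
  (forall i, i \notin A -> F i = 0) -> usum F = \sum_(i <- A) F i.
Proof.
move=> F0; apply: usum_eqP => e e0; exists A => B AB.
rewrite (big_fsetD F AB) opprD addrA subrr sub0r big_seq big1 ?oppr0 ?rnorm0 ?ltW //.
by move=> i; rewrite inE => /andP[/F0].
Qed.

Lemma usum0 : usum (fun _ : I => 0 : V) = 0.
Proof. by rewrite (@usum_fset _ fset0) // big_seq_fset0. Qed.

Lemma abs_summable0 : abs_summable (fun _ : I => 0 : V).
Proof. by exists 0 => A; rewrite big1 // => i _; rewrite rnorm0. Qed.

Lemma abs_summableD F G : abs_summable F -> abs_summable G ->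
  abs_summable (fun i => F i + G i).
Proof.
move=> [M FM] [N GN]; exists (M + N) => A.
rewrite (le_trans _ (lerD (FM A) (GN A))) // -big_split /=.
by apply: ler_sum => i _; exact: ler_rnormD.
Qed.

Lemma usumD F G : abs_summable F -> abs_summable G ->
  usum (fun i => F i + G i) = usum F + usum G.
Proof.
move=> sF sG; apply: usum_eqP => e e0.
have e2 : 0 < e / 2 by rewrite divr_gt0.
have [A HA] := usum_near sF e2; have [B HB] := usum_near sG e2.
exists (A `|` B)%fset => C ABC.
rewrite big_split /= opprD addrACA (le_trans (ler_rnormD _ _)) // [e]splitr lerD //.
  by apply: HA; exact: fsubset_trans (fsubsetUl A B) ABC.
by apply: HB; exact: fsubset_trans (fsubsetUr A B) ABC.
Qed.

End Complete.

(* Boundedness is kept as an explicit operator bound, so that operators may be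
   plain functions. *)
Definition bounded_op (V W : normedModType R[i]) (f : V -> W) (a : R) :=
  (forall c x y, f (c *: x + y) = c *: f x + f y) /\
  (forall x, rnorm (f x) <= a * rnorm x).

Section BoundedOp.
Variables (V W : normedModType R[i]) (f : V -> W) (a : R).
Hypothesis fa : bounded_op f a.

Lemma bopD x y : f (x + y) = f x + f y.
Proof. by rewrite -[x]scale1r fa.1 !scale1r. Qed.

Lemma bop0 : f 0 = 0.
Proof. by apply: (@addrI _ (f 0)); rewrite -bopD !addr0. Qed.

Lemma bopZ c x : f (c *: x) = c *: f x.
Proof. by rewrite -[c *: x]addr0 fa.1 bop0 addr0. Qed.

Lemma bopN x : f (- x) = - f x.
Proof. by rewrite -scaleN1r bopZ scaleN1r. Qed.

Lemma bopB x y : f (x - y) = f x - f y.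
Proof. by rewrite bopD bopN. Qed.

Lemma bop_sum I (r : seq I) (P : pred I) (F : I -> V) :
  f (\sum_(i <- r | P i) F i) = \sum_(i <- r | P i) f (F i).
Proof. by rewrite (big_morph f bopD bop0). Qed.

Lemma bop_le b : a <= b -> bounded_op f b.
Proof.
move=> ab; split; first exact: fa.1.
by move=> x; rewrite (le_trans (fa.2 x)) // ler_wpM2r // rnorm_ge0.
Qed.

Lemma abs_summable_bop (I : choiceType) (F : I -> V) :
  abs_summable F -> abs_summable (fun i => f (F i)).
Proof.
move=> [M FM]; exists (`|a| * M) => A.
rewrite (le_trans _ (ler_wpM2l (normr_ge0 a) (FM A))) // mulr_sumr.
apply: ler_sum => i _; rewrite (le_trans (fa.2 _)) // ler_wpM2r ?rnorm_ge0 //.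
exact: ler_norm.
Qed.

End BoundedOp.

Lemma usum_bop (V W : completeNormedModType R[i]) (f : V -> W) (a : R)
    (I : choiceType) (F : I -> V) :
  bounded_op f a -> abs_summable F -> f (usum F) = usum (fun i => f (F i)).
Proof.
move=> fa sF; apply/esym/usum_eqP => e e0.
have d0 : 0 < e / (`|a| + 1) by rewrite divr_gt0 // ltr_wpDl.
have [A HA] := usum_near sF d0; exists A => B AB.
rewrite -(bop_sum fa) -(bopB fa) (le_trans (fa.2 _)) //.
have := HA _ AB; rewrite ler_pdivlMr ?ltr_wpDl // => /(le_trans _); apply.
rewrite mulrC ler_wpM2l ?rnorm_ge0 // (le_trans (ler_norm a)) // lerDl //.
Qed.

Lemma bounded_opZ (V : normedModType R[i]) (c : R[i]) :
  bounded_op (fun x : V => c *: x) (cnorm c).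
Proof.
split=> [d x y|x]; first by rewrite scalerDr !scalerA [c * d]mulrC.
by rewrite rnormZ.
Qed.

Lemma usumZ (V : completeNormedModType R[i]) (I : choiceType) (F : I -> V) c :
  abs_summable F -> usum (fun i => c *: F i) = c *: usum F.
Proof. by move=> sF; rewrite (usum_bop (bounded_opZ V c) sF). Qed.

Lemma abs_summableZ (V : completeNormedModType R[i]) (I : choiceType) (F : I -> V) c :
  abs_summable F -> abs_summable (fun i => c *: F i).
Proof. exact: (abs_summable_bop (bounded_opZ V c)). Qed.

Lemma abs_summable_sum (V : completeNormedModType R[i]) (I : choiceType)
    (J : Type) (r : seq J) (P : pred J) (F : J -> I -> V) :
  (forall j, abs_summable (F j)) ->
  abs_summable (fun i => \sum_(j <- r | P j) F j i).
Proof.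
move=> sF; elim: r => [|j r IH].
  under [X in abs_summable X]funext do rewrite big_nil; exact: abs_summable0.
under [X in abs_summable X]funext do rewrite big_cons.
by case: (P j) => //; exact: abs_summableD.
Qed.

Lemma usum_sum (V : completeNormedModType R[i]) (I : choiceType)
    (J : Type) (r : seq J) (P : pred J) (F : J -> I -> V) :
  (forall j, abs_summable (F j)) ->
  usum (fun i => \sum_(j <- r | P j) F j i) = \sum_(j <- r | P j) usum (F j).
Proof.
move=> sF; elim: r => [|j r IH].
  by rewrite big_nil -[RHS](usum0 V I); congr usum; apply/funext => i; rewrite big_nil.
rewrite big_cons -IH; under [X in usum X]funext do rewrite big_cons.
case: (P j) => //; rewrite usumD //; exact: abs_summable_sum.
Qed.

End UnconditionalSum.

(** * Bounded operators and the exponential *)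

Section OperatorAlgebra.
Variables (R : realType) (V : normedModType R[i]).
Implicit Types (f g : V -> V) (a b : R).

Lemma bounded_op_id : bounded_op (@id V) 1.
Proof. by split=> // x; rewrite mul1r. Qed.

Lemma bounded_op_comp f g a b : 0 <= a -> bounded_op f a -> bounded_op g b ->
  bounded_op (f \o g) (a * b).
Proof.
move=> a0 fa gb; split=> [c x y|x] /=; first by rewrite gb.1 fa.1.
by rewrite (le_trans (fa.2 _)) // -mulrA ler_wpM2l // gb.2.
Qed.

Lemma bounded_opD f g a b : bounded_op f a -> bounded_op g b ->
  bounded_op (fun x => f x + g x) (a + b).
Proof.
move=> fa gb; split=> [c x y|x].
  by rewrite gb.1 fa.1 scalerDr addrACA.
by rewrite (le_trans (ler_rnormD _ _)) // mulrDl lerD ?fa.2 ?gb.2.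
Qed.

Lemma bounded_op_scale f a c : bounded_op f a ->
  bounded_op (fun x => c *: f x) (cnorm c * a).
Proof.
by move=> fa; apply: (bounded_op_comp (cnorm_ge0 c) (bounded_opZ V c) fa).
Qed.

Lemma bounded_opN f a : bounded_op f a -> bounded_op (fun x => - f x) a.
Proof.
move=> fa; split=> [c x y|x]; last by rewrite rnormN fa.2.
by rewrite fa.1 opprD scalerN.
Qed.

Lemma bounded_op0 a : 0 <= a -> bounded_op (fun _ : V => 0 : V) a.
Proof.
by move=> a0; split=> [c x y|x]; rewrite ?scaler0 ?addr0 // rnorm0 mulr_ge0 ?rnorm_ge0.
Qed.

Lemma bounded_op_sum I (r : seq I) (P : pred I) (f : I -> V -> V) (a : I -> R) :
  (forall i, P i -> bounded_op (f i) (a i)) ->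
  bounded_op (fun x => \sum_(i <- r | P i) f i x) (\sum_(i <- r | P i) a i).
Proof.
move=> fa; elim: r => [|i r IH].
  by rewrite big_nil; under [X in bounded_op X]funext do rewrite big_nil;
     apply: bounded_op0.
rewrite big_cons; under [X in bounded_op X]funext do rewrite big_cons.
by case: ifP => // Pi; apply: bounded_opD => //; exact: fa.
Qed.

Lemma bounded_op_iter f a k : 0 <= a -> bounded_op f a -> bounded_op (iter k f) (a ^+ k).
Proof.
move=> a0 fa; elim: k => [|k IH]; first exact: bounded_op_id.
by rewrite exprS; apply: (bounded_op_comp a0 fa IH).
Qed.

End OperatorAlgebra.

Lemma iter_comm T (f g : T -> T) k x : (forall x, f (g x) = g (f x)) ->
  iter k f (g x) = g (iter k f x).
Proof. by move=> fg; elim: k => //= k ->. Qed.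

Section NatSums.
Variables (R : realType) (V : completeNormedModType R[i]).
Implicit Types (F : nat -> V).

Lemma fset_iota_sum (W : zmodType) (F : nat -> W) (n : nat) :
  \sum_(i <- [fset j in iota 0 n]%fset) F i = \sum_(i < n) F i.
Proof.
rewrite -(big_mkord xpredT) /index_iota subn0.
by apply: perm_big; apply: uniq_perm; rewrite ?iota_uniq ?fset_uniq // => i; rewrite inE.
Qed.

Lemma abs_summable_natP F (M : R) :
  (forall n, \sum_(i < n) rnorm (F i) <= M) ->
  forall A : {fset nat}, \sum_(i <- A) rnorm (F i) <= M.
Proof.
move=> FM A; have /= := FM (\max_(i <- A) i).+1.
rewrite -(fset_iota_sum (fun i => rnorm (F i))); apply: le_trans; apply: ler_sum_fsub.
  by move=> i; exact: rnorm_ge0.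
apply/fsubsetP => i iA; rewrite in_fset mem_iota add0n ltnS /=.
exact: (@leq_bigmax_seq _ _ xpredT id).
Qed.

Lemma abs_summable_nat F (M : R) :
  (forall n, \sum_(i < n) rnorm (F i) <= M) -> abs_summable F.
Proof. by move=> FM; exists M; exact: abs_summable_natP. Qed.

Lemma usum_nat_near F (e : R) : abs_summable F -> 0 < e ->
  exists N, forall n, (N <= n)%N -> rnorm (usum F - \sum_(i < n) F i) <= e.
Proof.
move=> sF e0; have [A HA] := usum_near sF e0.
exists (\max_(i <- A) i).+1 => n Nn; rewrite -fset_iota_sum; apply: HA.
apply/fsubsetP => i iA; rewrite in_fset mem_iota add0n /=.
apply: leq_trans Nn; rewrite ltnS.
exact: (@leq_bigmax_seq _ _ xpredT id).
Qed.

Lemma usum_nat_cvg F : abs_summable F -> series F @ \oo --> usum F.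
Proof.
move=> sF; apply/cvg_rnormP => e e0; have [N HN] := usum_nat_near sF e0.
by exists N => // n /= Nn; rewrite /series /= big_mkord; exact: HN.
Qed.

Lemma lim_series_usum F : abs_summable F -> lim (series F @ \oo) = usum F.
Proof. by move=> sF; apply: cvg_lim => //; exact: usum_nat_cvg. Qed.

Lemma abs_summable_natS F : abs_summable F -> abs_summable (fun n => F n.+1).
Proof.
move=> [M FM]; apply: (@abs_summable_nat _ M) => n.
have := FM [fset i in iota 0 n.+1]%fset; rewrite (fset_iota_sum (fun i => rnorm (F i))) big_ord_recl.
by apply: le_trans; rewrite lerDr rnorm_ge0.
Qed.

Lemma usum_natS F : abs_summable F -> usum F = F 0%N + usum (fun n => F n.+1).
Proof.
move=> sF; apply/eqP; rewrite -subr_eq0; apply/eqP; apply: rnorm_le0_eq0 => e e0.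
have e2 : 0 < e / 2 by rewrite divr_gt0.
have [N HN] := usum_nat_near sF e2.
have [N' HN'] := usum_nat_near (abs_summable_natS sF) e2.
have h1 := HN (maxn N N').+1 (leqW (leq_maxl _ _)).
have h2 := HN' (maxn N N') (leq_maxr _ _).
rewrite big_ord_recl in h1.
set s := \sum_(_ < _) _ in h1; rewrite -/s in h2.
rewrite [e]splitr (le_trans _ (lerD h1 h2)) //.
by rewrite (le_trans _ (ler_rnormB _ _)) // opprB !opprD !addrA subrK.
Qed.

End NatSums.

Section PowerSeries.
Variables (R : realType) (V : completeNormedModType R[i]).
Variables (A : V -> V) (a : R) (c : nat -> R[i]) (M : R).
Hypotheses (a0 : 0 <= a) (Aa : bounded_op A a).
Hypothesis cM : forall n, \sum_(i < n) cnorm (c i) * a ^+ i <= M.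

(** Common frame of the Neumann series, of the exponential and of the factor [Y] in
    [expop_factor]. *)
Definition power_series (x : V) : V := usum (fun k => c k *: iter k A x).

Lemma power_series_term x n :
  \sum_(i < n) rnorm (c i *: iter i A x) <= M * rnorm x.
Proof.
rewrite (le_trans _ (ler_wpM2r (rnorm_ge0 x) (cM n))) // mulr_suml.
apply: ler_sum => i _; rewrite rnormZ -mulrA ler_wpM2l ?cnorm_ge0 //.
exact: (bounded_op_iter i a0 Aa).2.
Qed.

Lemma power_series_summable x : abs_summable (fun k => c k *: iter k A x).
Proof. exact: abs_summable_nat (power_series_term x). Qed.

Lemma power_series_bounded : bounded_op power_series M.
Proof.
split=> [d x y|x]; last first.
  by apply: usum_le; apply: abs_summable_natP; exact: power_series_term.
rewrite /power_series -usumZ; last exact: power_series_summable.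
rewrite -usumD; [|exact/abs_summableZ/power_series_summable|exact: power_series_summable].
congr usum; apply/funext => k.
by rewrite (bounded_op_iter k a0 Aa).1 scalerDr !scalerA [c k * d]mulrC.
Qed.

Lemma power_series_comm (B : V -> V) b x : bounded_op B b ->
  (forall x, A (B x) = B (A x)) -> power_series (B x) = B (power_series x).
Proof.
move=> Bb AB; rewrite /power_series (usum_bop Bb); last exact: power_series_summable.
by congr usum; apply/funext => k; rewrite (iter_comm _ _ AB) (bopZ Bb).
Qed.

End PowerSeries.

Section Neumann.
Variables (R : realType) (V : completeNormedModType R[i]).
Variables (A : V -> V) (a : R).
Hypotheses (a0 : 0 <= a) (a1 : a < 1) (Aa : bounded_op A a).

(** The commutation clause is kept because, through [neumann_shift], the inverse has to pass through
    the group, the bumps and V. *)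
Lemma neumann_inverse : exists N : V -> V,
  [/\ bounded_op N (1 - a)^-1, forall x, N x - A (N x) = x &
      forall (B : V -> V) b, bounded_op B b -> (forall x, A (B x) = B (A x)) ->
        forall x, N (B x) = B (N x)].
Proof.
have geo n : \sum_(i < n) cnorm (1 : R[i]) * a ^+ i <= (1 - a)^-1.
  have a1' : 0 < 1 - a by rewrite subr_gt0.
  under eq_bigr do rewrite cnorm1 mul1r.
  rewrite -[leLHS](mulKf (lt0r_neq0 a1')) ler_piMr ?invr_ge0 ?(ltW a1') //.
  have := subrX1 a n; have := exprn_ge0 n a0.
  by move: (a ^+ n) (\sum_(i < n) _) => u v; nra.
exists (power_series A (fun=> 1)); split.
- exact: (power_series_bounded (c := fun=> 1) a0 Aa geo).
- move=> x; have sF := power_series_summable (c := fun=> 1) a0 Aa geo x.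
  rewrite /power_series (usum_bop Aa sF) (usum_natS sF) /= scale1r.
  under [X in _ + usum X - _]funext do rewrite scale1r.
  by under [X in _ - usum X]funext do rewrite scale1r; rewrite addrK.
- by move=> B b Bb AB x; apply: (power_series_comm (c := fun=> 1) a0 Aa geo _ Bb).
Qed.

End Neumann.

Section Exponential.
Variables (R : realType) (V : completeNormedModType R[i]).
Implicit Types (A B : V -> V).

Let coef (k : nat) : R[i] := (k`!%:R)^-1.

Lemma cnorm_invfact k : cnorm (coef k) = (k`!%:R)^-1.
Proof. by rewrite /coef cnormV cnorm_nat. Qed.

Lemma exp_partial_le (a : R) n : 0 <= a ->
  \sum_(i < n) (i`!%:R)^-1 * a ^+ i <= expR a.
Proof.
move=> a0; rewrite /expR.
have -> : \sum_(i < n) (i`!%:R)^-1 * a ^+ i = series (exp_coeff a) n.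
  by rewrite /series /= big_mkord; apply: eq_bigr => i _; rewrite mulrC.
apply: nondecreasing_cvgn_le; last exact: is_cvg_series_exp_coeff.
by apply: nondecreasing_series => i _ _; exact: exp_coeff_ge0.
Qed.

Lemma exp_coef_le (a : R) n : 0 <= a ->
  \sum_(i < n) cnorm (coef i) * a ^+ i <= expR a.
Proof.
by move=> a0; under eq_bigr do rewrite cnorm_invfact; exact: exp_partial_le.
Qed.

Lemma expop_power_series A a : 0 <= a -> bounded_op A a ->
  expop A = power_series A coef.
Proof.
move=> a0 Aa; apply/funext => x; rewrite /expop lim_series_usum //.
exact: (power_series_summable a0 Aa (fun n => exp_coef_le n a0) x).
Qed.

Lemma expop_bounded A a : 0 <= a -> bounded_op A a -> bounded_op (expop A) (expR a).
Proof.
move=> a0 Aa; rewrite (expop_power_series a0 Aa).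
exact: (power_series_bounded a0 Aa (fun n => exp_coef_le n a0)).
Qed.

Lemma expop0 x : expop (fun _ : V => 0) x = x.
Proof.
rewrite (expop_power_series (lexx 0) (bounded_op0 V (lexx 0))) /power_series.
rewrite (@usum_fset _ _ _ _ [fset 0%N]%fset) ?big_seq_fset1 /= ?fact0 ?invr1 ?scale1r //.
  by rewrite /coef fact0 invr1 scale1r.
by case=> [|k]; rewrite inE ?eqxx // scaler0.
Qed.

Let D A k x := coef k *: iter k A x.

Let DS A a k x : bounded_op A a -> k.+1%:R *: D A k.+1 x = A (D A k x).
Proof.
move=> Aa; rewrite /D (bopZ Aa) scalerA /coef factS natrM invfM mulrA mulfV ?mul1r //.
Qed.

Let D_comm A B b k x : bounded_op B b -> (forall x, A (B x) = B (A x)) ->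
  D A k (B x) = B (D A k x).
Proof. by move=> Bb AB; rewrite /D (iter_comm _ _ AB) (bopZ Bb). Qed.

Let DD A B a b k x : 0 <= a -> 0 <= b -> bounded_op A a -> bounded_op B b ->
  (forall x, A (B x) = B (A x)) ->
  D (fun x => A x + B x) k x = \sum_(i < k.+1) D A i (D B (k - i) x).
Proof.
move=> a0 b0 Aa Bb AB; elim: k => [|k IH].
  by rewrite big_ord1 /D /coef /= fact0 invr1 !scale1r.
have k0 : (k.+1%:R : R[i]) != 0 by rewrite pnatr_eq0.
apply: (scalerI k0); rewrite (DS _ _ (bounded_opD Aa Bb)) IH (bop_sum Aa) (bop_sum Bb).
have -> : \sum_(i < k.+1) A (D A i (D B (k - i) x)) =
    \sum_(i < k.+2) i%:R *: D A i (D B (k.+1 - i) x).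
  rewrite [RHS]big_ord_recl scale0r add0r; apply: eq_bigr => i _.
  by rewrite lift0 subSS (DS _ _ Aa).
have -> : \sum_(i < k.+1) B (D A i (D B (k - i) x)) =
    \sum_(i < k.+2) (k.+1 - i)%:R *: D A i (D B (k.+1 - i) x).
  rewrite [RHS]big_ord_recr /= subnn scale0r addr0; apply: eq_bigr => i _.
  have ik : (i <= k)%N by rewrite -ltnS.
  have DAi := bounded_op_scale (coef i) (bounded_op_iter i a0 Aa).
  rewrite subSn // -(bopZ DAi) -/(D A i _) (DS _ _ Bb).
  by rewrite (D_comm _ _ Bb AB).
rewrite scaler_sumr -big_split /=; apply: eq_bigr => i _.
by rewrite -scalerDl -natrD subnKC // -ltnS.
Qed.

Let triangle (W : zmodType) (F : nat -> nat -> W) n :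
  \sum_(k < n) \sum_(i < k.+1) F i (k - i)%N =
  \sum_(i < n) \sum_(j < n | (i + j < n)%N) F i j.
Proof.
transitivity (\sum_(k < n) \sum_(i < n | (i < k.+1)%N) F i (k - i)%N).
  by apply: eq_bigr => k _; rewrite (big_ord_widen n (fun i => F i (k - i)%N)).
rewrite (exchange_big_dep xpredT) //=; apply: eq_bigr => i _.
rewrite -(big_mkord (fun k => i < k.+1)%N (fun k => F i (k - i)%N)).
rewrite -(big_mkord (fun j => i + j < n)%N (F i)).
have le_in := ltnW (ltn_ord i).
rewrite (big_cat_nat (n := i)) //= big_nat_cond big1 ?add0r; last first.
  by move=> k /andP[/andP[_ ki]]; rewrite ltnS leqNgt ki.
rewrite -{1}[i : nat]add0n big_addn [RHS](big_cat_nat (n := n - i)) ?leq_subr //=.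
rewrite [X in _ = _ + X]big_nat_cond [X in _ = _ + X]big1 ?addr0; last first.
  by move=> k /andP[/andP[]]; lia.
rewrite big_nat_cond [RHS]big_nat_cond; apply: eq_big => k; first by lia.
by rewrite addnK.
Qed.

Let t (a : R) (k : nat) : R := (k`!%:R)^-1 * a ^+ k.

Let t_ge0 a k : 0 <= a -> 0 <= t a k.
Proof. by move=> a0; rewrite mulr_ge0 ?invr_ge0 ?ler0n ?exprn_ge0. Qed.

Let tD a b k : t (a + b) k = \sum_(i < k.+1) t a i * t b (k - i).
Proof.
rewrite /t addrC exprDn mulr_sumr; apply: eq_bigr => i _.
have ik : (i <= k)%N by rewrite -ltnS.
have fact_neq0 m : (m`!%:R : R) != 0 by rewrite pnatr_eq0 -lt0n fact_gt0.
rewrite -[_ *+ 'C(k, i)]mulr_natr; have -> : 'C(k, i)%:R = (k`!%:R : R) / (i`!%:R * (k - i)`!%:R).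
  by rewrite -(bin_fact ik) !natrM mulfK // mulf_neq0.
by field; rewrite !fact_neq0.
Qed.

Let D_le A a k x : 0 <= a -> bounded_op A a -> rnorm (D A k x) <= t a k * rnorm x.
Proof.
move=> a0 Aa; rewrite /D rnormZ cnorm_invfact /t -mulrA ler_wpM2l ?invr_ge0 ?ler0n //.
exact: (bounded_op_iter k a0 Aa).2.
Qed.

Let exp_summable A a x : 0 <= a -> bounded_op A a -> abs_summable (fun k => D A k x).
Proof. by move=> a0 Aa; exact: (power_series_summable a0 Aa (fun n => exp_coef_le n a0) x). Qed.

(** The difference consists of the terms with i, j < n and i + j >= n. It is dominated by the same
    sum for the numbers a and b, which is at most e^{a+b} minus its n-th partial sum. *)
Let partial_product A B a b n x : 0 <= a -> 0 <= b -> bounded_op A a -> bounded_op B b ->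
  (forall x, A (B x) = B (A x)) ->
  rnorm (\sum_(i < n) D A i (\sum_(j < n) D B j x) -
         \sum_(k < n) D (fun x => A x + B x) k x)
  <= (expR (a + b) - \sum_(k < n) t (a + b) k) * rnorm x.
Proof.
move=> a0 b0 Aa Bb AB.
under [X in _ - X]eq_bigr do rewrite (DD _ _ a0 b0 Aa Bb AB).
rewrite (triangle (fun i j => D A i (D B j x))).
under [X in expR _ - X]eq_bigr do rewrite tD.
rewrite (triangle (fun i j => t a i * t b j)).
rewrite -sumrB; apply: le_trans (ler_rnorm_sum _ _ _) _.
have expab : \sum_(i < n) \sum_(j < n) t a i * t b j <= expR (a + b).
  under eq_bigr do rewrite -mulr_sumr.
  rewrite -mulr_suml expRD ler_pM ?exp_partial_le // sumr_ge0 // => i _; exact: t_ge0.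
apply: (@le_trans _ _ ((\sum_(i < n) \sum_(j < n) t a i * t b j -
  \sum_(i < n) \sum_(j < n | (i + j < n)%N) t a i * t b j) * rnorm x)); last first.
  by rewrite ler_wpM2r ?rnorm_ge0 // lerD2r.
rewrite -sumrB mulr_suml; apply: ler_sum => i _.
have DAi := bounded_op_scale (coef i) (bounded_op_iter i a0 Aa).
rewrite /D (bop_sum DAi) (bigID (fun j : 'I_n => i + j < n)%N) /= addrAC subrr add0r.
rewrite [X in (X - _) * _](bigID (fun j : 'I_n => i + j < n)%N) /= addrAC subrr add0r.
rewrite mulr_suml (le_trans (ler_rnorm_sum _ _ _)) //; apply: ler_sum => j _.
rewrite (le_trans (D_le _ _ a0 Aa)) // -[leRHS]mulrA ler_wpM2l ?t_ge0 //.
exact: D_le.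
Qed.

Lemma expopD A B a b x : 0 <= a -> 0 <= b -> bounded_op A a -> bounded_op B b ->
  (forall x, A (B x) = B (A x)) ->
  expop (fun x => A x + B x) x = expop A (expop B x).
Proof.
move=> a0 b0 Aa Bb AB; apply/eqP; rewrite -subr_eq0; apply/eqP.
apply: rnorm_le0_eq0 => e e0; have ABab := bounded_opD Aa Bb.
have ab0 : 0 <= a + b by rewrite addr_ge0.
have e4 : 0 < e / 4 by rewrite divr_gt0.
rewrite (expop_power_series ab0 ABab) (expop_power_series a0 Aa) (expop_power_series b0 Bb).
set y := power_series B coef x.
have [n1 H1] := usum_nat_near (exp_summable x ab0 ABab) e4.
have [n2 H2] := usum_nat_near (exp_summable y a0 Aa) e4.
have e4a : 0 < e / 4 / expR a by rewrite divr_gt0 ?expR_gt0.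
have [n3 H3] := usum_nat_near (exp_summable x b0 Bb) e4a.
have e4x : 0 < e / 4 / (1 + rnorm x) by rewrite divr_gt0 // ltr_wpDr ?rnorm_ge0.
have [n4 _ H4] : \forall n \near \oo, expR (a + b) - \sum_(k < n) t (a + b) k
    <= e / 4 / (1 + rnorm x).
  have /cvgrPdist_le /(_ _ e4x) := @is_cvg_series_exp_coeff R (a + b).
  rewrite -/(expR (a + b)); apply: filterS => n; rewrite /series /= big_mkord => h.
  apply: le_trans (ler_norm _) _; apply: le_trans h; rewrite le_eqVlt; apply/orP; left.
  by apply/eqP; congr (`|_ - _|); apply: eq_bigr => k _; rewrite /t mulrC.
pose n := maxn (maxn n1 n2) (maxn n3 n4).
have [n1n n2n n3n n4n] : [/\ n1 <= n, n2 <= n, n3 <= n & n4 <= n]%N.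
  by rewrite /n !leq_max !leqnn !orbT.
have {}H1 := H1 n n1n; have {}H2 := H2 n n2n.
have {}H3 := H3 n n3n; have {}H4 := H4 n n4n.
have HP := partial_product n x a0 b0 Aa Bb AB.
rewrite -/(power_series _ _ _) in H1; rewrite -/(power_series A coef y) in H2.
rewrite -/(power_series B coef x) -/y in H3.
have {}H3 : rnorm (\sum_(i < n) D A i y - \sum_(i < n) D A i (\sum_(j < n) D B j x)) <= e / 4.
  rewrite -sumrB (le_trans (ler_rnorm_sum _ _ _)) //.
  apply: (@le_trans _ _ (\sum_(i < n) t a i * (e / 4 / expR a))).
    apply: ler_sum => i _; have DAi := bounded_op_scale (coef i) (bounded_op_iter i a0 Aa).
    by rewrite -(bopB DAi) (le_trans (D_le _ _ a0 Aa)) // ler_wpM2l ?t_ge0.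
  rewrite -mulr_suml mulrC -[leRHS](divfK (lt0r_neq0 (expR_gt0 a))) ler_wpM2l ?(ltW e4a) //.
  exact: exp_partial_le.
have {}HP := le_trans HP (ler_wpM2r (rnorm_ge0 x) H4).
have {}HP : rnorm (\sum_(i < n) D A i (\sum_(j < n) D B j x) -
         \sum_(k < n) D (fun x => A x + B x) k x) <= e / 4.
  apply: le_trans HP _; rewrite mulrAC ler_pdivrMr ?ltr_wpDr ?rnorm_ge0 //.
  by rewrite ler_wpM2l ?(ltW e4) // lerDr.
rewrite rdistC in H2; rewrite rdistC in H3; rewrite rdistC in HP.
rewrite (_ : e = e / 4 + (e / 4 + (e / 4 + e / 4))); last by field.
apply: le_trans (ler_rdistD _ _ _) (lerD H1 _).
apply: le_trans (ler_rdistD _ _ _) (lerD HP _).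
exact: le_trans (ler_rdistD _ _ _) (lerD H3 H2).
Qed.

End Exponential.

(** * Open mapping theorem for the map sending (y_j) to sum_j A_j y_j *)

Section OpenMapping.
Variables (R : realType) (V : completeNormedModType R[i]).

Lemma rnorm_cauchy_cvg (u : nat -> V) :
  (forall e : R, 0 < e -> exists N, forall n, (N <= n)%N -> rnorm (u N - u n) <= e) ->
  exists l, forall e : R, 0 < e -> exists N, forall n, (N <= n)%N -> rnorm (l - u n) <= e.
Proof.
move=> H; suff /cvg_ex[l ul] : cvg (u @ \oo).
  exists l => e e0; move/cvg_rnormP : ul => /(_ _ e0)[N _ HN].
  by exists N => n Nn; apply: HN.
apply: cauchy_cvg; apply: cauchy_rnormP => e e0.
by have [N HN] := H e e0; exists (u N); exists N.
Qed.

Variables (n : nat) (A : 'I_n -> V -> V) (a : R).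
Hypothesis Aa : forall j, bounded_op (A j) a.
Hypothesis surj : forall x, exists y : 'I_n -> V, x = \sum_j A j (y j).

Let F (k : nat) (x : V) := exists y : 'I_n -> V,
  (forall j, rnorm (y j) <= k%:R) /\ x = \sum_j A j (y j).

(** Baire's argument by hand. If no [F k] came arbitrarily close to every point of some ball,
    shrinking balls could be chosen so that the one built at step k stays away from [F k]; their
    centres would converge to a point in no [F k], against [surj]. *)
Lemma baire_ball : exists (k : nat) (c : V) (r : R), 0 < r /\
  forall x, rnorm (x - c) <= r -> forall e, 0 < e ->
    exists2 y, F k y & rnorm (x - y) <= e.
Proof.
apply: contrapT => H.
(* Positivity of the radius is a premise of the conclusion, so that [choice] yields a total
   function; for other triples the witness is arbitrary. *)
have step (p : nat * V * R) : exists q : V * R, 0 < p.2 ->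
    [/\ 0 < q.2, q.2 <= p.2 / 2, rnorm (q.1 - p.1.2) <= p.2 / 2 &
        forall y, F p.1.1 y -> q.2 < rnorm (q.1 - y)].
  case: p => -[k c] r /=; have [r0|r0] := ltP 0 r; last by exists (0, 0).
  have r2 : 0 < r / 2 by rewrite divr_gt0.
  apply: contrapT => H'; apply: H; exists k, c, (r / 2); split => // x xc e e0.
  apply: contrapT => H''; apply: H'; exists (x, Num.min e (r / 2)) => _; split => //=.
  - by rewrite lt_min e0.
  - by rewrite ge_min lexx orbT.
  - move=> y Fy; rewrite gt_min; apply/orP; left; rewrite ltNge; apply/negP => ye.
    by apply: H''; exists y.
have [g gP] := choice step.
pose u := fix u (k : nat) : V * R := if k is k'.+1 then g (k', (u k').1, (u k').2) else (0, 1).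
have u0 k : 0 < (u k).2.
  by elim: k => [|k IH] //=; have [] := gP (k, (u k).1, (u k).2) IH.
have uS k := gP (k, (u k).1, (u k).2) (u0 k); rewrite /= in uS.
have ur k : (u k).2 <= 2^-1 ^+ k.
  elim: k => [|k IH]; first by rewrite expr0.
  have [_ le _ _] := uS k; rewrite exprSr; apply: le_trans le _.
  by rewrite ler_pM2r // invr_gt0.
have nest k m : rnorm ((u (k + m)%N).1 - (u k).1) <= (u k).2 - (u (k + m)%N).2.
  elim: m => [|m IH]; first by rewrite addn0 !subrr rnorm0.
  rewrite addnS; have [_ le1 le2 _] := uS (k + m)%N.
  apply: le_trans (ler_rdistD (u (k + m)%N).1 _ _) _; move: IH le1 le2 => /=; lra.
have nest' k m : rnorm ((u (k + m)%N).1 - (u k).1) <= (u k).2.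
  by apply: le_trans (nest k m) _; rewrite lerBlDr lerDl ltW.
have [|l ul] := @rnorm_cauchy_cvg (fun k => (u k).1).
  move=> e e0; have [N _ HN] : \forall k \near \oo, (2^-1 : R) ^+ k <= e.
    have /cvgrPdist_le /(_ _ e0) : (2^-1 : R) ^+ k @[k --> \oo] --> (0 : R).
      by apply: cvg_expr; rewrite ger0_norm ?invr_ge0 // invf_lt1 // ltr1n.
    by apply: filterS => k; rewrite sub0r normrN ger0_norm // exprn_ge0 ?invr_ge0.
  exists N => m Nm; rewrite rdistC -(subnKC Nm) (le_trans (nest' _ _)) //.
  by rewrite (le_trans (ur _)) // HN //=.
have ulk k : rnorm (l - (u k).1) <= (u k).2.
  apply/ler_addgt0Pr => e e0; have [N HN] := ul _ e0.
  rewrite [leRHS]addrC (le_trans (ler_rdistD (u (k + N)%N).1 _ _)) // lerD //.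
  by rewrite HN // leq_addl.
have [y yl] := surj l.
pose k := Num.bound (\sum_j rnorm (y j)).
have Fkl : F k l.
  exists y; split => // j; apply: ltW; apply: le_lt_trans (archi_boundP _).
    by rewrite (bigD1 j) //= lerDl sumr_ge0 // => i _; exact: rnorm_ge0.
  by rewrite sumr_ge0 // => i _; exact: rnorm_ge0.
have [_ _ _ /(_ l Fkl)] := uS k; rewrite rdistC ltNge.
by rewrite -[g _]/(u k.+1) ulk.
Qed.

Lemma approx_surj : exists2 C : R, 0 <= C & forall x, exists y : 'I_n -> V,
  (forall j, rnorm (y j) <= C * rnorm x) /\
  rnorm (x - \sum_j A j (y j)) <= rnorm x / 2.
Proof.
have [k [c [r [r0 H]]]] := baire_ball.
exists ((k + k)%:R / r); first by rewrite divr_ge0 // ltW.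
move=> x; have [->|x0] := eqVneq x 0.
  exists (fun=> 0); rewrite rnorm0 mulr0; split=> //.
  by rewrite big1 ?subr0 ?rnorm0 ?mul0r // => j _; rewrite (bop0 (Aa j)).
have nx : 0 < rnorm x by rewrite lt_neqAle rnorm_ge0 eq_sym rnorm_eq0 x0.
pose s := r / rnorm x; have s0 : 0 < s by rewrite divr_gt0.
have e0 : 0 < r / 4 by rewrite divr_gt0.
have sC : (s%:C != 0 :> R[i]) by rewrite (inj_eq (@complexI _)) gt_eqF.
(* Both c + s x and c lie in the ball. Subtracting their approximations leaves an error r/2 for s x
   with s = r/|x|, hence |x|/2 for x. *)
have [|y1 [w1 [w1k ->]] h1] := H (c + s%:C *: x) _ _ e0.
  by rewrite addrC addrA addNr add0r rnormZ cnormR gtr0_norm // divfK // gt_eqF.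
have [|y2 [w2 [w2k ->]] h2] := H c _ _ e0.
  by rewrite subrr rnorm0 ltW.
exists (fun j => s^-1%:C *: (w1 j - w2 j)); split=> [j|].
  rewrite rnormZ cnormR gtr0_norm ?invr_gt0 // /s invf_div natrD.
  rewrite [leLHS]mulrAC [leRHS]mulrAC ler_pM2r ?invr_gt0 // [leLHS]mulrC.
  rewrite ler_pM2r // (le_trans (ler_rnormB _ _)) // lerD //.
have -> : x - \sum_j A j (s^-1%:C *: (w1 j - w2 j)) =
    s^-1%:C *: ((c + s%:C *: x - \sum_j A j (w1 j)) - (c - \sum_j A j (w2 j))).
  under eq_bigr do rewrite (bopZ (Aa _)) (bopB (Aa _)).
  rewrite -scaler_sumr sumrB [in RHS]opprB [X in _ = _ *: X]addrC -[c + _ - _]addrA subrKA.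
  rewrite addrCA -[\sum_j A j (w2 j) - _]opprB [in RHS]scalerBr scalerA -rmorphM mulVf //=.
    by rewrite scale1r.
  by rewrite gt_eqF.
rewrite rnormZ cnormR gtr0_norm ?invr_gt0 // /s invf_div.
apply: le_trans (ler_wpM2l _ (le_trans (ler_rnormB _ _) (lerD h1 h2))) _.
  by rewrite divr_ge0 // ltW.
by rewrite -mulrA ler_wpM2l ?(ltW nx) // mulrC ler_pdivrMr //; lra.
Qed.

(** Correcting the remainder again and again halves it each time, so the corrections form series
    dominated by a geometric one of ratio 1/2; this doubles the constant. *)
Lemma bounded_surj : exists2 C : R, 0 <= C & forall x, exists y : 'I_n -> V,
  (forall j, rnorm (y j) <= C * rnorm x) /\ x = \sum_j A j (y j).
Proof.
have [C C0 H] := approx_surj; have [w wP] := choice H.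
exists (C * 2); first by rewrite mulr_ge0.
move=> x; pose r := fix r k := if k is k'.+1 then r k' - \sum_j A j (w (r k') j) else x.
have rk k : rnorm (r k) <= rnorm x * 2^-1 ^+ k.
  elim: k => [|k IH]; first by rewrite expr0 mulr1.
  rewrite /= (le_trans (wP _).2) // exprSr mulrA ler_pM2r //.
have geo k : \sum_(i < k) (2^-1 : R) ^+ i <= 2.
  have := subrX1 (2^-1 : R) k; have := exprn_ge0 k (_ : 0 <= 2^-1 :> R).
  by rewrite invr_ge0 ler0n => /(_ isT); lra.
have sw j k : \sum_(i < k) rnorm (w (r i) j) <= C * 2 * rnorm x.
  apply: (@le_trans _ _ (\sum_(i < k) C * rnorm x * 2^-1 ^+ i)).
    by apply: ler_sum => i _; rewrite (le_trans ((wP _).1 j)) // -mulrA ler_wpM2l.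
  by rewrite -mulr_sumr [leRHS]mulrAC ler_wpM2l ?mulr_ge0 ?rnorm_ge0.
have sw' j : abs_summable (fun i => w (r i) j) := abs_summable_nat (sw j).
exists (fun j => usum (fun i => w (r i) j)); split=> [j|].
  by apply: usum_le; apply: abs_summable_natP; exact: sw.
under eq_bigr => j _ do rewrite (usum_bop (Aa j) (sw' j)).
have sAw j : abs_summable (fun i => A j (w (r i) j)) := abs_summable_bop (Aa j) (sw' j).
rewrite -(usum_sum _ _ sAw).
set v := fun i => \sum_j A j (w (r i) j).
have sv : abs_summable v.
  exact: abs_summable_sum sAw.
apply/eqP; rewrite -subr_eq0; apply/eqP; apply: rnorm_le0_eq0 => e e0.
have e2 : 0 < e / 2 by rewrite divr_gt0.
have [N HN] := usum_nat_near sv e2.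
have [N' HN'] : exists N', forall k, (N' <= k)%N -> rnorm (r k) <= e / 2.
  have xe : 0 < e / 2 / (1 + rnorm x) by rewrite divr_gt0 // ltr_wpDr ?rnorm_ge0.
  have /cvgrPdist_le /(_ _ xe)[N' _ H'] : (2^-1 : R) ^+ k @[k --> \oo] --> (0 : R).
    by apply: cvg_expr; rewrite ger0_norm ?invr_ge0 // invf_lt1 // ltr1n.
  exists N' => k Nk; apply: le_trans (rk k) _; have := H' k Nk.
  rewrite /= sub0r normrN ger0_norm ?exprn_ge0 ?invr_ge0 // => h.
  apply: le_trans (ler_wpM2l (rnorm_ge0 x) h) _.
  rewrite mulrC mulrAC ler_pdivrMr ?ltr_wpDr ?rnorm_ge0 //.
  by rewrite ler_wpM2l ?(ltW e2) // lerDr.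
have rE k : x - r k = \sum_(i < k) v i.
  elim: k => [|k IH]; first by rewrite subrr big_ord0.
  by rewrite big_ord_recr -IH /= opprB addrCA addrC.
have := HN (maxn N N') (leq_maxl _ _); have := HN' (maxn N N') (leq_maxr _ _).
rewrite -rE; set k := maxn _ _ => h1 h2; rewrite rdistC [e]splitr.
rewrite (le_trans _ (lerD h2 h1)) // (le_trans _ (ler_rnormB _ _)) //.
by rewrite opprB addrA addrAC addrK.
Qed.

End OpenMapping.

Definition cis (R : realType) (u : R) : R[i] := cos u +i* sin u.

Section Cis.
Variable R : realType.
Implicit Types u v : R.

Lemma cisD u v : cis (u + v) = cis u * cis v.
Proof.
rewrite /cis cosD sinD; apply/eqP; rewrite eq_complex /= eqxx /=.
by apply/eqP; ring.
Qed.

Lemma cis0 : cis (0 : R) = 1.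
Proof. by rewrite /cis cos0 sin0. Qed.

Lemma cnorm_cis u : cnorm (cis u) = 1.
Proof.
apply/eqP; rewrite -(@eqrXn2 _ 2) ?cnorm_ge0 // cnorm_sqr /= expr1n.
by rewrite sin2cos2 addrCA subrr addr0.
Qed.

Lemma cis_neq0 u : cis u != 0.
Proof. by rewrite -cnorm_eq0 cnorm_cis oner_eq0. Qed.

Lemma cisN u : cis (- u) = (cis u)^-1.
Proof. by apply: (mulIf (cis_neq0 u)); rewrite -cisD addNr cis0 mulVf ?cis_neq0. Qed.

Lemma cis_sum I (r : seq I) (P : pred I) (F : I -> R) :
  cis (\sum_(i <- r | P i) F i) = \prod_(i <- r | P i) cis (F i).
Proof. by elim/big_ind2: _ => [|a b c d <- <-|//]; rewrite ?cis0 ?cisD. Qed.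

Lemma cis_nat (n : nat) u : cis (n%:R * u) = cis u ^+ n.
Proof.
elim: n => [|n IH]; first by rewrite mul0r cis0 expr0.
by rewrite -natr1 mulrDl mul1r cisD IH exprSr.
Qed.

Lemma cis_sub1_sqr u : cnorm (1 - cis u) ^+ 2 = 2 - 2 * cos u.
Proof.
rewrite cnorm_sqr /=; have := sin2cos2 u.
by move: (sin u) (cos u) => s c h; rewrite sub0r sqrrN h; ring.
Qed.

Lemma cis_neq1 u : 0 < u < 2 * pi -> cis u != 1.
Proof.
move=> u2; suff c1 : cos u < 1.
  by rewrite eq_complex /=; apply/negP => /andP[/eqP] c _; rewrite c ltxx in c1.
have cp v : 0 < v <= pi -> cos v < 1.
  move=> /andP[v0 vp]; rewrite -[ltRHS]cos0 ltr_cos ?in_itv /= ?lexx ?pi_ge0 ?vp ?ltW //.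
have [up|up] := leP u pi; first by apply: cp; rewrite up andbT; case/andP: u2.
rewrite -cosN -(cosD2pi (- u)) mulr2n; apply: cp.
by move: u2 up; rewrite mulrDl !mul1r => /andP[]; lra.
Qed.

Lemma powi (z : R) k : (z *i) ^+ k =
  (if odd k then 0 else (-1) ^+ k./2 * z ^+ k) +i* (if odd k then (-1) ^+ k./2 * z ^+ k else 0).
Proof.
elim: k => [|k IH]; first by rewrite !expr0 mulr1.
rewrite exprS IH /= uphalf_half; case: (odd k) => /=; apply/eqP;
  rewrite eq_complex /= !(mul0r, mulr0, sub0r, add0r, addr0) ?oppr0 eqxx ?andbT /=;
  apply/eqP; rewrite ?add1n ?add0n ?exprS; ring.
Qed.

Lemma usum_cis (z : R) :
  usum (fun k => (k`!%:R : R[i])^-1 * (z *i) ^+ k : complex_line R) = cis z.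
Proof.
have cn k : cnorm (z *i ^+ k) = `|z| ^+ k.
  rewrite cnormX; congr (_ ^+ _); apply/eqP; rewrite -(@eqrXn2 _ 2) ?cnorm_ge0 //.
  by rewrite cnorm_sqr /= expr0n /= add0r real_normK ?num_real.
rewrite -lim_series_usum; last first.
  apply: (@abs_summable_nat _ _ _ (expR `|z|)) => n.
  apply: le_trans (exp_partial_le n (normr_ge0 z)).
  by apply: ler_sum => k _; rewrite -/(cnorm _) cnormM cnorm_invfact cn.
apply: cvg_lim => //; apply/cvg_rnormP => e e0.
have e2 : 0 < e / 2 by rewrite divr_gt0.
have /cvgrPdist_le /(_ _ e2) := @is_cvg_series_cos_coeff R z.
have /cvgrPdist_le /(_ _ e2) := @is_cvg_series_sin_coeff R z.
have -> : lim (series (cos_coeff z) @ \oo) = cos z by rewrite unlock.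
have -> : lim (series (sin_coeff z) @ \oo) = sin z by rewrite unlock.
apply: filterS2 => n hs hc.
apply: le_trans (cnorm_le (cis z - _)) _.
have -> : series (fun k => (k`!%:R : R[i])^-1 * (z *i) ^+ k : complex_line R) n =
    series (cos_coeff z) n +i* series (sin_coeff z) n.
  rewrite /series /=; elim: n {hs hc} => [|n IH]; first by rewrite !big_geq.
  rewrite !big_nat_recr //= IH powi /cos_coeff /sin_coeff.
  have -> : (n`!%:R^-1 : R[i]) = (n`!%:R^-1 : R)%:C by rewrite fmorphV rmorph_nat.
  apply/eqP; rewrite eq_complex /=.
  have hn : odd n -> n.-1./2 = n./2 by case: n {IH} => //= n; rewrite uphalf_half => /negbTE ->.
  rewrite -exprnP; case: (odd n) hn => /= [->|_] //; apply/andP; split; apply/eqP; congr (_ + _);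
    rewrite !(mul0r, mulr0, subr0, addr0, add0r, mul1r, oppr0) // mulrC //.
by rewrite /= [e]splitr lerD.
Qed.

Lemma expop_scale (V : completeNormedModType R[i]) (z : R) (x : V) :
  expop (fun y => z *i *: y) x = cis z *: x.
Proof.
have zV := bounded_opZ V (z *i).
have zC := bounded_opZ (complex_line R) (z *i).
rewrite (expop_power_series (cnorm_ge0 _) zV) /power_series -usum_cis.
have xb : bounded_op (fun c : complex_line R => c *: x) (rnorm x).
  split=> [c d e|c]; first by rewrite scalerDl -scalerA.
  by rewrite rnormZ mulrC.
rewrite (usum_bop xb).
  congr usum; apply/funext => k; rewrite -scalerA; congr (_ *: _).
  by elim: k => [|k IH]; rewrite ?scale1r //= IH exprS scalerA.
have sC := power_series_summable (cnorm_ge0 _) zC (fun n => exp_coef_le n (cnorm_ge0 _))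
  ((1 : R[i]) : complex_line R).
move: sC; congr (abs_summable _); apply/funext => k; congr (_ * _).
by elim: k => [|k IH] //=; rewrite exprS IH.
Qed.

End Cis.

(** * Koszul exactness and the joint spectrum *)

Lemma continuous_bounded_op (R : realType) (V W : normedModType R[i]) (f : {linear V -> W}) :
  continuous f -> exists2 a : R, 0 <= a & bounded_op f a.
Proof.
move=> /linear_bounded_continuous/linear_boundedP/pinfty_ex_gt0[r r0 fr].
have rE : r = (complex.Re r)%:C by rewrite RRe_real // gtr0_real.
exists (complex.Re r); first by rewrite -lecR -rE ltW.
split=> [c x y|x]; first by rewrite linearP.
by have := fr x; rewrite rE !rnormE -rmorphM lecR.
Qed.

Section ExpFactor.
Variables (R : realType) (V : completeNormedModType R[i]).

(** [Y] is the sum of A^k/(k+1)! over k >= 1. Since (k+1)! >= 2^k and a/2 <= 3/8, its norm is at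
    most the sum of (3/8)^k, that is 3/5. Being below 1, this makes 1 + Y invertible, so e^A - 1 is
    A times an invertible operator. *)
Lemma expop_factor (A : V -> V) (a : R) : 0 <= a -> a <= 3 / 4 -> bounded_op A a ->
  exists Y : V -> V, [/\ bounded_op Y (3 / 5),
    forall (B : V -> V) b x, bounded_op B b -> (forall x, A (B x) = B (A x)) -> Y (B x) = B (Y x) &
    forall x, expop A x = x + A (x + Y x)].
Proof.
move=> a0 a34 Aa.
pose c (k : nat) : R[i] := if k is 0 then 0 else (k.+1`!%:R)^-1.
have cb m : \sum_(i < m) cnorm (c i) * a ^+ i <= 3 / 5.
  case: m => [|m]; first by rewrite big_ord0 divr_ge0.
  rewrite big_ord_recl /= cnorm0 mul0r add0r.
  have h i : cnorm (c (lift ord0 i)) * a ^+ (lift ord0 i) <= (3 / 8) * (3 / 8) ^+ (i : 'I_m).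
    rewrite lift0 /= cnorm_invfact -exprS.
    have h2 : (2 ^+ i.+1 : R) <= (i.+2)`!%:R.
      rewrite -natrX ler_nat; elim: (i : nat) => // k IH.
      by rewrite expnS [k.+3`!]factS leq_mul.
    have fp : 0 < (i.+2)`!%:R :> R by rewrite ltr0n fact_gt0.
    rewrite mulrC ler_pdivrMr // (_ : 3 / 8 = 3 / 4 / 2 :> R); last by field.
    rewrite expr_div_n -mulrA; apply: (@le_trans _ _ ((3 / 4) ^+ i.+1)).
      by rewrite lerXn2r // nnegrE // divr_ge0.
    rewrite ler_peMr ?exprn_ge0 ?divr_ge0 // mulrC ler_pdivlMr ?exprn_gt0 //.
    by rewrite mul1r.
  apply: (le_trans (ler_sum _ (fun i _ => h i))); rewrite -mulr_sumr.
  have := subrX1 (3 / 8 : R) m; have := exprn_ge0 m (_ : 0 <= 3 / 8 :> R).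
  rewrite divr_ge0 // => /(_ isT).
  by move: (_ ^+ m) (\sum_(i < m) _) => u v; lra.
exists (power_series A c); split.
- exact: power_series_bounded a0 Aa cb.
- by move=> B b x Bb AB; exact: (power_series_comm a0 Aa cb _ Bb).
move=> x; rewrite (expop_power_series a0 Aa) /power_series.
have sE := power_series_summable a0 Aa (fun n => exp_coef_le n a0) x.
have sY := power_series_summable a0 Aa cb x.
rewrite (usum_natS sE) (usum_natS (abs_summable_natS sE)) /= fact0 invr1 scale1r.
rewrite (bopD Aa) (usum_bop Aa sY) (usum_natS (abs_summable_bop Aa sY)) /=.
rewrite scale0r (bop0 Aa) add0r scale1r; congr (_ + (_ + usum _)).
by apply/funext => k; rewrite (bopZ Aa).
Qed.

Lemma expop_sub_le (A : V -> V) (a : R) x : 0 <= a -> a <= 3 / 4 -> bounded_op A a ->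
  rnorm (expop A x - x) <= 2 * a * rnorm x.
Proof.
move=> a0 a34 Aa; have [Y [Yb _ ->]] := expop_factor a0 a34 Aa.
rewrite [x + _]addrC addrK (le_trans (Aa.2 _)) // [2 * a]mulrC -mulrA ler_wpM2l //.
rewrite (le_trans (ler_rnormD _ _)) //; have := Yb.2 x; have := rnorm_ge0 x; lra.
Qed.

End ExpFactor.

Section Koszul.
Local Open Scope set_scope.
Variables (R : realType) (X : completeNormedModType R[i]) (n : nat).
Variables (B : 'I_n -> X -> X) (b : 'I_n -> R).
Hypothesis Bb : forall j, bounded_op (B j) (b j).

(** Exactness is tested in top degree only: a form carried by the full index set is always a
    cocycle, and to be a coboundary means exactly that its value is a sum of the B_j y_j. *)
Lemma koszul_exact_surj :
  (forall f : {ffun {set 'I_n} -> X}, koszul B f = 0 -> exists g, f = koszul B g) ->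
  forall x, exists y : 'I_n -> X, x = \sum_j B j (y j).
Proof.
move=> ex x; have [|g fg] := ex [ffun S => if S == [set: 'I_n] then x else 0].
  apply/ffunP => S; rewrite !ffunE big1 // => j jS; rewrite ffunE.
  case: eqP => [E|_]; last by rewrite (bop0 (Bb j)) scaler0.
  by move/setP/(_ j) : E; rewrite !inE eqxx.
exists (fun j : 'I_n => (-1) ^+ #|[set k in [set: 'I_n] | (k < j)%N]| *: g ([set: 'I_n] :\ j)).
move/ffunP : fg => /(_ [set: 'I_n]); rewrite !ffunE eqxx => ->.
by apply: eq_big => [j|j _]; rewrite ?inE // (bopZ (Bb j)).
Qed.

(** Contraction with e_i followed by the inverse [N] of B_i is a contracting homotopy; it commutes
    past the other B_j up to the sign counted by [m]. *)
Lemma koszul_exact_inverse (i : 'I_n) (N : X -> X) (c : R) : bounded_op N c ->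
  (forall x, N (B i x) = x) -> (forall x, B i (N x) = x) ->
  (forall j x, N (B j x) = B j (N x)) ->
  forall f : {ffun {set 'I_n} -> X}, koszul B f = 0 -> exists g, f = koszul B g.
Proof.
move=> Nc NB BN Ncomm f f0.
pose m (S : {set 'I_n}) (j : 'I_n) := #|[set k in S | (k < j)%N]|.
have mD1 (S : {set 'I_n}) (j k : 'I_n) : j \in S -> m S k = ((j < k) + m (S :\ j) k)%N.
  move=> jS; rewrite /m (cardsD1 j) !inE jS /=; congr (_ + _)%N.
  by apply: eq_card => l; rewrite !inE andbA.
exists [ffun S : {set 'I_n} => if i \in S then 0 else (-1) ^+ m S i *: N (f (i |: S))].
apply/ffunP => S; rewrite ffunE; have [iS|iS] := boolP (i \in S).
  rewrite (bigD1 i) //= big1 ?addr0; last first.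
    move=> j /andP[jS ji]; rewrite ffunE !inE eq_sym ji iS /=.
    by rewrite (bop0 (Bb j)) scaler0.
  rewrite ffunE !inE eqxx /= finset.setD1K // (bopZ (Bb i)) BN scalerA -/(m S i).
  by rewrite (mD1 _ _ _ iS) ltnn add0n -exprD addnn -signr_odd odd_double scale1r.
(* For S without i, the cocycle condition at [i |: S] is solved for its term j = i, which contains f
   S. *)
have := congr1 (fun h : {ffun {set 'I_n} -> X} => N (h (i |: S))) f0.
rewrite !ffunE (bop0 Nc) (big_setD1 i) ?finset.setU11 //= finset.setU1K // (bopD Nc) (bopZ Nc) NB.
rewrite (bop_sum Nc) -/(m (i |: S) i) (mD1 (i |: S) i i) ?finset.setU11 // ltnn add0n finset.setU1K //.
move/eqP; rewrite addr_eq0 => /eqP/(congr1 (fun x => (-1) ^+ m S i *: x)).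
rewrite scalerA -exprD addnn -signr_odd odd_double scale1r => ->.
rewrite scalerN scaler_sumr -sumrN; apply: eq_bigr => j jS.
have ij : i != j by apply: contraNneq iS => ->.
rewrite (bopZ Nc) Ncomm scalerA ffunE !inE (negbTE iS) andbF /=.
rewrite (bopZ (Bb j)) scalerA -scaleNr; congr (_ *: B j (N (f _))); last first.
  by apply/setP => k; rewrite !inE; case: (eqVneq k i) => [->|]; rewrite ?ij.
rewrite -/(m _ _) -/(m S j) (mD1 (i |: S) i j) ?finset.setU11 // finset.setU1K // (mD1 S j i) //.
(* Exactly one of i < j and j < i holds, so the two sign exponents differ in parity. *)
rewrite -!exprD -[LHS]mulN1r -exprS -[LHS]signr_odd -[RHS]signr_odd; congr (_ ^+ nat_of_bool _).
rewrite /= !oddD !oddb; case: ltngtP (ij) => // [||/val_inj ->]; rewrite ?eqxx // => _ _;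
  by case: (odd _); case: (odd _).
Qed.

End Koszul.

Lemma neumann_shift (R : realType) (V : completeNormedModType R[i]) (A : V -> V) (a : R) (u : R[i]) :
  0 <= a -> a < cnorm u -> bounded_op A a ->
  exists N c, [/\ bounded_op N c, forall x, N (A x - u *: x) = x, forall x, A (N x) - u *: N x = x &
    forall (B : V -> V) b x, bounded_op B b -> (forall x, A (B x) = B (A x)) -> N (B x) = B (N x)].
Proof.
move=> a0 au Aa; have u0 : 0 < cnorm u := le_lt_trans a0 au.
have uN0 : u != 0 by rewrite -cnorm_eq0 gt_eqF.
have Qb := bounded_op_scale u^-1 Aa; rewrite cnormV in Qb.
have [||N [Nb NQ Ncomm]] := neumann_inverse _ _ Qb.
- by rewrite mulr_ge0 // invr_ge0 cnorm_ge0.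
- by rewrite mulrC ltr_pdivrMr // mul1r.
have QA B b : bounded_op B b -> (forall x, A (B x) = B (A x)) ->
    forall x, N (B x) = B (N x).
  move=> Bb AB; apply: (Ncomm _ _ Bb) => x; by rewrite AB (bopZ Bb).
have E x : A x - u *: x = - u *: (x - u^-1 *: A x).
  by rewrite scaleNr scalerBr scalerA divff // scale1r opprB.
have Au := bounded_opD Aa (bounded_opN (bounded_opZ V u)).
have R1 x : A (- u^-1 *: N x) - u *: (- u^-1 *: N x) = x.
  rewrite E (bopZ Aa) scalerA [u^-1 * _]mulrC -scalerA -scalerBr NQ scalerA.
  by rewrite mulrNN divff // scale1r.
exists (fun x => - u^-1 *: N x), (cnorm (- u^-1) * (1 - (cnorm u)^-1 * a)^-1).
split=> //.
- exact: bounded_op_scale.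
- by move=> x; rewrite (QA _ _ Au) -?(bopZ Au) ?R1 // => y; rewrite (bopB Aa) (bopZ Aa).
- by move=> B b x Bb AB; rewrite (QA _ _ Bb AB) (bopZ Bb).
Qed.

(** Since |1 - e^{iz}|^2 = 2 - 2 cos z, this keeps |1 - e^{iz}| at least |1 - e^{i/2}| on the range
    where points near the grid may lie. *)
Lemma cos_le_half (R : realType) (z : R) : 1 / 2 <= `|z| <= 2 * pi - 1 / 2 -> cos z <= cos (1 / 2).
Proof.
have p2 := @pi_ge2 R.
have cp v : 1 / 2 <= v <= pi -> cos v <= cos (1 / 2 : R).
  move=> /andP[v0 vp]; rewrite leNgt ltr_cos ?in_itv /=; first by rewrite -leNgt.
    by apply/andP; split; lra.
  by apply/andP; split; lra.
have -> : cos z = cos `|z| by case: (ger0P z) => // _; rewrite cosN.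
move: `|z| => v /andP[v1 v2]; have [vp|vp] := leP v pi; first by apply: cp; rewrite v1.
by rewrite -cosN -(cosD2pi (- v)) mulr2n; apply: cp; move: v2; rewrite mulrDl !mul1r; lra.
Qed.

Section Spectrum.
Variables (R : realType) (X : completeNormedModType R[i]) (n : nat).
Variables (T : 'I_n -> X -> X) (a : R).
Hypotheses (a0 : 0 <= a) (Ta : forall j, bounded_op (T j) a).
Hypothesis Tcomm : forall i j x, T i (T j x) = T j (T i x).

Let shift_bounded (u : R[i]) j : bounded_op (fun x => T j x - u *: x) (a + cnorm u).
Proof. exact: (bounded_opD (Ta j) (bounded_opN (bounded_opZ X u))). Qed.

(** If |z_i| > a, the Neumann series inverts T_i - z_i, and one invertible member with commuting
    inverse makes the Koszul complex exact. *)
Lemma joint_spectrum_bounded (z : 'rV[R]_n) i : joint_spectrum T z -> `|z 0 i| <= a.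
Proof.
move=> zS; rewrite leNgt; apply/negP => az; apply: zS.
rewrite -cnormR in az; have [N [c [Nc NB BN Ncomm]]] := neumann_shift a0 az (Ta i).
pose B j x := T j x - (map_mx (fun u : R => u%:C) z) 0 j *: x.
have Bb j : bounded_op (B j) _ := shift_bounded _ j.
apply: (koszul_exact_inverse Bb (i := i) Nc); rewrite /B.
- by move=> x; rewrite mxE NB.
- by move=> x; rewrite mxE BN.
- move=> j x; rewrite (Ncomm _ _ x (shift_bounded _ j)) // => y.
  by rewrite (bopB (Ta _)) (bopZ (Ta _)) Tcomm.
Qed.

Variable M : R.
Hypotheses (M0 : 0 < M) (aM : a / M <= 1 / 4).
Hypothesis aM' : 2 * (a / M) < cnorm (1 - cis (1 / 2 : R)).

Let A j x := (M^-1 *i) *: T j x.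

Let Mi : cnorm (M^-1 *i) = M^-1.
Proof.
apply/eqP; rewrite -(@eqrXn2 _ 2) ?cnorm_ge0 ?invr_ge0 ?ltW //.
by rewrite cnorm_sqr /= expr0n add0r.
Qed.

Let Ab j : bounded_op (A j) (a / M).
Proof. by have := bounded_op_scale (M^-1 *i) (Ta j); rewrite Mi mulrC. Qed.

Let aM0 : 0 <= a / M. Proof. by rewrite divr_ge0 // ltW. Qed.

Let exp_letter j (u : R[i]) : bounded_op (fun x => expop (A j) x - u *: x) (expR (a / M) + cnorm u).
Proof.
exact: (bounded_opD (expop_bounded aM0 (Ab j)) (bounded_opN (bounded_opZ X u))).
Qed.

(** Two cases. If some |z_i| > 1/2, then e^{A_i} is closer to 1 than e^{iz_i} is, so a single letter
    is already invertible. Otherwise M z is off the spectrum, the operators T_j - M z_j are jointly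
    onto, and [expop_factor] rewrites them by the letters. [bounded_surj] then gives a constant
    uniform in x. *)
Lemma exp_family_surj (z : 'rV[R]_n) :
  (forall j, `|z 0 j| <= 2 * pi - 1 / 2) ->
  ~ ((forall j, `|z 0 j| <= 1 / 2) /\ joint_spectrum T (M *: z)) ->
  exists2 C : R, 0 <= C & forall x, exists y : 'I_n -> X,
    (forall j, rnorm (y j) <= C * rnorm x) /\
    x = \sum_j (expop (A j) (y j) - cis (z 0 j) *: y j).
Proof.
move=> z2pi zS.
have Lb j : bounded_op (fun x => expop (A j) x - cis (z 0 j) *: x) (expR (a / M) + 1).
  by have := exp_letter j (cis (z 0 j)); rewrite cnorm_cis.
apply: (bounded_surj Lb).
have [[i zi]|zsmall] := pselect (exists i, 1 / 2 < `|z 0 i|).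
  move=> x; have Ub : bounded_op (fun x => expop (A i) x - x) (2 * (a / M)).
    split=> [c u v|u]; last by apply: expop_sub_le => //; apply: le_trans aM _; lra.
    by rewrite (expop_bounded aM0 (Ab i)).1 opprD addrACA scalerBr.
  have [||N [_ [_ _ NR _]]] := @neumann_shift _ _ _ _ (cis (z 0 i) - 1) _ _ Ub.
  - by rewrite mulr_ge0.
  - rewrite (lt_le_trans aM') // -[leRHS]cnormN opprB.
    rewrite -(@ler_pXn2r _ 2) ?nnegrE ?cnorm_ge0 // !cis_sub1_sqr.
    by rewrite lerD2l lerN2 ler_pM2l // cos_le_half // (ltW zi) z2pi.
  exists (fun j => if j == i then N x else 0).
  rewrite (bigD1 i) //= eqxx big1 ?addr0.
    by have := NR x; rewrite scalerBl scale1r opprB addrA subrK => ->.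
  move=> j /negbTE ->; exact: (bop0 (exp_letter j _)).
have {}zsmall j : `|z 0 j| <= 1 / 2.
  by rewrite leNgt; apply/negP => zj; apply: zsmall; exists j.
pose u j := (map_mx (fun u : R => u%:C) (M *: z)) 0 j.
have ex := contrapT (fun h => zS (conj zsmall h)).
have [y0 y0P] := choice (koszul_exact_surj (fun j => shift_bounded (u j) j) ex).
move=> x.
(* With D = A_j - i z_j, of norm at most 1/4 + 1/2, one has e^{A_j} - e^{iz_j} = e^{iz_j} D (1 + Y).
   Hence e^{-iz_j} (1 + Y)^{-1} v is mapped to D v. *)
have key j v : exists y, (M^-1 *i) *: (T j v - (M * z 0 j)%:C *: v) =
    expop (A j) y - cis (z 0 j) *: y.
  pose D w := A j w - ((z 0 j) *i) *: w.
  have zC := bounded_opZ X ((z 0 j) *i).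
  have Db : bounded_op D (3 / 4).
    apply: (@bop_le R X X D _ (bounded_opD (Ab j) (bounded_opN zC))).
    have -> : cnorm ((z 0 j) *i) = `|z 0 j|.
      apply/eqP; rewrite -(@eqrXn2 _ 2) ?cnorm_ge0 //.
      by rewrite cnorm_sqr /= expr0n add0r real_normK ?num_real.
    by rewrite (le_trans (lerD aM (zsmall j))) //; lra.
  have d0 : (0 : R) <= 3 / 4 by rewrite divr_ge0.
  have AE : A j = fun w => D w + ((z 0 j) *i) *: w.
    by apply/funext => w; rewrite /D subrK.
  have UE w : expop (A j) w = cis (z 0 j) *: expop D w.
    rewrite AE (expopD _ d0 (cnorm_ge0 _) Db zC) ?expop_scale ?(bopZ (expop_bounded d0 Db)) //.
    by move=> v1; rewrite (bopZ Db).
  have [Y [Yb _ DY]] := expop_factor d0 (lexx _) Db.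
  have [||N [_ NY _]] := neumann_inverse _ _ (bounded_opN Yb).
  - by rewrite divr_ge0.
  - by lra.
  exists (cis (- z 0 j) *: N v).
  rewrite UE (bopZ (expop_bounded d0 Db)) !scalerA cisN mulfV ?cis_neq0 //.
  rewrite !scale1r DY [_ + D _]addrC addrK.
  rewrite -[Y _]opprK NY /D /A scalerBr scalerA; congr (_ - _ *: _).
  apply/eqP; rewrite eq_complex /= !(mul0r, mulr0, subr0, addr0, add0r) oppr0 eqxx /=.
  by rewrite mulKf // gt_eqF.
pose w := ((M^-1 *i) : R[i])^-1 *: x.
have [y yP] := choice (fun j => key j (y0 w j)).
exists y; under eq_bigr do rewrite -yP.
rewrite -scaler_sumr (_ : \sum_j _ = w).
  by rewrite /w scalerA mulfV ?scale1r // -cnorm_eq0 Mi invr_eq0 gt_eqF.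
by rewrite [RHS]y0P; apply: eq_bigr => j _; rewrite /u !mxE.
Qed.

End Spectrum.

(** * Smoothing kernels and weights *)

Definition sinc (R : realType) (u : R) : R := if u == 0 then 1 else sin u / u.

Section Sinc.
Variable R : realType.
Implicit Types u : R.

Lemma sincN u : sinc (- u) = sinc u.
Proof. by rewrite /sinc oppr_eq0; case: eqP => // _; rewrite sinN invrN mulrNN. Qed.

Lemma sinc_half u : sinc u = cos (u / 2) * sinc (u / 2).
Proof.
rewrite /sinc mulf_eq0 invr_eq0 pnatr_eq0 orbF.
have [->|u0] := eqVneq u 0; first by rewrite mul0r cos0 mulr1.
rewrite {1}[u]splitr sinD; field; exact: u0.
Qed.

(** Partial products of Viete's formula, which exhibits sinc as a limit of products of cosines. *)
Definition cos_prod (m : nat) u := \prod_(i < m) cos (u / 2 ^+ i.+1).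

Lemma sinc_cos_prod m u : sinc u = cos_prod m u * sinc (u / 2 ^+ m).
Proof.
elim: m => [|m IH]; first by rewrite /cos_prod big_ord0 mul1r expr0 divr1.
rewrite IH [X in _ * X]sinc_half /cos_prod big_ord_recr /=.
by rewrite -[u / _ / 2]mulrA -invfM -exprSr mulrA.
Qed.

Lemma cos_norm_le1 u : `|cos u| <= 1.
Proof. by rewrite ler_norml cos_geN1 cos_le1. Qed.

Lemma cos_prod_norm_le1 m u : `|cos_prod m u| <= 1.
Proof.
elim: m => [|m IH]; first by rewrite /cos_prod big_ord0 normr1.
by rewrite /cos_prod big_ord_recr /= normrM -[leRHS]mulr1 ler_pM // cos_norm_le1.
Qed.

Lemma sin_mvt u : 0 <= u -> exists2 c, 0 <= c <= u & sin u = cos c * u.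
Proof.
move=> u0; have dsin x : x \in `]0, u[%R -> is_derive x 1 (@sin R) (cos x).
  by move=> _; exact: is_derive_sin.
have csin : {within `[0, u], continuous (@sin R)}.
  by apply: continuous_subspaceT => x; exact: continuous_sin.
have [c cu] := MVT_segment u0 dsin csin.
by rewrite sin0 !subr0 => ->; exists c => //; move: cu; rewrite in_itv.
Qed.

Lemma cos_sub1_le u : `|cos u - 1| <= `|u|.
Proof.
have -> : cos u = cos `|u| by case: (ger0P u) => // _; rewrite cosN.
have dcos x : x \in `]0, `|u|[%R -> is_derive x 1 (@cos R) (- sin x).
  by move=> _; exact: is_derive_cos.
have ccos : {within `[0, `|u|], continuous (@cos R)}.
  by apply: continuous_subspaceT => x; exact: continuous_cos.
have [c cu E] := MVT_segment (normr_ge0 u) dcos ccos.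
move: E; rewrite cos0 subr0 => ->; rewrite normrM normr_id /= normrN.
by rewrite ler_piMl // sin_max.
Qed.

Lemma sin_norm_le u : `|sin u| <= `|u|.
Proof.
wlog u0 : u / 0 <= u.
  by move=> h; have [/h//|/ltW u0] := leP 0 u; rewrite -normrN -sinN -(normrN u) h // oppr_ge0.
have [c _ ->] := sin_mvt u0; by rewrite normrM ler_piMl // cos_norm_le1.
Qed.

Lemma cis_sub1_le u : cnorm (cis u - 1) <= 2 * `|u|.
Proof.
apply: le_trans (cnorm_le _) _ => /=; rewrite subr0 mulrDl !mul1r.
by rewrite lerD ?cos_sub1_le ?sin_norm_le.
Qed.

(** The mean value theorem makes sinc a value of cos at a point no larger than u, so both bounds on
    sinc near 0 are inherited from cos. *)
Lemma sinc_mvt u : exists2 c, `|c| <= `|u| & sinc u = cos c.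
Proof.
wlog u0 : u / 0 <= u.
  by move=> h; have [/h//|/ltW u0] := leP 0 u; rewrite -sincN -(normrN u); apply: h; rewrite oppr_ge0.
rewrite /sinc; case: eqP => [->|/eqP uN0]; first by exists 0; rewrite ?cos0.
have [c /andP[c0 cu] ->] := sin_mvt u0; exists c; first by rewrite !ger0_norm.
by rewrite mulfK.
Qed.

Lemma sinc_norm_le1 u : `|sinc u| <= 1.
Proof. by have [c _ ->] := sinc_mvt u; exact: cos_norm_le1. Qed.

Lemma sinc_sub1_le u : `|sinc u - 1| <= `|u|.
Proof. by have [c cu ->] := sinc_mvt u; rewrite (le_trans (cos_sub1_le c)). Qed.

Lemma sinc_decay u : `|sinc u| * (1 + `|u|) <= 2.
Proof.
rewrite mulrDr mulr1 lerD ?sinc_norm_le1 //.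
rewrite /sinc; case: eqP => [->|/eqP u0]; first by rewrite normr0 mulr0.
by rewrite normrM normfV mulfVK ?normr_eq0 // sin_max.
Qed.

End Sinc.

(** * Fourier transforms of measures on small boxes *)

Section Positive.
Variables (R : realType) (n : nat).
Implicit Types (b : 'rV[int]_n -> R) (h : 'I_n -> R).

Definition dot (k : 'rV[int]_n) (t : 'rV[R]_n) : R := \sum_j (k 0 j)%:~R * t 0 j.

Lemma characterE k t : character k t = cis (dot k t).
Proof.
rewrite /character /cis /=.
by have -> : \sum_j @int_point R n k 0 j * t 0 j = dot k t by apply: eq_bigr => j _; rewrite mxE.
Qed.

Lemma dotDr k t u : dot k (t + u) = dot k t + dot k u.
Proof. by rewrite -big_split; apply: eq_bigr => j _; rewrite mxE mulrDr. Qed.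

Lemma dotNr k t : dot k (- t) = - dot k t.
Proof. by rewrite -sumrN; apply: eq_bigr => j _; rewrite mxE mulrN. Qed.

Lemma dotDl k l t : dot (k + l) t = dot k t + dot l t.
Proof. by rewrite -big_split; apply: eq_bigr => j _; rewrite mxE rmorphD mulrDl. Qed.

Lemma dotNl k t : dot (- k) t = - dot k t.
Proof. by rewrite -sumrN; apply: eq_bigr => j _; rewrite mxE rmorphN mulNr. Qed.

Lemma dot0l t : dot 0 t = 0.
Proof. by rewrite /dot big1 // => j _; rewrite mxE mul0r. Qed.

Lemma dotZr k c t : dot k (c *: t) = c * dot k t.
Proof. by rewrite mulr_sumr; apply: eq_bigr => j _; rewrite mxE mulrCA. Qed.

(* b is (a limit of) the Fourier transform of measures of total variation at
   most one carried by the box [-h, h]. *)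
Definition box_transform b h :=
  forall (P : seq (R[i] * 'rV[int]_n)) (m : R),
    (forall t : 'rV[R]_n, (forall j, `|t 0 j| <= h j) ->
      cnorm (\sum_(q <- P) q.1 * cis (dot q.2 t)) <= m) ->
    cnorm (\sum_(q <- P) q.1 * (b q.2)%:C) <= m.

Lemma box_transform_mono b h h' : (forall j, h j <= h' j) ->
  box_transform b h -> box_transform b h'.
Proof.
move=> hh bh P m Pm; apply: bh => t th; apply: Pm => j.
exact: le_trans (th j) (hh j).
Qed.

Lemma box_transform1 : box_transform (fun=> 1) (fun=> 0).
Proof.
move=> P m /(_ 0) h; rewrite (_ : \sum_(q <- P) _ = \sum_(q <- P) q.1 * cis (dot q.2 (0 : 'rV[R]_n))).
  by apply: h => j; rewrite mxE normr0.
by apply: eq_bigr => q _; rewrite /dot big1 ?cis0 // => j _; rewrite mxE mulr0.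
Qed.

(** A product of transforms belongs to the convolution of the measures, whose supports add. The two
    hypotheses are applied in turn, the factors of one being absorbed into the coefficients of
    [P]. *)
Lemma box_transformM b b' h h' : box_transform b h -> box_transform b' h' ->
  box_transform (fun k => b k * b' k) (fun j => h j + h' j).
Proof.
move=> bh bh' P m Pm.
have -> : \sum_(q <- P) q.1 * (b q.2 * b' q.2)%:C =
    \sum_(q <- [seq (q.1 * (b q.2)%:C, q.2) | q <- P]) q.1 * (b' q.2)%:C.
  by rewrite big_map; apply: eq_bigr => q _; rewrite rmorphM mulrA.
apply: bh' => t th; rewrite big_map.
have -> : \sum_(q <- P) q.1 * (b q.2)%:C * cis (dot q.2 t) =
    \sum_(q <- [seq (q.1 * cis (dot q.2 t), q.2) | q <- P]) q.1 * (b q.2)%:C.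
  by rewrite big_map; apply: eq_bigr => q _; rewrite mulrAC.
apply: bh => u uh; rewrite big_map.
have -> : \sum_(q <- P) q.1 * cis (dot q.2 t) * cis (dot q.2 u) =
    \sum_(q <- P) q.1 * cis (dot q.2 (t + u)).
  by apply: eq_bigr => q _; rewrite dotDr cisD mulrA.
apply: Pm => j; rewrite mxE addrC (le_trans (ler_normD _ _)) // lerD //.
Qed.

Lemma box_transform_prod I (r : seq I) (b : I -> 'rV[int]_n -> R) (h : I -> 'I_n -> R) :
  (forall i, box_transform (b i) (h i)) ->
  box_transform (fun k => \prod_(i <- r) b i k) (fun j => \sum_(i <- r) h i j).
Proof.
move=> bh; elim: r => [|i r IH].
  have -> : (fun k => \prod_(i <- [::]) b i k) = fun=> 1 by apply/funext => k; rewrite big_nil.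
  have -> : (fun j => \sum_(i <- [::]) h i j) = fun=> 0 by apply/funext => j; rewrite big_nil.
  exact: box_transform1.
have -> : (fun k => \prod_(l <- i :: r) b l k) = (fun k => b i k * \prod_(l <- r) b l k).
  by apply/funext => k; rewrite big_cons.
have -> : (fun j => \sum_(l <- i :: r) h l j) = (fun j => h i j + \sum_(l <- r) h l j).
  by apply/funext => j; rewrite big_cons.
exact: box_transformM.
Qed.

(** Each test polynomial is a finite list, so pointwise convergence is uniform on its
    frequencies. *)
Lemma box_transform_lim (b : nat -> 'rV[int]_n -> R) b' h :
  (forall m, box_transform (b m) h) ->
  (forall k (e : R), 0 < e -> exists m0, forall m, (m0 <= m)%N -> `|b m k - b' k| <= e) ->
  box_transform b' h.
Proof.
move=> bh lim P m Pm; apply/ler_addgt0Pr => e e0.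
pose s := \sum_(q <- P) cnorm q.1.
have s0 : 0 <= s by apply: sumr_ge0 => q _; exact: cnorm_ge0.
have es : 0 < e / (1 + s) by rewrite divr_gt0 // ltr_wpDr.
have unif e1 : 0 < e1 -> exists m0, forall m, (m0 <= m)%N ->
    forall q, q \in P -> `|b m q.2 - b' q.2| <= e1.
  move=> e1_gt0; elim: (P) => [|q Q [m1 IH]]; first by exists 0%N.
  have [m2 H2] := lim q.2 e1 e1_gt0; exists (maxn m1 m2) => l.
  rewrite geq_max => /andP[h1 h2] p; rewrite inE => /predU1P[->|pQ]; first exact: H2.
  exact: IH.
have [m0 Hm] := unif _ es; have {}Hm := Hm m0 (leqnn _).
have -> : \sum_(q <- P) q.1 * (b' q.2)%:C =
   \sum_(q <- P) q.1 * (b m0 q.2)%:C + \sum_(q <- P) q.1 * (b' q.2 - b m0 q.2)%:C.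
  by rewrite -big_split; apply: eq_bigr => q _; rewrite /= -mulrDr -rmorphD /= [b m0 _ + _]addrC subrK.
rewrite (le_trans (ler_cnormD _ _)) // lerD //; first exact: bh.
rewrite (le_trans (ler_cnorm_sum _ _ _)) //.
apply: (@le_trans _ _ (s * (e / (1 + s)))).
  rewrite mulr_suml big_seq [leRHS]big_seq; apply: ler_sum => q qP.
  by rewrite cnormM cnormR ler_wpM2l ?cnorm_ge0 // distrC Hm.
by rewrite mulrA ler_pdivrMr ?ltr_wpDr // mulrC ler_wpM2l ?(ltW e0) // lerDr.
Qed.

(** The measure is half of the sum of the point masses at v and -v on the axis j0. *)
Lemma box_transform_cos j0 (v : R) :
  box_transform (fun k => cos ((k 0 j0)%:~R * v)) (fun j => if j == j0 then `|v| else 0).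
Proof.
move=> P m Pm; pose t (w : R) : 'rV[R]_n := \row_j (if j == j0 then w else 0).
have dt k w : dot k (t w) = (k 0 j0)%:~R * w.
  rewrite /dot (bigD1 j0) //= mxE eqxx big1 ?addr0 // => j /negbTE jj.
  by rewrite mxE jj mulr0.
have tm w : `|w| <= `|v| -> cnorm (\sum_(q <- P) q.1 * cis (dot q.2 (t w))) <= m.
  by move=> wv; apply: Pm => j; rewrite mxE; case: eqP; rewrite ?normr0.
have E : \sum_(q <- P) q.1 * (cos ((q.2 0 j0)%:~R * v))%:C = 2^-1 *
    (\sum_(q <- P) q.1 * cis (dot q.2 (t v)) + \sum_(q <- P) q.1 * cis (dot q.2 (t (- v)))).
  rewrite -big_split mulr_sumr; apply: eq_bigr => q _.
  rewrite /= !dt mulrN -mulrDr mulrCA; congr (_ * _).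
  set u := _ * v; have -> : cis u + cis (- u) = 2 * (cos u)%:C.
    rewrite /cis cosN sinN; apply/eqP; rewrite eq_complex /=.
    by rewrite !(mul0r, mulr0, add0r, addr0, subr0, subrr) !eqxx andbT; apply/eqP; ring.
  by rewrite mulKf // pnatr_eq0.
rewrite E cnormM cnormV cnorm_nat mulrC ler_pdivrMr // mulr_natr mulr2n.
rewrite (le_trans (ler_cnormD _ _)) // lerD ?tm ?normrN //.
Qed.

(** Limit of the cosine products: the half-widths |v|/2^{i+1} add up to at most |v|. The measure
    behind it is the uniform one on [-v, v]. *)
Lemma box_transform_sinc j0 (v : R) :
  box_transform (fun k => sinc ((k 0 j0)%:~R * v)) (fun j => if j == j0 then `|v| else 0).
Proof.
pose b m (k : 'rV[int]_n) := cos_prod m ((k 0 j0)%:~R * v).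
apply: (@box_transform_lim b) => [m|k e e0].
  have := @box_transform_prod _ (index_enum 'I_m)
    (fun i k => cos ((k 0 j0)%:~R * (v / 2 ^+ i.+1))) _
    (fun i => @box_transform_cos j0 (v / 2 ^+ i.+1)).
  have -> : (fun k : 'rV[int]_n => \prod_(i < m) cos ((k 0 j0)%:~R * (v / 2 ^+ i.+1))) = b m.
    by apply/funext => k; apply: eq_bigr => i _; rewrite mulrA.
  apply: box_transform_mono => j; case: eqP => [_|]; last by rewrite big1.
  under eq_bigr do rewrite normrM normfV (@ger0_norm _ (2 ^+ _)) ?exprn_ge0 // -exprVn.
  rewrite -mulr_sumr ler_piMr //.
  have -> : \sum_(i < m) (2^-1 : R) ^+ i.+1 = 2^-1 * \sum_(i < m) 2^-1 ^+ i.
    by rewrite mulr_sumr; apply: eq_bigr => i _; rewrite exprS.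
  have := subrX1 (2^-1 : R) m; have := exprn_ge0 m (_ : 0 <= 2^-1 :> R).
  rewrite invr_ge0 ler0n => /(_ isT); lra.
set u := _ * v; have [m0 _ Hm] : \forall m \near \oo, (2^-1 : R) ^+ m <= e / (1 + `|u|).
  have eu : 0 < e / (1 + `|u|) by rewrite divr_gt0 // ltr_wpDr.
  have /cvgrPdist_le /(_ _ eu) : (2^-1 : R) ^+ k @[k --> \oo] --> (0 : R).
    by apply: cvg_expr; rewrite ger0_norm ?invr_ge0 // invf_lt1 // ltr1n.
  by apply: filterS => l; rewrite sub0r normrN ger0_norm // exprn_ge0 ?invr_ge0.
exists m0 => m m0m; rewrite /b -/u (sinc_cos_prod m u) -{1}[cos_prod m u]mulr1 -mulrBr normrM.
have c1 := cos_prod_norm_le1 m u.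
apply: le_trans (ler_pM _ _ c1 (lexx _)) _ => //; rewrite mul1r distrC.
apply: le_trans (sinc_sub1_le _) _; rewrite normrM normfV (@ger0_norm _ (2 ^+ m)) ?exprn_ge0 //.
rewrite -exprVn; apply: le_trans (ler_wpM2l _ (Hm m m0m)) _ => //.
by rewrite mulrA ler_pdivrMr ?ltr_wpDr // mulrC ler_wpM2l ?(ltW e0) // lerDr.
Qed.

End Positive.

(** * Lattice boxes and polynomial weights *)

Section Zbox.
Variable n : nat.

(** The indices 0..2K stand for -K..K, a full set of residues mod 2K + 1. The same indices serve for
    frequencies in a box and for grid points of the torus. *)
Definition centered (K : nat) (i : 'I_(K.*2.+1)) : int := i%:Z - K%:Z.

Definition box_index (K : nat) (f : {ffun 'I_n -> 'I_(K.*2.+1)}) : 'rV[int]_n :=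
  \row_j centered (f j).

Definition zbox (K : nat) : {fset 'rV[int]_n} :=
  [fset box_index f | f in {: {ffun 'I_n -> 'I_(K.*2.+1)}}]%fset.

Lemma centered_inj K : injective (@centered K).
Proof. by move=> i j; rewrite /centered => /addIr [] /val_inj. Qed.

Lemma centered_le K i : (`|@centered K i| <= K)%N.
Proof. by rewrite /centered; have := ltn_ord i; lia. Qed.

Lemma box_index_inj K : injective (@box_index K).
Proof.
move=> f g fg; apply/ffunP => j; apply: centered_inj.
by move/rowP : fg => /(_ j); rewrite !mxE.
Qed.

Lemma zboxP K (k : 'rV[int]_n) :
  reflect (forall j : 'I_n, (`|k 0%R j| <= K)%N) (k \in zbox K).
Proof.
apply: (iffP (imfsetP _ _ _ _)) => [[f _ ->] j|kK]; first by rewrite mxE centered_le.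
exists [ffun j => inord `|(k 0 j + K%:Z)%R|%N] => //; apply/rowP => j.
rewrite mxE ffunE /centered; move: (kK j); set z := k 0 j => zK; rewrite inordK; by lia.
Qed.

Lemma zbox_sum (W : zmodType) K (F : 'rV[int]_n -> W) :
  \sum_(k <- zbox K) F k = \sum_(f : {ffun 'I_n -> 'I_(K.*2.+1)}) F (box_index f).
Proof.
rewrite big_imfset /=; last by move=> f g _ _; exact: box_index_inj.
by rewrite -big_enum; apply: perm_big; exact: perm_refl.
Qed.

Lemma sub_zbox (A : {fset 'rV[int]_n}) : exists K, (A `<=` zbox K)%fset.
Proof.
exists (\max_(k <- A) \max_(j < n) `|k 0%R j|%N)%N; apply/fsubsetP => k kA.
apply/zboxP => j; apply: leq_trans (@leq_bigmax_seq _ _ xpredT _ k kA _) => //.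
exact: (@leq_bigmax _ (fun j => `|k 0%R j|%N) j).
Qed.

Lemma zbox_prod (K : nat) (R : comNzRingType) (f : 'I_n -> int -> R) :
  \sum_(k <- zbox K) \prod_j f j (k 0 j) = \prod_j \sum_(i < K.*2.+1) f j (centered i).
Proof.
rewrite zbox_sum bigA_distr_bigA; apply: eq_bigr => g _.
by apply: eq_bigr => j _; rewrite mxE.
Qed.

End Zbox.

Section Weight.
Variables (R : realType) (n : nat).
Implicit Types (e : 'I_n -> R) (k l : 'rV[int]_n).

(** A product over the coordinates rather than a power of the Euclidean norm: it is what the bounds
    on the single operators multiply up to, and sums over boxes factor. *)
Definition weight e k : R := \prod_j (1 + `|(k 0 j)%:~R|) `^ e j.

Let pos (x : R) : 0 < 1 + `|x|. Proof. by rewrite ltr_wpDr. Qed.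

Lemma weight_gt0 e k : 0 < weight e k.
Proof. by apply: prodr_gt0 => j _; rewrite powR_gt0. Qed.

Lemma weight_ge0 e k : 0 <= weight e k. Proof. exact/ltW/weight_gt0. Qed.

Lemma weightD e k l : (forall j, 0 <= e j) -> weight e (k + l) <= weight e k * weight e l.
Proof.
move=> e0; rewrite -big_split /=; apply: ler_prod => j _.
rewrite powR_ge0 /= -powRM ?addr_ge0 // ge0_ler_powR ?nnegrE ?mulr_ge0 ?addr_ge0 //.
rewrite mxE rmorphD /= mulrDl mul1r mulrDr mulr1 -!addrA lerD2l.
by rewrite (le_trans (ler_normD _ _)) // [leRHS]addrCA lerD2l lerDl mulr_ge0.
Qed.

Lemma weight_le e e' k : (forall j, e j <= e' j) -> weight e k <= weight e' k.
Proof.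
by move=> ee; apply: ler_prod => j _; rewrite powR_ge0 ler_powR ?lerDl.
Qed.

(** Some coordinate exceeds K in absolute value, so one more unit in its exponent gains a factor
    above 1 + K. This is why tails are measured with the exponents s_j + 1. *)
Lemma weight_outside e k K : k \notin zbox n K ->
  weight e k * (1 + K%:R) <= weight (fun j => e j + 1) k.
Proof.
move=> kK; have [j0 kj] : exists j0, (K < `|k 0%R j0|)%N.
  apply: contrapT => h; move/negP: kK; apply; apply/zboxP => j.
  by rewrite leqNgt; apply/negP => ?; apply: h; exists j.
rewrite /weight (bigD1 j0) // [leRHS](bigD1 j0) //= mulrAC ler_pM ?mulr_ge0 ?powR_ge0 ?prodr_ge0 //.
- rewrite powRD ?powRr1 ?addr_ge0 //; last by rewrite (gt_eqF (pos _)) implybT.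
  by rewrite ler_wpM2l ?powR_ge0 // lerD2l -intr_norm -pmulrn ler_nat ltnW.
- apply: ler_prod => j _; rewrite powR_ge0 /=.
  by rewrite ler_powR // lerDl.
Qed.

Lemma sum_weight_zbox e (K D : nat) : (forall j, 0 <= e j <= D%:R) ->
  \sum_(k <- zbox n K) weight e k <= (2 * (1 + K%:R)) ^+ (n * D.+1).
Proof.
move=> eD; rewrite (zbox_prod K (fun j z => (1 + `|z%:~R|) `^ e j)).
rewrite exprM -[X in _ <= (_ ^+ X) ^+ _]card_ord -prodr_const -prodrXl.
apply: ler_prod => j _; have /andP[e0 eDj] := eD j.
rewrite sumr_ge0 /= => [|i _]; last by rewrite powR_ge0.
have h i : (1 + `|(@centered K i)%:~R|) `^ e j <= ((1 + K%:R) ^+ D : R).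
  have h1 : `|(@centered K i)%:~R| <= K%:R :> R.
    by rewrite -intr_norm -[K%:R]/(K%:Z%:~R) ler_int; have := centered_le i; lia.
  apply: (@le_trans _ _ ((1 + K%:R) `^ e j)).
    by rewrite ge0_ler_powR ?nnegrE ?addr_ge0 // lerD2l.
  by rewrite -powR_mulrn ?addr_ge0 // ler_powR // lerDl.
apply: (le_trans (ler_sum _ (fun i _ => h i))).
rewrite sumr_const card_ord -[leLHS]mulr_natl exprS ler_pM ?ler0n ?exprn_ge0 ?addr_ge0 //.
  by rewrite -natr1 -muln2 natrM; have : 0 <= K%:R :> R by []; lra.
by rewrite lerXn2r ?nnegrE ?mulr_ge0 ?addr_ge0 // ler_peMl ?addr_ge0 // ler1n.
Qed.

End Weight.

(** * Weighted sums of powers of the bump *)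

Section Bump.
Variables (R : realType) (n : nat).

Definition sinc_bump (eta : R) (B : nat) (k : 'rV[int]_n) : R :=
  \prod_j sinc ((k 0 j)%:~R * eta) ^+ B.

Lemma bumpN eta B k : sinc_bump eta B (- k) = sinc_bump eta B k.
Proof. by apply: eq_bigr => j _; rewrite mxE rmorphN mulNr sincN. Qed.

Lemma box_transform_bump eta B : box_transform (sinc_bump eta B) (fun=> B%:R * `|eta|).
Proof.
have h (j : 'I_n) := @box_transform_prod R n _ (index_enum 'I_B)
  (fun _ k => sinc ((k 0 j)%:~R * eta)) _ (fun _ => @box_transform_sinc R n j eta).
have -> : sinc_bump eta B = fun k : 'rV[int]_n => \prod_(j < n) \prod_(i < B) sinc ((k 0 j)%:~R * eta).
  by apply/funext => k; apply: eq_bigr => j _; rewrite prodr_const card_ord.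
apply: box_transform_mono (@box_transform_prod R n _ (index_enum 'I_n) _ _ h) => j.
rewrite (bigD1 j) //= eqxx sumr_const card_ord.
rewrite big1 ?addr0 ?mulr_natl // => i /negbTE ij; rewrite eq_sym ij.
by rewrite big1.
Qed.

Lemma sum_inv_sqr (eta : R) K : 0 < eta -> eta <= 1 ->
  \sum_(i < K.*2.+1) (1 + eta * `|(centered i)%:~R|) ^- 2 <= 3 / eta.
Proof.
move=> eta0 eta1; have p (m : nat) : 0 < 1 + eta * m%:R by rewrite ltr_wpDr // mulr_ge0 ?(ltW eta0).
(* The subtracted term makes the induction on K work: each of the two new terms is at most the
   telescoping difference of eta^{-1}/(1 + eta K) and its successor. *)
apply: (@le_trans _ _ (1 + 2 / eta - 2 / (eta * (1 + eta * K%:R)))); last first.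
  have : 1 <= eta^-1 by rewrite invf_ge1.
  have : 0 <= 2 / (eta * (1 + eta * K%:R)) by rewrite divr_ge0 ?mulr_ge0 // ?(ltW eta0) ?(ltW (p _)).
  by lra.
elim: K => [|K IH].
  rewrite big_ord1 /centered subrr normr0 mulr0 addr0 expr1n invr1 mulr1.
  by rewrite addrK.
rewrite big_ord_recl big_ord_recr.
have E i : @centered K.+1 (lift ord0 (widen_ord (leqnSn K.*2.+1) i)) = @centered K i.
  by rewrite /centered lift0; change (i.+1%:Z - K.+1%:Z = i%:Z - K%:Z); lia.
under eq_bigr do rewrite E.
have -> : @centered K.+1 ord0 = - (K.+1%:Z) by rewrite /centered sub0r.
have -> : @centered K.+1 (lift ord0 ord_max) = K.+1%:Z.
  by change (K.*2.+2%:Z - K.+1%:Z = K.+1%:Z); lia.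
have nK : `|(K.+1%:Z)%:~R| = K.+1%:R :> R by rewrite -pmulrn normr_nat.
rewrite rmorphN normrN nK.
have h : (1 + eta * K.+1%:R) ^- 2 <= (eta^-1 / (1 + eta * K%:R) - eta^-1 / (1 + eta * K.+1%:R)).
  have -> : eta^-1 / (1 + eta * K%:R) - eta^-1 / (1 + eta * K.+1%:R) =
    ((1 + eta * K%:R) * (1 + eta * K.+1%:R))^-1.
    rewrite -natr1; field; have := p K; have := p K.+1; rewrite -natr1 => p1 p2.
    by rewrite !gt_eqF.
  rewrite lef_pV2 ?posrE ?mulr_gt0 ?exprn_gt0 // expr2 ler_pM2r //.
  by rewrite lerD2l ler_pM2l // ler_nat.
have i1 m : 2 / (eta * (1 + eta * m%:R)) = 2 * (eta^-1 / (1 + eta * m%:R)).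
  by rewrite invfM mulrA.
rewrite i1; rewrite i1 in IH; move: IH h; set u := _^-1 / _; set v := _^-1 / _.
set S := \sum_(i < _) _; set w := _ ^- 2; rewrite /=; lra.
Qed.

(** With y = 1 + eta |k|, one has |sinc| <= 2/y and 1 + |k| <= y/eta. The term is thus at most 2^N
    eta^{-e} y^{e-N}, and e + 2 <= N leaves the summable y^{-2}. *)
Lemma sum_sinc_weight (eta e : R) (N K : nat) : 0 < eta -> eta <= 1 -> 0 <= e -> e + 2 <= N%:R ->
  \sum_(i < K.*2.+1) `|sinc ((centered i)%:~R * eta)| ^+ N * (1 + `|(centered i)%:~R|) `^ e
  <= 3 * 2 ^+ N * (eta^-1 * (eta^-1) `^ e).
Proof.
move=> eta0 eta1 e0 eN.
have h (i : 'I_(K.*2.+1)) : `|sinc ((centered i)%:~R * eta)| ^+ N * (1 + `|(centered i)%:~R|) `^ e <=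
    2 ^+ N * eta^-1 `^ e * (1 + eta * `|(centered i)%:~R|) ^- 2.
  set x := `|_%:~R|; have x0 : 0 <= x := normr_ge0 _.
  set y := 1 + eta * x; have y1 : 1 <= y by rewrite lerDl mulr_ge0 // ltW.
  have y0 : 0 < y by apply: lt_le_trans y1.
  have s1 : `|sinc ((centered i)%:~R * eta)| <= 2 / y.
    rewrite ler_pdivlMr //; have := sinc_decay ((centered i)%:~R * eta).
    by rewrite /y normrM (gtr0_norm eta0) -/x [x * eta]mulrC.
  have xy : 1 + x <= eta^-1 * y.
    by rewrite mulrDr mulr1 mulKf ?gt_eqF // lerD2r invf_ge1.
  apply: (@le_trans _ _ ((2 / y) ^+ N * (eta^-1 * y) `^ e)).
    apply: ler_pM; rewrite ?exprn_ge0 ?powR_ge0 //.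
      by rewrite lerXn2r ?nnegrE // divr_ge0 // ltW.
    by rewrite ge0_ler_powR ?nnegrE ?addr_ge0 ?mulr_ge0 ?invr_ge0 ?(ltW eta0) ?(ltW y0).
  rewrite powRM ?invr_ge0 ?(ltW eta0) ?(ltW y0) // expr_div_n -!mulrA ler_wpM2l ?exprn_ge0 //.
  rewrite mulrCA ler_wpM2l ?powR_ge0 // mulrC ler_pdivrMr ?exprn_gt0 //.
  rewrite mulrC ler_pdivlMr ?exprn_gt0 // -!powR_mulrn ?(ltW y0) // -powRD; last by rewrite (gt_eqF y0) implybT.
  by rewrite ler_powR.
apply: (le_trans (ler_sum _ (fun i _ => h i))).
rewrite -mulr_sumr; apply: le_trans (ler_wpM2l _ (sum_inv_sqr K eta0 eta1)) _.
  by rewrite mulr_ge0 ?exprn_ge0 ?powR_ge0.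
by rewrite le_eqVlt; apply/orP; left; apply/eqP; ring.
Qed.

Lemma sum_bump_weight (eta : R) (e : 'I_n -> R) (B r : nat) (A : {fset 'rV[int]_n}) :
  0 < eta -> eta <= 1 -> (forall j, 0 <= e j) -> (forall j, e j + 2 <= (B * r)%:R) ->
  \sum_(k <- A) `|sinc_bump eta B k| ^+ r * weight e k <=
    (3 * 2 ^+ (B * r)) ^+ n * (eta^-1 ^+ n * eta^-1 `^ (\sum_j e j)).
Proof.
move=> eta0 eta1 e0 eB; have [K AK] := sub_zbox A.
apply: le_trans (ler_sum_fsub _ AK) _.
  by move=> k; rewrite mulr_ge0 ?exprn_ge0 ?weight_ge0.
have -> : \sum_(k <- zbox n K) `|sinc_bump eta B k| ^+ r * weight e k =
  \sum_(k <- zbox n K) \prod_j (`|sinc ((k 0 j)%:~R * eta)| ^+ (B * r) * (1 + `|(k 0 j)%:~R|) `^ e j).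
  apply: eq_bigr => k _; rewrite big_split /=; congr (_ * _).
  by rewrite normr_prod -prodrXl; apply: eq_bigr => j _; rewrite normrX exprM.
rewrite (zbox_prod K (fun j z => `|sinc (z%:~R * eta)| ^+ (B * r) * (1 + `|z%:~R|) `^ e j)).
have -> : (3 * 2 ^+ (B * r)) ^+ n * (eta^-1 ^+ n * eta^-1 `^ (\sum_j e j)) =
   \prod_j (3 * 2 ^+ (B * r) * (eta^-1 * eta^-1 `^ e j)) :> R.
  rewrite !big_split /= !prodr_const card_ord; congr (_ * (_ * _)).
    exact: exprMn.
  apply: (big_morph (powR eta^-1)) => [a b|]; last exact: powRr0.
  by rewrite powRD // invr_eq0 (gt_eqF eta0) implybT.
apply: ler_prod => j _; apply/andP; split; last exact: sum_sinc_weight.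
by apply: sumr_ge0 => i _; rewrite mulr_ge0 ?exprn_ge0 ?powR_ge0.
Qed.

End Bump.

(** * Character sums over a finite grid of the torus *)

Section Grid.
Variables (R : realType) (n K : nat).
Local Notation N := (K.*2.+1).

Lemma cis_2pi_int (l : int) : cis (2 * pi * l%:~R) = 1 :> R[i].
Proof.
have h (m : nat) : cis (2 * pi * m%:R) = 1 :> R[i].
  rewrite mulrC cis_nat; have -> : cis (2 * pi) = 1 :> R[i]; last exact: expr1n.
  by rewrite /cis mulrC mulr_natr -[pi *+ 2]add0r cosD2pi sinD2pi cos0 sin0.
case: l => m; first exact: h.
by rewrite NegzE mulrNz mulrN cisN -pmulrn h invr1.
Qed.

Lemma grid_sum1 (l : int) :
  \sum_(i < N) cis (l%:~R * (2 * pi / N%:R * (centered i)%:~R)) =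
    (if (N %| `|l|)%N then N%:R else 0) :> R[i].
Proof.
have N0 : (N%:R : R) != 0 by rewrite pnatr_eq0.
pose z : R[i] := cis (2 * pi / N%:R * l%:~R).
have -> : \sum_(i < N) cis (l%:~R * (2 * pi / N%:R * (centered i)%:~R)) =
    z ^- K * \sum_(i < N) z ^+ i.
  rewrite mulr_sumr; apply: eq_bigr => i _.
  rewrite /z -!cis_nat -cisN -cisD; congr cis; rewrite /centered rmorphB /=.
  by rewrite -!pmulrn; ring.
have zN : z ^+ N = 1.
  rewrite /z -cis_nat (_ : _ * _ = 2 * pi * l%:~R); first exact: cis_2pi_int.
  by field.
case: ifPn => [/dvdnP[q lq]|Nl].
  have -> : z = 1.
    rewrite /z; have [->|->] : l = (q * N)%:Z \/ l = - (q * N)%:Z by lia.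
      by rewrite (_ : _ * _ = 2 * pi * (q%:Z)%:~R) ?cis_2pi_int // -!pmulrn natrM; field.
    by rewrite (_ : _ * _ = 2 * pi * (- q%:Z)%:~R) ?cis_2pi_int // !rmorphN /= -!pmulrn natrM; field.
  rewrite expr1n invr1 mul1r; under eq_bigr do rewrite expr1n.
  by rewrite sumr_const card_ord.
have z1 : z != 1.
  have E : l = (l %/ N%:Z)%Z * N%:Z + (l %% N%:Z)%Z by exact: divz_eq.
  set r := (l %% N%:Z)%Z in E; have r0 : 0 < r%:~R :> R.
    rewrite ltr0z lt0r modz_ge0 // andbT; apply: contra Nl => /eqP r0.
    by rewrite E r0 addr0 abszM dvdn_mull.
  have rN : r%:~R < N%:R :> R by rewrite -[N%:R]/((N%:Z)%:~R) ltr_int ltz_pmod.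
  rewrite /z; have -> : 2 * pi / N%:R * l%:~R = 2 * pi * (l %/ N%:Z)%Z%:~R + 2 * pi * (r%:~R / N%:R) :> R.
    by rewrite {1}E rmorphD rmorphM /= -pmulrn; field.
  have p2 : 0 < 2 * pi :> R by rewrite mulr_gt0 ?pi_gt0.
  rewrite cisD cis_2pi_int mul1r; apply: cis_neq1; apply/andP; split.
    by rewrite mulr_gt0 // divr_gt0.
  by rewrite gtr_pMr // ltr_pdivrMr ?ltr0n // mul1r.
have /eqP := subrX1 z N; rewrite zN subrr eq_sym mulf_eq0 subr_eq0 (negbTE z1) /= => /eqP ->.
by rewrite mulr0.
Qed.

Definition grid_point (f : {ffun 'I_n -> 'I_N}) : 'rV[R]_n :=
  (2 * pi / N%:R) *: int_point R (box_index f).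

Lemma grid_sum (l : 'rV[int]_n) :
  \sum_f cis (dot l (grid_point f)) =
    (if [forall j, N %| `|l 0%R j|]%N then N%:R ^+ n else 0) :> R[i].
Proof.
transitivity (\prod_(j < n) (if (N %| `|l 0%R j|)%N then N%:R else 0 : R[i])); last first.
  case: ifPn => [/forallP h|].
    by rewrite -[n in RHS]card_ord -prodr_const; apply: eq_bigr => j _; rewrite h.
  by rewrite negb_forall => /existsP[j /negbTE h]; rewrite (bigD1 j) //= h mul0r.
under [RHS]eq_bigr do rewrite -grid_sum1.
rewrite bigA_distr_bigA; apply: eq_bigr => f _; rewrite /dot cis_sum.
by apply: eq_bigr => j _; rewrite !mxE.
Qed.

End Grid.

(** * Local nullity *)

Lemma usum_reindex (R : realType) (V : completeNormedModType R[i]) (I J : choiceType)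
    (h : J -> I) (h' : I -> J) (F : I -> V) :
  cancel h h' -> cancel h' h -> abs_summable F -> usum (fun j => F (h j)) = usum F.
Proof.
move=> hK h'K sF; apply: usum_eqP => e e0; have [A HA] := usum_near sF e0.
exists [fset h' i | i in A]%fset => B AB.
have -> : \sum_(j <- B) F (h j) = \sum_(i <- [fset h j | j in B]%fset) F i.
  by rewrite big_imfset //= => j1 j2 _ _; exact: (can_inj hK).
apply: HA; apply/fsubsetP => i iA; rewrite -(h'K i); apply: in_imfset.
by apply: (fsubsetP AB); rewrite in_imfset.
Qed.

Lemma abs_summable_inj (R : realType) (V : normedModType R[i]) (I J : choiceType)
    (h : J -> I) (F : I -> V) :
  injective h -> abs_summable F -> abs_summable (fun j => F (h j)).
Proof.
move=> hI [M FM]; exists M => A.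
have := FM [fset h j | j in A]%fset; rewrite big_imfset //= => j1 j2 _ _.
exact: hI.
Qed.

(** * Trigonometric polynomials and their norms *)

Section TrigPoly.
Variables (R : realType) (n : nat).
Local Notation poly := (seq (R[i] * 'rV[int]_n)).
Implicit Types P Q : poly.

(** A polynomial is a list of pairs of coefficient and frequency, repetitions allowed, so that
    products need no collecting of terms; norms of lists bound those of the collected polynomials
    from above. *)
Definition peval P (t : 'rV[R]_n) : R[i] := \sum_(q <- P) q.1 * cis (dot q.2 t).

Definition pnorm (e : 'I_n -> R) P : R := \sum_(q <- P) cnorm q.1 * weight e q.2.

Definition pmul P Q : poly := [seq (p.1 * q.1, p.2 + q.2) | p <- P, q <- Q].

Definition pone : poly := [:: (1, 0)].

Definition pexp P m : poly := iter m (pmul P) pone.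

Lemma big_pmul (W : zmodType) (F : R[i] * 'rV[int]_n -> W) P Q :
  \sum_(q <- pmul P Q) F q = \sum_(p <- P) \sum_(q <- Q) F (p.1 * q.1, p.2 + q.2).
Proof. by rewrite /pmul big_allpairs_dep. Qed.

Lemma peval_mul P Q t : peval (pmul P Q) t = peval P t * peval Q t.
Proof.
rewrite /peval big_pmul mulr_suml; apply: eq_bigr => p _.
rewrite mulr_sumr; apply: eq_bigr => q _ /=.
by rewrite dotDl cisD mulrACA.
Qed.

Lemma peval_one t : peval pone t = 1.
Proof. by rewrite /peval big_seq1 /= dot0l cis0 mulr1. Qed.

Lemma peval_exp P m t : peval (pexp P m) t = peval P t ^+ m.
Proof.
by elim: m => [|m IH]; rewrite ?peval_one // /pexp iterS peval_mul IH exprS.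
Qed.

Lemma pnorm_ge0 e P : 0 <= pnorm e P.
Proof. by apply: sumr_ge0 => q _; rewrite mulr_ge0 ?cnorm_ge0 ?weight_ge0. Qed.

Lemma weight0 (e : 'I_n -> R) : weight e 0 = 1.
Proof. by rewrite /weight big1 // => j _; rewrite mxE normr0 addr0 powR1. Qed.

Lemma weight_ge1 (e : 'I_n -> R) k : (forall j, 0 <= e j) -> 1 <= weight e k.
Proof.
move=> e0; have := @weight_le R n (fun=> 0) e k e0.
by rewrite {1}/weight big1 // => j _; rewrite powRr0.
Qed.

Lemma pnorm_one e : pnorm e pone = 1.
Proof. by rewrite /pnorm big_seq1 /= cnorm1 weight0 mulr1. Qed.

Lemma pnorm_mul e P Q : (forall j, 0 <= e j) -> pnorm e (pmul P Q) <= pnorm e P * pnorm e Q.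
Proof.
move=> e0; rewrite /pnorm big_pmul mulr_suml; apply: ler_sum => p _.
rewrite mulr_sumr; apply: ler_sum => q _ /=.
by rewrite cnormM mulrACA ler_wpM2l ?mulr_ge0 ?cnorm_ge0 // weightD.
Qed.

Lemma peval_norm P t : cnorm (peval P t) <= \sum_(q <- P) cnorm q.1.
Proof.
apply: le_trans (ler_cnorm_sum _ _ _) _; apply: ler_sum => q _.
by rewrite cnormM cnorm_cis mulr1.
Qed.

Lemma cis_dist (u v : R) : cnorm (cis u - cis v) <= 2 * `|u - v|.
Proof.
have -> : cis u - cis v = cis v * (cis (u - v) - 1).
  by rewrite mulrBr mulr1 -cisD [v + _]addrC subrK.
by rewrite cnormM cnorm_cis mul1r cis_sub1_le.
Qed.

Definition plip P : R := \sum_(q <- P) cnorm q.1 * (2 * \sum_j `|(q.2 0 j)%:~R|).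

Lemma plip_ge0 P : 0 <= plip P.
Proof.
by apply: sumr_ge0 => q _; rewrite !mulr_ge0 ?cnorm_ge0 ?sumr_ge0.
Qed.

Lemma peval_lip P (t u : 'rV[R]_n) (h : R) : 0 <= h -> (forall j, `|t 0 j - u 0 j| <= h) ->
  cnorm (peval P t - peval P u) <= plip P * h.
Proof.
move=> h0 tu; rewrite /peval -sumrB /plip mulr_suml.
apply: le_trans (ler_cnorm_sum _ _ _) _; apply: ler_sum => q _.
rewrite -mulrBr cnormM -mulrA ler_wpM2l ?cnorm_ge0 //.
apply: le_trans (cis_dist _ _) _; rewrite -mulrA ler_wpM2l // mulr_suml.
rewrite /dot -sumrB; apply: le_trans (ler_norm_sum _ _ _) _; apply: ler_sum => j _.
by rewrite -mulrBr normrM ler_wpM2l.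
Qed.

End TrigPoly.

(** * Norm bounds for P(U) S_p, and vanishing by long words *)

Section Representation.
Variables (R : realType) (X : completeNormedModType R[i]) (n : nat).
Variables (U : 'rV[int]_n -> X -> X) (s : 'I_n -> R) (C0 : R) (B : nat).
Hypotheses (C0_ge0 : 0 <= C0) (s_ge0 : forall j, 0 <= s j).
Hypothesis sB : forall j, s j + 3 <= B%:R.
Hypothesis Ub : forall k, bounded_op (U k) (C0 * weight s k).
Hypothesis UD : forall k l x, U (k + l) x = U k (U l x).
Hypothesis U0 : forall x, U 0 x = x.
Local Notation poly := (seq (R[i] * 'rV[int]_n)).
Local Notation s1 := (fun j => s j + 1).
Local Notation zbox := (zbox n).

Let s1_ge0 j : 0 <= s j + 1. Proof. by rewrite addr_ge0. Qed.

Let UC k l x : U k (U l x) = U l (U k x).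
Proof. by rewrite -!UD addrC. Qed.

Lemma term_le (c : R[i]) k x : rnorm (c *: U k x) <= C0 * rnorm x * (cnorm c * weight s k).
Proof.
rewrite rnormZ mulrCA ler_wpM2l ?cnorm_ge0 // (le_trans ((Ub k).2 x)) //.
by rewrite mulrAC.
Qed.

Lemma wsum_term_le (c : 'rV[int]_n -> R[i]) (M : R) x (A : {fset 'rV[int]_n}) :
  \sum_(k <- A) cnorm (c k) * weight s k <= M ->
  \sum_(k <- A) rnorm (c k *: U k x) <= C0 * rnorm x * M.
Proof.
move=> cM; apply: (le_trans (ler_sum _ (fun k _ => term_le (c k) k x))).
by rewrite -mulr_sumr ler_wpM2l // mulr_ge0 ?rnorm_ge0.
Qed.

Lemma wsum_summable (c : 'rV[int]_n -> R[i]) (M : R) x :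
  (forall A : {fset _}, \sum_(k <- A) cnorm (c k) * weight s k <= M) ->
  abs_summable (fun k => c k *: U k x).
Proof. by move=> cM; exists (C0 * rnorm x * M) => A; exact: wsum_term_le. Qed.

Lemma weight_s_le_s1 k : weight s k <= weight s1 k.
Proof. by apply: weight_le => j; rewrite lerDl. Qed.

(** Low frequencies are kept as an explicit sum that finer information can improve; for high ones
    the spare unit in the exponents of [s1] is traded for 1/(1 + K). *)
Lemma usum_split_zbox (c : 'rV[int]_n -> R[i]) (M : R) x K :
  (forall A : {fset _}, \sum_(k <- A) cnorm (c k) * weight s1 k <= M) ->
  rnorm (usum (fun k => c k *: U k x)) <=
    C0 * rnorm x * (\sum_(k <- zbox K) cnorm (c k) * weight s k + M / (1 + K%:R)).
Proof.
move=> cM; apply: usum_le => A; apply: wsum_term_le.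
have F0 k : 0 <= cnorm (c k) * weight s k by rewrite mulr_ge0 ?cnorm_ge0 ?weight_ge0.
apply: le_trans (ler_sum_fsub F0 (fsubsetUr (zbox K) A)) _.
rewrite (big_fsetD _ (fsubsetUl (zbox K) A)) lerD2l.
rewrite ler_pdivlMr ?ltr_wpDr // (le_trans _ (cM ((zbox K `|` A) `\` zbox K)%fset)) // mulr_suml.
rewrite big_seq [leRHS]big_seq; apply: ler_sum => k; rewrite inE => /andP[kK _].
by rewrite -mulrA ler_wpM2l ?cnorm_ge0 // weight_outside.
Qed.

Definition pop (P : poly) (x : X) : X := \sum_(q <- P) q.1 *: U q.2 x.

Lemma pop_bounded P : bounded_op (pop P) (C0 * pnorm s P).
Proof.
have := @bounded_op_sum R X _ P xpredT (fun q x => q.1 *: U q.2 x)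
  (fun q => cnorm q.1 * (C0 * weight s q.2)) (fun q _ => bounded_op_scale q.1 (Ub q.2)).
by under eq_bigr do rewrite mulrCA; rewrite -mulr_sumr.
Qed.

Lemma pop_mul P Q x : pop (pmul P Q) x = pop P (pop Q x).
Proof.
rewrite /pop big_pmul; apply: eq_bigr => p _.
rewrite (bop_sum (Ub _)) scaler_sumr; apply: eq_bigr => q _ /=.
by rewrite (bopZ (Ub _)) scalerA UD.
Qed.

Lemma pop_one x : pop (@pone R n) x = x.
Proof. by rewrite /pop big_seq1 /= U0 scale1r. Qed.

Lemma pop_comm P (A : X -> X) a x : bounded_op A a -> (forall k x, A (U k x) = U k (A x)) ->
  pop P (A x) = A (pop P x).
Proof.
move=> Ab AU; rewrite /pop (bop_sum Ab); apply: eq_bigr => q _.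
by rewrite (bopZ Ab) AU.
Qed.

Lemma U_pop k P x : U k (pop P x) = pop P (U k x).
Proof. by rewrite (pop_comm _ _ (Ub k)). Qed.

Section BumpOperator.
Variables (eta : R) (p : 'rV[R]_n).
Hypotheses (eta_gt0 : 0 < eta) (eta_le1 : eta <= 1).

Definition bump_coef (k : 'rV[int]_n) : R[i] := (sinc_bump eta B k)%:C * cis (- dot k p).

Definition bump_op (x : X) : X := usum (fun k => bump_coef k *: U k x).

(** The bound of [sum_bump_weight] for r = 1 and the exponents s_j + 1, whose requirement on the
    power B is s_j + 3 <= B. *)
Definition bump_mass : R := (3 * 2 ^+ B) ^+ n * (eta^-1 ^+ n * eta^-1 `^ (\sum_j (s j + 1))).

Lemma bump_mass_ge0 : 0 <= bump_mass.
Proof. by rewrite !mulr_ge0 ?exprn_ge0 ?powR_ge0 ?invr_ge0 ?mulr_ge0 ?(ltW eta_gt0). Qed.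

Lemma cnorm_bump_coef k : cnorm (bump_coef k) = `|sinc_bump eta B k|.
Proof. by rewrite cnormM cnorm_cis mulr1 cnormR. Qed.

Lemma sum_bump_coef (A : {fset _}) :
  \sum_(k <- A) cnorm (bump_coef k) * weight s1 k <= bump_mass.
Proof.
under eq_bigr do rewrite cnorm_bump_coef -(expr1 (Num.norm _)).
have := @sum_bump_weight R n eta s1 B 1 A eta_gt0 eta_le1 s1_ge0; rewrite muln1; apply.
by move=> j; rewrite -addrA; have := sB j; lra.
Qed.

Lemma sum_le_s1 (c : 'rV[int]_n -> R[i]) (M : R) :
  (forall A : {fset _}, \sum_(k <- A) cnorm (c k) * weight s1 k <= M) ->
  (forall A : {fset _}, \sum_(k <- A) cnorm (c k) * weight s k <= M).
Proof.
move=> cM A; apply: le_trans (cM A); apply: ler_sum => k _.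
by rewrite ler_wpM2l ?cnorm_ge0 // weight_s_le_s1.
Qed.

Lemma bump_op_summable x : abs_summable (fun k => bump_coef k *: U k x).
Proof. exact: wsum_summable (sum_le_s1 sum_bump_coef). Qed.

Lemma bump_op_bounded : bounded_op bump_op (C0 * bump_mass).
Proof.
split=> [d x y|x]; last first.
  by apply: usum_le => A; rewrite mulrAC; apply: wsum_term_le; exact: (sum_le_s1 sum_bump_coef).
rewrite /bump_op -(usumZ _ (bump_op_summable x)).
rewrite -(usumD (abs_summableZ _ (bump_op_summable x)) (bump_op_summable y)).
by congr usum; apply/funext => k; rewrite (Ub k).1 scalerDr !scalerA [d * _]mulrC.
Qed.

Lemma bump_op_comm (A : X -> X) a x : bounded_op A a -> (forall k x, A (U k x) = U k (A x)) ->
  bump_op (A x) = A (bump_op x).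
Proof.
move=> Ab AU; rewrite /bump_op (usum_bop Ab (bump_op_summable x)).
by congr usum; apply/funext => k; rewrite (bopZ Ab) AU.
Qed.

(** The k-th coefficient of P(U) S_p is, up to a phase, P integrated against a character times the
    bump measure moved to p. That measure has mass at most one on the box around p, so only the size
    of P there matters. *)
Lemma pop_bump_coef P (k : 'rV[int]_n) (r : R) :
  (forall t : 'rV[R]_n, (forall j, `|t 0 j - p 0 j| <= B%:R * eta) -> cnorm (peval P t) <= r) ->
  cnorm (\sum_(q <- P) q.1 * bump_coef (k - q.2)) <= r.
Proof.
move=> Pr; have := @box_transform_bump R n eta B.
move=> /(_ [seq (q.1 * cis (dot q.2 p), q.2 - k) | q <- P] r); rewrite !big_map.
have -> : \sum_(q <- P) q.1 * bump_coef (k - q.2) = cis (- dot k p) *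
    \sum_(q <- P) q.1 * cis (dot q.2 p) * (sinc_bump eta B (q.2 - k))%:C.
  rewrite mulr_sumr; apply: eq_bigr => q _ /=.
  by rewrite /bump_coef -opprB bumpN dotNl opprK dotDl dotNl cisD; ring.
rewrite cnormM cnorm_cis mul1r; apply => t th; rewrite big_map /=.
have -> : \sum_(q <- P) q.1 * cis (dot q.2 p) * cis (dot (q.2 - k) t) =
    cis (- dot k t) * peval P (p + t).
  rewrite /peval mulr_sumr; apply: eq_bigr => q _.
  by rewrite dotDl dotNl dotDr !cisD; ring.
rewrite cnormM cnorm_cis mul1r; apply: Pr => j; rewrite mxE addrAC subrr add0r.
by have := th j; rewrite (gtr0_norm eta_gt0).
Qed.

Lemma pop_bump_op P x :
  pop P (bump_op x) = usum (fun k => (\sum_(q <- P) q.1 * bump_coef (k - q.2)) *: U k x).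
Proof.
pose F (q : R[i] * 'rV[int]_n) k := (q.1 * bump_coef k) *: U (q.2 + k) x.
have sF q : abs_summable (F q).
  have := abs_summableZ q.1 (abs_summable_bop (Ub q.2) (bump_op_summable x)).
  by congr abs_summable; apply/funext => k; rewrite (bopZ (Ub _)) scalerA -UD.
have shiftK (l : 'rV[int]_n) : cancel (fun k => k - l) (fun k => k + l) by move=> k; rewrite subrK.
have shiftK' (l : 'rV[int]_n) : cancel (fun k => k + l) (fun k => k - l) by move=> k; rewrite addrK.
have E q : q.1 *: U q.2 (bump_op x) = usum (fun k => F q (k - q.2)).
  rewrite (usum_reindex (shiftK q.2) (shiftK' q.2) (sF q)) /bump_op.
  rewrite (usum_bop (Ub _) (bump_op_summable x)).
  rewrite -(usumZ _ (abs_summable_bop (Ub q.2) (bump_op_summable x))).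
  by congr usum; apply/funext => k; rewrite (bopZ (Ub _)) scalerA -UD.
rewrite /pop; under eq_bigr do rewrite E.
rewrite -(usum_sum _ _ (fun q => abs_summable_inj (can_inj (shiftK q.2)) (sF q))).
congr usum; apply/funext => k; rewrite scaler_suml; apply: eq_bigr => q _.
by rewrite /F [q.2 + _]addrC subrK.
Qed.

(** Frequencies in the box use the local bound r at the price of a power of K; the others use the
    global norm of P, damped by 1/(1 + K). The balance is left to the choice of K. *)
Lemma pop_bump_op_le P (r : R) x K : 0 <= r ->
  (forall t : 'rV[R]_n, (forall j, `|t 0 j - p 0 j| <= B%:R * eta) -> cnorm (peval P t) <= r) ->
  rnorm (pop P (bump_op x)) <=
    C0 * rnorm x * (r * (2 * (1 + K%:R)) ^+ (n * B.+1) + pnorm s1 P * bump_mass / (1 + K%:R)).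
Proof.
move=> r0 Pr; rewrite pop_bump_op.
have M (A : {fset 'rV[int]_n}) : \sum_(k <- A) cnorm (\sum_(q <- P) q.1 * bump_coef (k - q.2)) * weight s1 k
    <= pnorm s1 P * bump_mass.
  apply: (@le_trans _ _ (\sum_(k <- A) \sum_(q <- P)
     cnorm q.1 * weight s1 q.2 * (cnorm (bump_coef (k - q.2)) * weight s1 (k - q.2)))).
    apply: ler_sum => k _; apply: le_trans (ler_wpM2r (weight_ge0 _ _) (ler_cnorm_sum _ _ _)) _.
    rewrite mulr_suml; apply: ler_sum => q _; rewrite cnormM mulrACA.
    rewrite ler_wpM2l ?mulr_ge0 ?cnorm_ge0 //.
    by rewrite -{1}[k](subrK q.2) addrC weightD.
  rewrite exchange_big /= /pnorm mulr_suml; apply: ler_sum => q _.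
  rewrite -mulr_sumr ler_wpM2l ?mulr_ge0 ?cnorm_ge0 ?weight_ge0 //.
  have := sum_bump_coef [fset k - q.2 | k in A]%fset; rewrite big_imfset /=; first by apply.
  by move=> k1 k2 _ _; exact: addIr.
apply: le_trans (usum_split_zbox x K M) _.
rewrite ler_wpM2l ?mulr_ge0 ?rnorm_ge0 // lerD2r.
apply: (@le_trans _ _ (\sum_(k <- zbox K) r * weight s k)).
  by apply: ler_sum => k _; rewrite ler_wpM2r ?weight_ge0 // pop_bump_coef.
rewrite -mulr_sumr ler_wpM2l // sum_weight_zbox // => j.
by rewrite s_ge0 /=; have := sB j; lra.
Qed.

End BumpOperator.

Lemma pnorm_word e (m : nat) (P : 'I_m -> poly) (W : seq 'I_m) L :
  (forall j, 0 <= e j) -> (forall i, pnorm e (P i) <= L) ->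
  pnorm e (foldr (fun i Q => pmul (P i) Q) (@pone R n) W) <= L ^+ size W.
Proof.
move=> e0 PL; elim: W => [|i W IH] /=; first by rewrite pnorm_one.
rewrite (le_trans (pnorm_mul _ _ e0)) // exprS ler_pM ?pnorm_ge0 //.
Qed.

Lemma peval_word (m : nat) (P : 'I_m -> poly) (W : seq 'I_m) t r :
  (forall i, cnorm (peval (P i) t) <= r) ->
  cnorm (peval (foldr (fun i Q => pmul (P i) Q) (@pone R n) W) t) <= r ^+ size W.
Proof.
move=> Pr; elim: W => [|i W IH] /=; first by rewrite peval_one cnorm1.
by rewrite peval_mul cnormM exprS ler_pM ?cnorm_ge0.
Qed.

(* If S y can be rewritten as a sum of P_i(U) S y_i with letters P_i that are
   small on the support of the bump S, iterating l times gives words of length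
   l; their sup norm on the support is r^l, and cutting frequencies at kappa^l
   turns this into an operator norm bound that tends to 0. *)
Lemma bump_op_eq0 (eta : R) (p : 'rV[R]_n) (m : nat) (P : 'I_m -> poly)
    (C L r : R) (kappa : nat) (E : X -> Prop) :
  0 < eta -> eta <= 1 -> 0 <= C -> 0 <= r -> 0 <= L ->
  (forall i, pnorm s1 (P i) <= L) ->
  (forall i (t : 'rV[R]_n), (forall j, `|t 0 j - p 0 j| <= B%:R * eta) -> cnorm (peval (P i) t) <= r) ->
  (0 < kappa)%N -> 2 * (m%:R * C * L) <= kappa%:R ->
  2 * (m%:R * C * r * kappa%:R ^+ (n * B.+1)) <= 1 ->
  (forall y, E y -> exists z : 'I_m -> X, [/\ forall i, E (z i),
     forall i, rnorm (z i) <= C * rnorm y &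
     bump_op eta p y = \sum_i pop (P i) (bump_op eta p (z i))]) ->
  forall y, E y -> bump_op eta p y = 0.
Proof.
move=> eta0 eta1 C_ge0 r0 L0 PL Pr k0 kL kr step y Ey.
set S := bump_op eta p; set D := (n * B.+1)%N.
pose word := foldr (fun i Q => pmul (P i) Q) (@pone R n).
(* The induction is over all [A]: each use of [step] moves one letter into [A], so that a bound for
   words of length l + 1 after [A] becomes one for words of length l after [A] composed with
   [pop (P i)]. *)
have iter_step l (A : X -> X) a (b : R) : 0 <= b -> bounded_op A a ->
    (forall W : seq 'I_m, size W = l -> forall y, E y -> rnorm (A (pop (word W) (S y))) <= b * rnorm y) ->
    forall y, E y -> rnorm (A (S y)) <= (m%:R * C) ^+ l * b * rnorm y.
  elim: l A a => [|l IH] A a b0 Ab H z Ez.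
    by have := H [::] erefl z Ez; rewrite /word /= pop_one expr0 mul1r.
  have [zz [Ezz zzC Sz]] := step z Ez; rewrite -/S in Sz; rewrite Sz.
  rewrite (bop_sum Ab) (le_trans (ler_rnorm_sum _ _ _)) //.
  apply: (@le_trans _ _ (\sum_(i < m) (m%:R * C) ^+ l * b * (C * rnorm z))).
    apply: ler_sum => i _.
    apply: le_trans (IH (fun x => A (pop (P i) x)) (`|a| * (C0 * pnorm s (P i))) b0 _ _ _ (Ezz i)) _.
    - exact: (bounded_op_comp (normr_ge0 a) (bop_le Ab (ler_norm a)) (pop_bounded (P i))).
    - move=> W Wl v Ev; rewrite -pop_mul; apply: (H (i :: W)) => //=.
      by rewrite Wl.
    - by rewrite ler_wpM2l // mulr_ge0 // exprn_ge0 // mulr_ge0.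
  rewrite sumr_const card_ord -[leLHS]mulr_natl exprSr le_eqVlt; apply/orP; left.
  by apply/eqP; ring.
have M0 := bump_mass_ge0 eta0.
have bound l : rnorm (S y) <= C0 * rnorm y * (2 ^+ D + bump_mass eta) * 2^-1 ^+ l.
  (* The frequency cut K is kappa^l - 1, which makes 1 + K equal to kappa^l. *)
  have kl : (kappa ^ l).-1.+1 = (kappa ^ l)%N by rewrite prednK // expn_gt0 k0.
  pose b := C0 * (r ^+ l * (2 * kappa%:R ^+ l) ^+ D + L ^+ l * bump_mass eta / kappa%:R ^+ l).
  have b0 : 0 <= b.
    rewrite /b; move: (bump_mass eta) M0 => M1 M1_0.
    by do ?[apply: divr_ge0|apply: mulr_ge0|apply: addr_ge0|apply: exprn_ge0] => //.
  have := iter_step l id 1 b b0 (bounded_op_id X) _ y Ey; rewrite -/S.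
  have hb (W : seq 'I_m) : size W = l -> forall y, E y -> rnorm (id (pop (word W) (S y))) <= b * rnorm y.
    move=> Wl z Ez /=; apply: le_trans (pop_bump_op_le (r := r ^+ l) eta0 eta1 z (kappa ^ l).-1 _ _) _.
    - exact: exprn_ge0.
    - by move=> t tp; rewrite -Wl; apply: peval_word => i; exact: Pr.
    rewrite nat1r kl natrX /b -/D [leRHS]mulrAC ler_wpM2l ?mulr_ge0 ?rnorm_ge0 // lerD2l.
    rewrite ler_wpM2r ?invr_ge0 ?exprn_ge0 // ler_wpM2r // -Wl.
    exact: pnorm_word.
  move=> /(_ hb) /le_trans; apply.
  have kR : 0 < kappa%:R :> R by rewrite ltr0n.
  have -> : (m%:R * C) ^+ l * b * rnorm y = C0 * rnorm y *
      (2 ^+ D * (m%:R * C * r * kappa%:R ^+ D) ^+ l +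
       bump_mass eta * (m%:R * C * L / kappa%:R) ^+ l).
    rewrite /b !exprMn -!exprM [(D * l)%N]mulnC exprVn; ring.
  rewrite -[leRHS]mulrA ler_wpM2l ?mulr_ge0 ?rnorm_ge0 // mulrDl lerD //.
    rewrite ler_wpM2l ?exprn_ge0 // lerXn2r ?nnegrE ?invr_ge0 ?mulr_ge0 ?exprn_ge0 //.
    by rewrite -/D in kr; move: kr; set v := _ * _ ^+ D; lra.
  rewrite ler_wpM2l // lerXn2r ?nnegrE ?invr_ge0 ?mulr_ge0 ?exprn_ge0 ?invr_ge0 //.
  by rewrite ler_pdivrMr //; move: kL; set v := _ * L; lra.
apply: rnorm_le0_eq0 => e e0; set c := C0 * _ * _ in bound.
have c0 : 0 <= c by rewrite !mulr_ge0 ?rnorm_ge0 // addr_ge0 ?exprn_ge0.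
have ec : 0 < e / (1 + c) by rewrite divr_gt0 // ltr_wpDr.
have /cvgrPdist_le /(_ _ ec)[l _ Hl] : (2^-1 : R) ^+ k @[k --> \oo] --> (0 : R).
  by apply: cvg_expr; rewrite ger0_norm ?invr_ge0 // invf_lt1 // ltr1n.
apply: le_trans (bound l) _; have := Hl l (leqnn _).
rewrite /= sub0r normrN ger0_norm ?exprn_ge0 ?invr_ge0 // => h.
apply: le_trans (ler_wpM2l c0 h) _.
by rewrite mulrA ler_pdivrMr ?ltr_wpDr // mulrC ler_wpM2l ?(ltW e0) // lerDr.
Qed.

(** The letters vanish at z, hence are O(eta) within 2 B eta of it: B eta from z to p and B eta for
    the bump. The ratio [kappa] depends only on m, C and the norms of the letters, so it is fixed
    before eta is made small. The predicate [E] will be everything for the spectrum, and the set of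
    y with S V y = 0 for the symbol. *)
Lemma local_null (z : 'rV[R]_n) (m : nat) (P : 'I_m -> poly) (C : R) :
  0 <= C -> (forall i, peval (P i) z = 0) ->
  exists d : R, 0 < d /\ forall (eta : R) (p : 'rV[R]_n) (E : X -> Prop), 0 < eta -> eta <= d -> eta <= 1 ->
    (forall j, `|p 0 j - z 0 j| <= B%:R * eta) ->
    (forall y, E y -> exists v : 'I_m -> X, [/\ forall i, E (v i),
     forall i, rnorm (v i) <= C * rnorm y &
     bump_op eta p y = \sum_i pop (P i) (bump_op eta p (v i))]) ->
    forall y, E y -> bump_op eta p y = 0.
Proof.
move=> C_ge0 Pz; pose L := \sum_i pnorm s1 (P i); pose Lip := \sum_i plip (P i).
have L0 : 0 <= L by apply: sumr_ge0 => i _; exact: pnorm_ge0.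
have Lip0 : 0 <= Lip by apply: sumr_ge0 => i _; exact: plip_ge0.
have mC : 0 <= m%:R * C by rewrite mulr_ge0.
pose kappa := (Num.bound (2 * (m%:R * C * L))).+1.
have kL : 2 * (m%:R * C * L) <= kappa%:R.
  apply: le_trans (ltW (archi_boundP _)) _; first by rewrite !mulr_ge0.
  by rewrite ler_nat.
pose c := 2 * (m%:R * C * (Lip * (B%:R * 2)) * kappa%:R ^+ (n * B.+1)).
have c0 : 0 <= c by rewrite !mulr_ge0 ?exprn_ge0.
exists (1 + c)^-1; split=> [|eta p E eta0 etad eta1 pz step y Ey].
  by rewrite invr_gt0 ltr_wpDr.
pose r := Lip * (B%:R * 2 * eta).
apply: (@bump_op_eq0 eta p m P C L r kappa E) => //.
- by rewrite !mulr_ge0 // ltW.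
- by move=> i; rewrite /L (bigD1 i) //= lerDl sumr_ge0 // => k _; exact: pnorm_ge0.
- move=> i t tp; rewrite -[peval _ _]subr0 -(Pz i).
  apply: le_trans (peval_lip (P i) (h := B%:R * 2 * eta) _ _) _.
  + by rewrite !mulr_ge0 // ltW.
  + move=> j; rewrite -[_ - _](subrKA (p 0 j)); apply: le_trans (ler_normD _ _) _.
    by rewrite [B%:R * 2]mulrC -mulrA mulrDl !mul1r lerD.
  + rewrite /r ler_wpM2r ?mulr_ge0 ?(ltW eta0) //.
    by rewrite /Lip (bigD1 i) //= lerDl sumr_ge0 // => k _; exact: plip_ge0.
- have -> : 2 * (m%:R * C * r * kappa%:R ^+ (n * B.+1)) = c * eta by rewrite /c /r; ring.
  apply: le_trans (ler_wpM2l c0 etad) _.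
  by rewrite ler_pdivrMr ?ltr_wpDr // mul1r lerDr.
Qed.

End Representation.

Lemma usum_tail (R : realType) (V : completeNormedModType R[i]) (I : choiceType)
    (F : I -> V) (A : {fset I}) (e : R) :
  abs_summable F ->
  (forall B : {fset I}, [disjoint A & B]%fset -> \sum_(i <- B) rnorm (F i) <= e) ->
  forall B : {fset I}, (A `<=` B)%fset -> rnorm (usum F - \sum_(i <- B) F i) <= e.
Proof.
move=> sF Fe B AB; apply/ler_addgt0Pr => d d0; have [D HD] := usum_near sF d0.
have := HD (B `|` D)%fset (fsubsetUr B D).
rewrite (big_fsetD _ (fsubsetUl B D)) => h; rewrite [leRHS]addrC.
set S := \sum_(i <- B) _ in h *; set T := \sum_(i <- _) _ in h.
rewrite (_ : usum F - S = (usum F - (S + T)) + T); last by rewrite opprD addrA subrK.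
rewrite (le_trans (ler_rnormD _ _)) // lerD // /T (le_trans (ler_rnorm_sum _ _ _)) //.
apply: Fe; apply/fdisjointP => i iA; rewrite !inE negb_and negbK.
by rewrite (fsubsetP AB).
Qed.

(** * Vanishing off the spectrum and off the zeros of the symbol; bisection *)

Section LocalNullity.
Variables (R : realType) (X : completeNormedModType R[i]) (n : nat).
Variables (U : 'rV[int]_n -> X -> X) (s : 'I_n -> R) (C0 : R) (B : nat).
Hypotheses (C0_ge0 : 0 <= C0) (s_ge0 : forall j, 0 <= s j).
Hypothesis sB : forall j, s j + 3 <= B%:R.
Hypothesis Ub : forall k, bounded_op (U k) (C0 * weight s k).
Hypothesis UD : forall k l x, U (k + l) x = U k (U l x).
Hypothesis U0 : forall x, U 0 x = x.
Local Notation S := (bump_op U B).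

Let UC k l x : U k (U l x) = U l (U k x).
Proof. by rewrite -!UD addrC. Qed.

Lemma bump_op_U eta (p : 'rV[R]_n) k x : 0 < eta -> eta <= 1 ->
  S eta p (U k x) = U k (S eta p x).
Proof. by move=> e0 e1; apply: (bump_op_comm C0_ge0 s_ge0 sB Ub p e0 e1 _ (Ub k)). Qed.

Lemma spectral_null (z : 'rV[R]_n) (C : R) : 0 <= C ->
  (forall x, exists y : 'I_n -> X, (forall j, rnorm (y j) <= C * rnorm x) /\
     x = \sum_j (U (delta_mx 0 j) (y j) - cis (z 0 j) *: y j)) ->
  exists d : R, 0 < d /\ forall (eta : R) (p : 'rV[R]_n) x, 0 < eta -> eta <= d -> eta <= 1 ->
    (forall j, `|p 0 j - z 0 j| <= B%:R * eta) -> S eta p x = 0.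
Proof.
move=> C1 surj.
pose P (j : 'I_n) : seq (R[i] * 'rV[int]_n) := [:: (1, delta_mx 0 j); (- cis (z 0 j), 0)].
have Pz j : peval (P j) z = 0.
  rewrite /peval /P big_cons big_seq1 /= dot0l cis0 mulr1 mul1r.
  rewrite /dot (bigD1 j) //= mxE !eqxx mul1r big1 ?addr0 ?subrr // => i ij.
  by rewrite mxE (negbTE ij) andbF mul0r.
have [d [d0 dP]] := local_null C0_ge0 s_ge0 sB Ub UD U0 C1 Pz.
exists d; split=> // eta p x e0 ed e1 pz; apply: (dP eta p (fun=> True)) => // y _.
have [v [vC yE]] := surj y; exists v; split=> //.
have Sb := bump_op_bounded C0_ge0 s_ge0 sB Ub p e0 e1.
rewrite {1}yE (bop_sum Sb); apply: eq_bigr => j _.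
rewrite (bopB Sb) (bopZ Sb) bump_op_U // /pop big_cons big_seq1 /=.
by rewrite U0 scale1r scaleNr.
Qed.

Section Refinement.
Variables (b : 'rV[int]_n -> R) (M : R) (x : X).
Hypothesis bM : forall A : {fset 'rV[int]_n}, \sum_(k <- A) `|b k| * weight s k <= M.

Let T (b : 'rV[int]_n -> R) (p : 'rV[R]_n) : X :=
  usum (fun k => ((b k)%:C * cis (- dot k p)) *: U k x).

(** Each cosine is the mean of two opposite phases, that is, of the shifts of p by theta and -theta
    along its axis. If the mean is nonzero, so is one of the two shifted sums; repeat along [r],
    where axes may recur. *)
Lemma cos_split (theta : R) (r : seq 'I_n) (p : 'rV[R]_n) :
  T (fun k => \prod_(j <- r) cos ((k 0 j)%:~R * theta) * b k) p <> 0 ->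
  exists p' : 'rV[R]_n, (forall j, `|p' 0 j - p 0 j| <= (count_mem j r)%:R * `|theta|) /\ T b p' <> 0.
Proof.
have cos1 (Q : seq 'I_n) (k : 'rV[int]_n) : `|\prod_(j <- Q) cos ((k 0 j)%:~R * theta)| <= 1.
  elim: Q => [|j Q IH]; first by rewrite big_nil normr1.
  by rewrite big_cons normrM -[leRHS]mulr1 ler_pM // cos_norm_le1.
have sumT Q q : abs_summable (fun k : 'rV[int]_n =>
    ((\prod_(j <- Q) cos ((k 0 j)%:~R * theta) * b k)%:C * cis (- dot k q)) *: U k x).
  apply: (wsum_summable C0_ge0 Ub (M := M)) => A; apply: le_trans (bM A).
  apply: ler_sum => k _; rewrite ler_wpM2r ?weight_ge0 // cnormM cnorm_cis mulr1 cnormR normrM.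
  by rewrite ler_piMl.
elim: r p => [|j r IH] p.
  move=> Tp; exists p; split=> [j|]; first by rewrite subrr normr0 mul0r.
  by move: Tp; congr (_ <> _); congr usum; apply/funext => k; rewrite big_nil mul1r.
pose e : 'rV[R]_n := theta *: delta_mx 0 j.
have dotE k : dot k e = (k 0 j)%:~R * theta.
  rewrite /e dotZr mulrC; congr (_ * _); rewrite /dot (bigD1 j) //= mxE !eqxx mulr1.
  by rewrite big1 ?addr0 // => i ij; rewrite mxE (negbTE ij) andbF mulr0.
pose b1 (k : 'rV[int]_n) := \prod_(j <- r) cos ((k 0 j)%:~R * theta) * b k.
have -> : T (fun k => \prod_(i <- j :: r) cos ((k 0 i)%:~R * theta) * b k) p =
    2^-1 *: (T b1 (p + e) + T b1 (p - e)).
  rewrite -usumD; [|exact: sumT|exact: sumT].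
  rewrite -usumZ; last by apply: abs_summableD; exact: sumT.
  congr usum; apply/funext => k; rewrite -scalerDl scalerA; congr (_ *: _).
  have cosE u : (cos u)%:C = 2^-1 * (cis (- u) + cis u) :> R[i].
    have -> : cis (- u) + cis u = 2 * (cos u)%:C.
      rewrite /cis cosN sinN; apply/eqP; rewrite eq_complex /=.
      by rewrite !(mul0r, mulr0, add0r, addr0, subr0, addNr) eqxx andbT; apply/eqP; ring.
    by rewrite mulKf // pnatr_eq0.
  rewrite big_cons -mulrA -/(b1 k) rmorphM /= cosE !dotDr dotNr dotE !opprD opprK !cisD.
  by ring.
move=> Tne.
have next (q : 'rV[R]_n) : (forall i, `|q 0 i - p 0 i| <= (i == j)%:R * `|theta|) -> T b1 q <> 0 ->
    exists p' : 'rV[R]_n, (forall i, `|p' 0 i - p 0 i| <= (count_mem i (j :: r))%:R * `|theta|) /\ T b p' <> 0.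
  move=> qp /IH[p' [p'q Tp']]; exists p'; split=> // i.
  rewrite -(subrKA (q 0 i)) (le_trans (ler_normD _ _)) //= natrD mulrDl addrC eq_sym.
  by rewrite lerD.
have [T0|] := pselect (T b1 (p + e) = 0); last first.
  apply: next => i; rewrite !mxE addrAC subrr add0r normrM mulrC ?eqxx /=.
  by case: (i == j); rewrite ?normr0 ?normr1.
have [T1|] := pselect (T b1 (p - e) = 0); last first.
  apply: next => i; rewrite !mxE addrAC subrr add0r normrN normrM mulrC ?eqxx /=.
  by case: (i == j); rewrite ?normr0 ?normr1.
by case: Tne; rewrite T0 T1 addr0 scaler0.
Qed.

End Refinement.

Lemma sinc_bump_half (eta : R) (k : 'rV[int]_n) :
  sinc_bump eta B k = \prod_(j <- [seq q.1 | q <- index_enum ('I_n * 'I_B)%type])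
    cos ((k 0 j)%:~R * (eta / 2)) * sinc_bump (eta / 2) B k.
Proof.
rewrite big_map -(pair_bigA _ (fun (j : 'I_n) (_ : 'I_B) => cos ((k 0 j)%:~R * (eta / 2)))) /=.
rewrite -big_split /=; apply: eq_bigr => j _.
by rewrite prodr_const card_ord sinc_half exprMn -mulrA.
Qed.

Lemma bump_op_refine (eta : R) (p : 'rV[R]_n) x : 0 < eta -> eta <= 1 -> S eta p x <> 0 ->
  exists p' : 'rV[R]_n, (forall j, `|p' 0 j - p 0 j| <= B%:R * (eta / 2)) /\ S (eta / 2) p' x <> 0.
Proof.
move=> eta0 eta1 Sx; have h0 : 0 < eta / 2 by rewrite divr_gt0.
have h1 : eta / 2 <= 1 by lra.
have bM (A : {fset 'rV[int]_n}) : \sum_(k <- A) `|sinc_bump (eta / 2) B k| * weight s k <= bump_mass s B (eta / 2).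
  apply: le_trans (sum_bump_coef s_ge0 sB 0 h0 h1 A); apply: ler_sum => k _.
  by rewrite cnorm_bump_coef ler_wpM2l // weight_s_le_s1.
have [|p' [pp' Sp']] := cos_split (x := x) bM (theta := eta / 2)
    (r := [seq q.1 | q <- index_enum ('I_n * 'I_B)%type]) (p := p).
  by move: Sx; congr (_ <> _); congr usum; apply/funext => k; rewrite /bump_coef sinc_bump_half.
exists p'; split=> // j; rewrite -(gtr0_norm h0).
apply: le_trans (pp' j) _; rewrite (_ : count_mem j _ = B) // count_map.
rewrite -sum1_count big_mkcond -(pair_bigA _ (fun (i : 'I_n) (_ : 'I_B) => if i == j then 1 else 0)%N) /=.
rewrite (bigD1 j) //= [X in (_ + X)%N]big1 ?addn0 => [|i /negbTE ij]; last by rewrite big1 // ij.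
by rewrite eqxx sum1_card card_ord.
Qed.

Lemma bump_op_support (eta : R) (p : 'rV[R]_n) x : 0 < eta -> eta <= 1 -> S eta p x <> 0 ->
  exists z : 'rV[R]_n, (forall j, `|p 0 j - z 0 j| <= B%:R * eta) /\
    forall i : nat, exists p' : 'rV[R]_n,
      (forall j, `|p' 0 j - z 0 j| <= B%:R * (eta / 2 ^+ i)) /\ S (eta / 2 ^+ i) p' x <> 0.
Proof.
move=> eta0 eta1 Sx; pose e i := eta / 2 ^+ i.
have e0 i : 0 < e i by rewrite divr_gt0 // exprn_gt0.
have eS i : e i.+1 = e i / 2 by rewrite /e exprSr invfM mulrA.
have e1 i : e i <= 1.
  by rewrite ler_pdivrMr ?exprn_gt0 // mul1r (le_trans eta1) // exprn_ege1 // ler1n.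
have ex (ip : nat * 'rV[R]_n) : exists p' : 'rV[R]_n, S (e ip.1) ip.2 x <> 0 ->
    (forall j, `|p' 0 j - ip.2 0 j| <= B%:R * e ip.1.+1) /\ S (e ip.1.+1) p' x <> 0.
  have [S0|S0] := pselect (S (e ip.1) ip.2 x = 0); first by exists 0.
  have [p' H] := bump_op_refine (e0 _) (e1 _) S0; exists p' => _.
  by rewrite eS.
have [f fP] := choice ex.
pose u := fix u i := if i is i'.+1 then f (i', u i') else p.
have uS i : S (e i) (u i) x <> 0.
  elim: i => [|i IH]; first by rewrite /e expr0 divr1.
  by have [] := fP (i, u i) IH.
have ud i j : `|u i.+1 0 j - u i 0 j| <= B%:R * e i.+1.
  by have [] := fP (i, u i) (uS i).
(* With e_i = eta/2^i, the intervals of radius B e_i about the centres u_i are nested in each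
   coordinate, as the centre moves by at most B e_{i+1} = B e_i/2. Their common point z is the
   supremum of the left ends. *)
pose lo j := [set u i 0 j - B%:R * e i | i in [set: nat]].
have mono j i k : u i 0 j - B%:R * e i <= u (i + k)%N 0 j - B%:R * e (i + k)%N /\
    u (i + k)%N 0 j + B%:R * e (i + k)%N <= u i 0 j + B%:R * e i.
  elim: k => [|k [IH1 IH2]]; first by rewrite addn0.
  rewrite addnS; have := ud (i + k)%N j; rewrite ler_norml => /andP[].
  move: IH1 IH2; rewrite !eS mulrA.
  by set v := B%:R * e (i + k)%N; lra.
have Be i : 0 <= B%:R * e i by rewrite mulr_ge0 // ltW.
have cross j i k : u i 0 j - B%:R * e i <= u k 0 j + B%:R * e k.
  have [m1 _] := mono j i k; have [_ m2] := mono j k i.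
  rewrite addnC in m2; have := Be (i + k)%N; lra.
pose z : 'rV[R]_n := \row_j sup (lo j).
have zu i j : `|u i 0 j - z 0 j| <= B%:R * e i.
  have hs : has_sup (lo j).
    split; first by exists (u 0%N 0 j - B%:R * e 0%N), 0%N.
    by exists (u 0%N 0 j + B%:R * e 0%N) => _ [k _ <-]; exact: cross.
  rewrite mxE ler_distlC; apply/andP; split.
    by apply: sup_upper_bound => //; exists i.
  by apply: ge_sup; [exact: hs.1|move=> _ [k _ <-]; exact: cross].
exists z; split=> [j|i]; first by have := zu 0%N j; rewrite /e expr0 divr1.
by exists (u i); split=> [j|]; [exact: zu|exact: uS].
Qed.

Section Symbol.
Variables (I : choiceType) (c : I -> R[i]) (ix : I -> 'rV[int]_n) (La : R).
Hypothesis cLa : forall A : {fset I}, \sum_(i <- A) cnorm (c i) * weight s (ix i) <= La.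

(** Terms are indexed apart from their frequencies because only the frequencies M k occur in V; [ix]
    will be multiplication by M. *)
Definition Vop (x : X) : X := usum (fun i => c i *: U (ix i) x).

Definition symbol (t : 'rV[R]_n) : R[i] :=
  usum (fun i => c i * cis (dot (ix i) t) : complex_line R).

Definition trunc (A : {fset I}) : seq (R[i] * 'rV[int]_n) := [seq (c i, ix i) | i <- A].

Lemma La_ge0 : 0 <= La.
Proof. by have := cLa fset0; rewrite big_seq_fset0. Qed.

Let Vterm i x : rnorm (c i *: U (ix i) x) <= C0 * rnorm x * (cnorm (c i) * weight s (ix i)).
Proof. exact: term_le. Qed.

Let Vsum (A : {fset I}) M x : \sum_(i <- A) cnorm (c i) * weight s (ix i) <= M ->
  \sum_(i <- A) rnorm (c i *: U (ix i) x) <= C0 * M * rnorm x.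
Proof.
move=> AM; apply: (le_trans (ler_sum _ (fun i _ => Vterm i x))).
by rewrite -mulr_sumr mulrAC ler_wpM2r ?rnorm_ge0 // ler_wpM2l.
Qed.

Lemma Vop_summable x : abs_summable (fun i => c i *: U (ix i) x).
Proof. by exists (C0 * La * rnorm x) => A; exact: Vsum. Qed.

Lemma Vop_bounded : bounded_op Vop (C0 * La).
Proof.
split=> [d x y|x]; last by apply: usum_le => A; exact: Vsum.
rewrite /Vop -(usumZ _ (Vop_summable x)).
rewrite -(usumD (abs_summableZ _ (Vop_summable x)) (Vop_summable y)).
by congr usum; apply/funext => k; rewrite (Ub _).1 scalerDr !scalerA [d * _]mulrC.
Qed.

Lemma Vop_comm (A : X -> X) a x : bounded_op A a -> (forall k x, A (U k x) = U k (A x)) ->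
  Vop (A x) = A (Vop x).
Proof.
move=> Ab AU; rewrite /Vop (usum_bop Ab (Vop_summable x)).
by congr usum; apply/funext => k; rewrite (bopZ Ab) AU.
Qed.

Lemma Vop_U k x : Vop (U k x) = U k (Vop x).
Proof. exact: Vop_comm (Ub k) _. Qed.

Let symterm i t : cnorm (c i * cis (dot (ix i) t)) <= cnorm (c i) * weight s (ix i).
Proof.
by rewrite cnormM cnorm_cis ler_wpM2l ?cnorm_ge0 // weight_ge1.
Qed.

(** One finite set controls V, its symbol and the weighted coefficients at once. It is stated for
    all larger sets, so that a truncation can be enlarged later without losing the bounds. *)
Lemma trunc_tail (e : R) : 0 < e -> exists A : {fset I}, forall D : {fset I}, (A `<=` D)%fset ->
  [/\ forall x, rnorm (Vop x - pop U (trunc D) x) <= C0 * e * rnorm x,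
      forall t, cnorm (symbol t - peval (trunc D) t) <= e &
      \sum_(i <- (D `\` A)%fset) cnorm (c i) * weight s (ix i) <= e].
Proof.
move=> e0; have F0 i : 0 <= cnorm (c i) * weight s (ix i).
  by rewrite mulr_ge0 ?cnorm_ge0 ?weight_ge0.
have [A HA] := sum_fset_tail F0 cLa e0.
exists A => D AD; split.
- move=> x; rewrite /pop big_map; apply: (usum_tail (Vop_summable x) _ AD) => E AE.
  exact: Vsum (HA E AE).
- move=> t; rewrite /peval big_map.
  apply: (@usum_tail _ (complex_line R) _ (fun i => c i * cis (dot (ix i) t)) A e _ _ _ AD).
    exists La => E; apply: le_trans (cLa E); apply: ler_sum => i _; exact: symterm.
  by move=> E AE; apply: le_trans (HA E AE); apply: ler_sum => i _; exact: symterm.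
- apply: HA; apply/fdisjointP => i iA; by rewrite inE iA.
Qed.

(* With a the value at z of a truncation P of V, the rest Q = V - P is small and
   N = (a + Q)^-1, so y = V (N y) - (P - a) (N y), where P - a vanishes at z. *)
Lemma symbol_null (z : 'rV[R]_n) : symbol z != 0 ->
  exists d : R, 0 < d /\ forall (eta : R) (p : 'rV[R]_n) y, 0 < eta -> eta <= d -> eta <= 1 ->
    (forall j, `|p 0 j - z 0 j| <= B%:R * eta) -> S eta p (Vop y) = 0 -> S eta p y = 0.
Proof.
rewrite -cnorm_eq0 => az0; have az : 0 < cnorm (symbol z) by rewrite lt0r az0 cnorm_ge0.
(* Makes both e and C0 e at most |g(z)|/4, so |a| >= 3|g(z)|/4 exceeds the norm C0 e of [Q]. *)
pose e := cnorm (symbol z) / (4 * (1 + C0)).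
have C1 : 0 < 4 * (1 + C0) by rewrite mulr_gt0 // ltr_wpDr.
have e0 : 0 < e by rewrite divr_gt0.
have [A /(_ A (fsubset_refl A))[QA symA _]] := trunc_tail e0.
set a := peval (trunc A) z.
have eC : e * (1 + C0) = cnorm (symbol z) / 4.
  by rewrite /e; field; rewrite gt_eqF // ltr_wpDr.
have ea : e <= cnorm (symbol z) / 4 by rewrite -eC ler_pMr // lerDl.
have Ce : C0 * e <= cnorm (symbol z) / 4 by rewrite -eC [C0 * e]mulrC ler_wpM2l ?(ltW e0) // lerDr.
have a34 : cnorm (symbol z) * (3 / 4) <= cnorm a.
  have := ler_cnormD (symbol z - a) a; rewrite subrK; have := symA z; rewrite -/a.
  by move: ea; lra.
pose Q x := Vop x - pop U (trunc A) x.
have Pb := pop_bounded Ub (trunc A).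
have Qb : bounded_op Q (C0 * e).
  split=> [d x y|x]; last exact: QA.
  by rewrite /Q Vop_bounded.1 Pb.1 opprD addrACA scalerBr.
have Ce0 : 0 <= C0 * e by rewrite mulr_ge0 // ltW.
have [|N [cN [Nb NQ QN Ncomm]]] := neumann_shift (u := - a) Ce0 _ Qb.
  by rewrite cnormN; apply: le_lt_trans Ce _; apply: lt_le_trans a34; lra.
have QU k x : Q (U k x) = U k (Q x).
  by rewrite /Q Vop_U (bopB (Ub k)) (U_pop Ub UD).
have QB (D : X -> X) d : bounded_op D d -> (forall k x, D (U k x) = U k (D x)) ->
    forall x, Q (D x) = D (Q x).
  move=> Db DU x; rewrite /Q (Vop_comm _ Db DU) (bopB Db) (pop_comm _ _ Db) // => k y.
have NU k x : N (U k x) = U k (N x) by apply: (Ncomm _ _ _ (Ub k)) => y; exact: QU.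
pose P := (- a, 0) :: trunc A.
have PE x : pop U P x = pop U (trunc A) x - a *: x.
  by rewrite /P /pop big_cons /= U0 scaleNr addrC.
have Pz (i : 'I_1) : peval P z = 0.
  by rewrite /P /peval big_cons /= dot0l cis0 mulr1 addNr.
have cN0 : 0 <= `|cN| by [].
have [d [d0 dP]] := @local_null _ _ _ _ _ _ _ C0_ge0 s_ge0 sB Ub UD U0 z 1 (fun=> P) _ cN0 Pz.
exists d; split=> // eta p y eta0 etad eta1 pz SVy.
have Sb := bump_op_bounded C0_ge0 s_ge0 sB Ub p eta0 eta1.
have SU k x : S eta p (U k x) = U k (S eta p x) by exact: bump_op_U.
apply: (dP eta p (fun y => S eta p (Vop y) = 0)) => // {y SVy}y SVy.
have NS x : N (S eta p x) = S eta p (N x).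
  by apply: (Ncomm _ _ _ Sb) => v; exact: (QB _ _ Sb SU).
have NV x : N (Vop x) = Vop (N x).
  by apply: (Ncomm _ _ _ Vop_bounded) => v; exact: (QB _ _ Vop_bounded Vop_U).
(* All operators commute, so S V (N y) = N S V y = 0. Only the letter remains: S y = P(U) S (-N y),
   and -N y satisfies the same predicate. *)
exists (fun=> - N y); split.
- by move=> _; rewrite (bopN Vop_bounded) (bopN Sb) -NV -NS SVy (bop0 Nb) oppr0.
- by move=> _; rewrite rnormN (bop_le Nb (ler_norm cN)).2.
rewrite big_ord1.
have yE : y = Vop (N y) - pop U P (N y).
  rewrite PE -{1}(QN y) /Q scaleNr opprK opprB addrA [RHS]addrAC.
  by rewrite [RHS]addrC addrA addrAC addrC addrA addrAC.
have Pcomm x : pop U P (S eta p x) = S eta p (pop U P x) by exact: pop_comm Sb SU.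
rewrite Pcomm (bopN (pop_bounded Ub P)) (bopN Sb) {1}yE (bopB Sb).
by rewrite -NV -NS SVy (bop0 Nb) sub0r.
Qed.

End Symbol.

End LocalNullity.

(** * The Beurling-Pollard estimate *)

Section GridAnalysis.
Variables (R : realType) (n : nat).

Lemma count_interval (N : nat) (a y h : R) : 0 < a -> 0 <= h ->
  #|[pred i : 'I_N.+1 | `|a * i%:R - y| <= h]|%:R <= 2 * h / a + 1.
Proof.
move=> a0 h0; set A := [pred i : 'I_N.+1 | _]; set v := 2 * h / a.
have v0 : 0 <= v by rewrite divr_ge0 ?mulr_ge0 // ltW.
have [i1 Ai1|A0] := pickP A; last by rewrite eq_card0 // addr_ge0.
have [i0 Ai0 i0min] := arg_minnP (fun i : 'I_N.+1 => i : nat) Ai1.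
pose M := Num.truncn v.
have sub : {subset A <= [seq inord (i0 + k) | k : 'I_M.+1]}.
  move=> i /[!inE] Ai; have i0i := i0min i Ai.
  have iM : (i - i0 < M.+1)%N.
    rewrite ltnS /M truncn_ge_nat // /v ler_pdivlMr // natrB //.
    have : `|a * i0%:R - y| <= h := Ai0.
    move: Ai; rewrite !ler_norml => /andP[h1 h2] /andP[h3 h4].
    rewrite mulrBl ![_ * a]mulrC; lra.
  apply/mapP; exists (Ordinal iM); rewrite ?mem_enum //=.
  by apply: val_inj; rewrite /= inordK subnKC.
have le : (#|A| <= M.+1)%N.
  apply: leq_trans (subset_leq_card _) _; first exact/fintype.subsetP/sub.
  by rewrite (leq_trans (leq_image_card _ _)) // card_ord.
apply: (@le_trans _ _ (M.+1)%:R); first by rewrite ler_nat.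
by rewrite -natr1 lerD2r /M truncn_le.
Qed.

(** The count is a product over coordinates, and an interval of length 2h contains at most a
    fraction h/pi + 1/N of N points of spacing 2 pi/N. *)
Lemma count_cube (K : nat) (y : 'rV[R]_n) (h : R) : 0 <= h ->
  (K.*2.+1%:R ^- n) * #|[pred f | [forall j, `|grid_point R f 0 j - y 0 j| <= h]]
     : pred {ffun 'I_n -> 'I_(K.*2.+1)}|%:R <= (h + (K.*2.+1%:R)^-1) ^+ n.
Proof.
move=> h0; set N : nat := K.*2.+1.
have N0 : 0 < N%:R :> R by rewrite ltr0n.
pose ind (b : bool) : R := b%:R.
have card_sum (T : finType) (P : pred T) : #|P|%:R = \sum_(t : T) ind (P t).
  rewrite -sum1_card natr_sum big_mkcond /=; apply: eq_bigr => t _.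
  by rewrite /ind unfold_in; case: (P t).
pose t (i : 'I_N) : R := 2 * pi / N%:R * i%:R.
pose y' j := y 0 j + 2 * pi / N%:R * K%:R.
rewrite card_sum /=.
have -> : \sum_(f : {ffun 'I_n -> 'I_N}) ind [forall j, `|grid_point R f 0 j - y 0 j| <= h] =
    \sum_(f : {ffun 'I_n -> 'I_N}) \prod_j ind (`|t (f j) - y' j| <= h).
  apply: eq_bigr => f _.
  have E (j : 'I_n) : grid_point R f 0 j - y 0 j = t (f j) - y' j.
    by rewrite !mxE /centered rmorphB /= -!pmulrn mulrBr opprD addrA addrAC.
  case: (boolP [forall j, _]) => [/forallP H|].
    by rewrite big1 // => j _; rewrite -E H.
  rewrite negb_forall => /existsP[j /negbTE Hj].
  by rewrite (bigD1 j) //= -E Hj mul0r.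
rewrite -(bigA_distr_bigA (fun j (i : 'I_N) => ind (`|t i - y' j| <= h))).
rewrite -[X in _ ^- X]card_ord -[X in _ <= _ ^+ X]card_ord -exprVn -!prodr_const -big_split /=.
apply: ler_prod => j _; rewrite mulr_ge0 ?invr_ge0 ?ler0n ?sumr_ge0 //=.
have pN : 0 < 2 * pi / N%:R :> R by rewrite divr_gt0 // mulr_gt0 // pi_gt0.
have := @count_interval K.*2 (2 * pi / N%:R) (y' j) h pN h0.
rewrite card_sum /= => /(ler_wpM2l (_ : 0 <= N%:R^-1)); rewrite invr_ge0 ltW // => /(_ isT).
move/le_trans; apply; rewrite mulrDr mulr1 lerD2r.
have -> : N%:R^-1 * (2 * h / (2 * pi / N%:R)) = h / pi.
  have p0 : (pi : R) != 0 by rewrite gt_eqF ?pi_gt0.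
  have n0 : (N%:R : R) != 0 by rewrite gt_eqF.
  move: (pi : R) (N%:R : R) p0 n0 => p q p0 q0.
  by field; rewrite ?p0 ?q0.
by rewrite ler_pdivrMr ?pi_gt0 // ler_peMr // (le_trans _ (pi_ge2 R)) // ler1n.
Qed.

Lemma conj_cis (u : R) : (cis u)^*%C = cis (- u).
Proof. by rewrite /cis /= cosN sinN. Qed.

Lemma cnorm_sqrE (z : R[i]) : (cnorm z ^+ 2)%:C = z * z^*%C.
Proof. by rewrite rmorphXn /= -cnormE sqr_normc. Qed.

(** Orthogonality of characters. As grid points and frequencies carry the same indices, [dot] is
    symmetric in them, and two indices in -K..K that agree mod 2K + 1 are equal. *)
Lemma grid_parseval (K : nat) (h : {ffun 'I_n -> 'I_(K.*2.+1)} -> R[i]) :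
  \sum_(k <- zbox n K) cnorm (\sum_f h f * cis (- dot k (grid_point R f))) ^+ 2 =
  K.*2.+1%:R ^+ n * \sum_f cnorm (h f) ^+ 2.
Proof.
have conjM (x y : R[i]) : (x * y)^*%C = x^*%C * y^*%C by rewrite rmorphM.
set N : nat := K.*2.+1; apply: (@complexI R).
rewrite zbox_sum rmorphM rmorphXn rmorph_nat !rmorph_sum /=.
under eq_bigr do rewrite cnorm_sqrE rmorph_sum /= mulr_suml.
rewrite exchange_big mulr_sumr /=; apply: eq_bigr => f _.
under eq_bigr do rewrite mulr_sumr.
rewrite exchange_big /= (bigD1 f) //= [X in _ + X]big1 ?addr0.
  under eq_bigr do rewrite conjM conj_cis opprK mulrACA -cisD addNr cis0 mulr1.
  by rewrite sumr_const card_ffun !card_ord cnorm_sqrE -natrX mulr_natl.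
move=> f' ff'; have sym (k l : {ffun 'I_n -> 'I_N}) :
    dot (box_index k) (grid_point R l) = dot (box_index l) (grid_point R k).
  by rewrite /dot; apply: eq_bigr => j _; rewrite !mxE; ring.
under eq_bigr => k _ do rewrite conjM conj_cis opprK mulrACA -cisD (sym k f) (sym k f') -dotNl -dotDl.
rewrite -mulr_sumr grid_sum; case: ifPn => [/forallP H|_]; last by rewrite mulr0.
case/eqP: ff'; apply/ffunP => j; apply/val_inj.
have := H j; rewrite !mxE /centered; have := ltn_ord (f j); have := ltn_ord (f' j).
set u : nat := f j; set v : nat := f' j => uN vN.
have -> : (`|(- (u%:Z - K%:Z) + (v%:Z - K%:Z))%R| = `|(u%:Z - v%:Z)%R|)%N by lia.
have goalE : `|(u%:Z - v%:Z)%R|%N = 0%N -> v = u by lia.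
move=> /dvdnP[q]; case: q => [|q]; first by rewrite mul0n.
move: uN vN; rewrite /N => uN vN.
rewrite mulSn => E; have : (N <= `|(u%:Z - v%:Z)%R|)%N by rewrite E leq_addr.
by lia.
Qed.

End GridAnalysis.

(** * Averages of the bumps S_p over a grid *)

Section GridBump.
Variables (R : realType) (X : completeNormedModType R[i]) (n : nat).
Variables (U : 'rV[int]_n -> X -> X) (s : 'I_n -> R) (C0 : R) (B : nat).
Hypotheses (C0_ge0 : 0 <= C0) (s_ge0 : forall j, 0 <= s j).
Hypothesis sB : forall j, s j + 3 <= B%:R.
Hypothesis Ub : forall k, bounded_op (U k) (C0 * weight s k).
Local Notation S := (bump_op U B).
Variables (eta : R) (eta_gt0 : 0 < eta) (eta_le1 : eta <= 1) (K : nat).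
Local Notation N := (K.*2.+1).
Local Notation index := {ffun 'I_n -> 'I_N}.

Definition grid_coef (h : index -> R[i]) (k : 'rV[int]_n) : R[i] :=
  (N%:R ^+ n)^-1 * \sum_f h f * cis (- dot k (grid_point R f)).

(** The phase e^{-ik.p} inside S_p turns the average over p into a discrete Fourier coefficient of h
    in front of U_k. *)
Lemma grid_bumpE (h : index -> R[i]) x :
  (N%:R ^+ n)^-1 *: \sum_f h f *: S eta (grid_point R f) x =
  usum (fun k => (grid_coef h k * (sinc_bump eta B k)%:C) *: U k x).
Proof.
have sb (p : 'rV[R]_n) := bump_op_summable C0_ge0 s_ge0 sB Ub p eta_gt0 eta_le1 x.
have sh (f : index) : abs_summable (fun k => h f *: (bump_coef B eta (grid_point R f) k *: U k x)).
  exact: abs_summableZ.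
under eq_bigr => f _ do rewrite -usumZ //.
rewrite -usum_sum // -usumZ; last exact: abs_summable_sum.
congr usum; apply/funext => k.
under eq_bigr do rewrite scalerA.
rewrite -scaler_suml scalerA /grid_coef -mulrA; congr (_ * _ *: _).
by rewrite mulr_suml; apply: eq_bigr => f _; rewrite /bump_coef mulrCA [RHS]mulrC mulrCA.
Qed.

Lemma grid_coef_le (h : index -> R[i]) k rho :
  (forall f, cnorm (h f) <= rho) -> cnorm (grid_coef h k) <= rho.
Proof.
move=> hr; have N0 : 0 < N%:R ^+ n :> R by rewrite exprn_gt0 // ltr0n.
rewrite cnormM cnormV cnormX cnorm_nat mulrC ler_pdivrMr //.
apply: (le_trans (ler_cnorm_sum _ _ _)).
apply: (@le_trans _ _ (\sum_(f : index) rho)).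
  by apply: ler_sum => f _; rewrite cnormM cnorm_cis mulr1.
by rewrite sumr_const card_ffun !card_ord -natrX mulr_natr.
Qed.

Lemma coef_bump_mass (g : 'rV[int]_n -> R[i]) rho (A : {fset 'rV[int]_n}) :
  0 <= rho -> (forall k, cnorm (g k) <= rho) ->
  \sum_(k <- A) cnorm (g k * (sinc_bump eta B k)%:C) * weight (fun j => s j + 1) k
    <= rho * bump_mass s B eta.
Proof.
move=> r0 gr; apply: le_trans (ler_wpM2l r0 (sum_bump_coef s_ge0 sB 0 eta_gt0 eta_le1 A)).
rewrite mulr_sumr; apply: ler_sum => k _.
by rewrite cnormM cnormR cnorm_bump_coef -mulrA ler_wpM2r ?mulr_ge0 ?weight_ge0.
Qed.

Definition bump_mass2 : R :=
  (3 * 2 ^+ (B * 2)) ^+ n * (eta^-1 ^+ n * eta^-1 `^ (\sum_j (s j + s j))).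

Lemma sum_bump2 (A : {fset 'rV[int]_n}) :
  \sum_(k <- A) (`|sinc_bump eta B k| * weight s k) ^+ 2 <= bump_mass2.
Proof.
apply: le_trans (@sum_bump_weight R n eta (fun j => s j + s j) B 2 A eta_gt0 eta_le1 _ _).
- apply: ler_sum => k _; rewrite exprMn; rewrite ler_wpM2l ?exprn_ge0 //.
  rewrite /weight -prodrXl le_eqVlt; apply/orP; left; apply/eqP; apply: eq_bigr => j _.
  have p : 0 < 1 + `|(k 0 j)%:~R| :> R by rewrite ltr_wpDr.
  by rewrite expr2 powRD // (gt_eqF p) implybT.
- by move=> j; rewrite addr_ge0.
- by move=> j; rewrite natrM; have := sB j; lra.
Qed.

(** Cauchy-Schwarz in the form 2uv <= theta u^2 + v^2/theta on the box of frequencies, with Parseval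
    for the coefficients and [sum_bump2] for the weighted bump. Outside the box only the bound rho
    on the coefficients is available, and it gives the term over 1 + K. *)
Lemma grid_bump_le (W : pred index) (h : index -> R[i]) (rho theta : R) x :
  0 <= rho -> 0 < theta -> (forall f, W f -> cnorm (h f) <= rho) ->
  rnorm ((N%:R ^+ n)^-1 *: \sum_(f | W f) h f *: S eta (grid_point R f) x) <=
  C0 * rnorm x * ((theta * ((N%:R ^+ n)^-1 * #|W|%:R * rho ^+ 2) + theta^-1 * bump_mass2) / 2
     + rho * bump_mass s B eta / (1 + K%:R)).
Proof.
move=> r0 t0 hW; pose h' f := if W f then h f else 0.
have h'r f : cnorm (h' f) <= rho by rewrite /h'; case: ifPn => [/hW//|_]; rewrite cnorm0.
have -> : \sum_(f | W f) h f *: S eta (grid_point R f) x = \sum_f h' f *: S eta (grid_point R f) x.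
  by rewrite big_mkcond; apply: eq_bigr => f _; rewrite /h'; case: ifP => // _; rewrite scale0r.
rewrite grid_bumpE.
have gr k := grid_coef_le k h'r.
apply: le_trans (usum_split_zbox C0_ge0 Ub x K (fun A => coef_bump_mass A r0 gr)) _.
rewrite ler_wpM2l ?mulr_ge0 ?rnorm_ge0 // lerD2r.
have N0 : 0 < N%:R ^+ n :> R by rewrite exprn_gt0 // ltr0n.
apply: (@le_trans _ _ ((theta * \sum_(k <- zbox n K) cnorm (grid_coef h' k) ^+ 2 +
   theta^-1 * \sum_(k <- zbox n K) (`|sinc_bump eta B k| * weight s k) ^+ 2) / 2)).
  rewrite !mulr_sumr -big_split /= mulr_suml; apply: ler_sum => k _.
  rewrite cnormM cnormR -mulrA; set u := cnorm _; set v := _ * weight s k.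
  rewrite ler_pdivlMr // -(ler_pM2l t0) [leRHS]mulrDr mulVKf ?gt_eqF //.
  by have := sqr_ge0 (theta * u - v); rewrite sqrrB mulr2n !expr2; lra.
rewrite ler_pM2r ?invr_gt0 // lerD //; last first.
  by rewrite ler_wpM2l ?invr_ge0 ?(ltW t0) // sum_bump2.
rewrite ler_wpM2l ?(ltW t0) //.
have -> : \sum_(k <- zbox n K) cnorm (grid_coef h' k) ^+ 2 =
    (N%:R ^+ n)^-1 * \sum_f cnorm (h' f) ^+ 2.
  under eq_bigr do rewrite /grid_coef cnormM exprMn cnormV cnormX cnorm_nat.
  by rewrite -mulr_sumr grid_parseval expr2 -mulrA mulKf // gt_eqF.
rewrite -mulrA ler_pM2l ?invr_gt0 //.
have -> : #|W|%:R * rho ^+ 2 = \sum_(f | W f) rho ^+ 2 by rewrite sumr_const mulr_natl.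
rewrite [leRHS]big_mkcond; apply: ler_sum => f _; rewrite /h'; case: ifPn => [/hW h1|_].
  by rewrite lerXn2r ?nnegrE ?cnorm_ge0.
by rewrite cnorm0 expr0n.
Qed.

(** No aliasing occurs inside the box: two frequencies there that agree mod 2K + 1 coincide, so the
    grid returns the coefficients of F exactly. The error comes from frequencies outside, which cost
    1/(1 + K). *)
Lemma grid_average (F : seq (R[i] * 'rV[int]_n)) x :
  (forall q, q \in F -> q.2 \in zbox n K) ->
  rnorm (\sum_(q <- F) (q.1 * (sinc_bump eta B q.2)%:C) *: U q.2 x -
     (N%:R ^+ n)^-1 *: \sum_(f : index) peval F (grid_point R f) *: S eta (grid_point R f) x) <=
  C0 * rnorm x * (2 * (\sum_(q <- F) cnorm q.1) * bump_mass s B eta / (1 + K%:R)).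
Proof.
move=> FK; rewrite grid_bumpE.
set c1 := \sum_(q <- F) cnorm q.1.
have c1_ge0 : 0 <= c1 by apply: sumr_ge0 => q _; exact: cnorm_ge0.
pose g k : R[i] := \sum_(q <- F) (if k == q.2 then q.1 else 0).
have gle k : cnorm (g k) <= c1.
  apply: le_trans (ler_cnorm_sum _ _ _) _; apply: ler_sum => q _.
  by case: ifP => // _; rewrite cnorm0 cnorm_ge0.
have sumE (A : {fset 'rV[int]_n}) M (e : 'rV[int]_n -> R[i]) : 0 <= M -> (forall k, cnorm (e k) <= M) ->
    \sum_(k <- A) cnorm (e k * (sinc_bump eta B k)%:C) * weight s k <= M * bump_mass s B eta.
  move=> M0 eM; apply: le_trans (coef_bump_mass A M0 eM); apply: ler_sum => k _.
  by rewrite ler_wpM2l ?cnorm_ge0 // weight_s_le_s1.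
have TE : \sum_(q <- F) (q.1 * (sinc_bump eta B q.2)%:C) *: U q.2 x =
    usum (fun k => (g k * (sinc_bump eta B k)%:C) *: U k x).
  have E q : (q.1 * (sinc_bump eta B q.2)%:C) *: U q.2 x =
      usum (fun k => ((if k == q.2 then q.1 else 0) * (sinc_bump eta B k)%:C) *: U k x).
    rewrite (@usum_fset _ _ _ _ [fset q.2]%fset); last first.
      by move=> k; rewrite inE => /negbTE ->; rewrite mul0r scale0r.
    by rewrite big_seq_fset1 eqxx.
  have sE (q : R[i] * 'rV[int]_n) : abs_summable
      (fun k => ((if k == q.2 then q.1 else 0) * (sinc_bump eta B k)%:C) *: U k x).
    apply: (wsum_summable C0_ge0 Ub (M := cnorm q.1 * bump_mass s B eta)) => A.
    by apply: sumE (cnorm_ge0 _) _ => k; case: ifP => // _; rewrite cnorm0 cnorm_ge0.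
  under eq_bigr do rewrite E.
  rewrite -usum_sum //; congr usum; apply/funext => k.
  by rewrite -scaler_suml -mulr_suml.
pose h := peval F \o @grid_point R n K.
have hle k : cnorm (grid_coef h k) <= c1 by apply: grid_coef_le => f; exact: peval_norm.
have sg : abs_summable (fun k => (g k * (sinc_bump eta B k)%:C) *: U k x).
  by apply: (wsum_summable C0_ge0 Ub (M := c1 * bump_mass s B eta)) => A; exact: sumE.
have sh : abs_summable (fun k => (- (grid_coef h k * (sinc_bump eta B k)%:C)) *: U k x).
  by apply: (wsum_summable C0_ge0 Ub (M := c1 * bump_mass s B eta)) => A; under eq_bigr do rewrite cnormN; exact: sumE.
have -> : usum (fun k => (grid_coef h k * (sinc_bump eta B k)%:C) *: U k x) =
    - usum (fun k => (- (grid_coef h k * (sinc_bump eta B k)%:C)) *: U k x).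
  rewrite -scaleN1r -usumZ //; congr usum; apply/funext => k.
  by rewrite scalerA mulN1r opprK.
rewrite TE opprK -usumD //.
have -> : (fun k => (g k * (sinc_bump eta B k)%:C) *: U k x +
    (- (grid_coef h k * (sinc_bump eta B k)%:C)) *: U k x) =
    fun k => ((g k - grid_coef h k) * (sinc_bump eta B k)%:C) *: U k x.
  by apply/funext => k; rewrite -scalerDl mulrBl.
have d2 k : cnorm (g k - grid_coef h k) <= 2 * c1.
  by rewrite (le_trans (ler_cnormB _ _)) // mulrDl mul1r lerD.
have c2 : 0 <= 2 * c1 by rewrite mulr_ge0.
apply: le_trans (usum_split_zbox C0_ge0 Ub x K (fun A => coef_bump_mass A c2 d2)) _.
rewrite ler_wpM2l ?mulr_ge0 ?rnorm_ge0 // big_seq big1 ?add0r // => k kK.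
suff -> : g k = grid_coef h k by rewrite subrr mul0r cnorm0 mul0r.
have NN0 : (N%:R ^+ n : R[i]) != 0 by rewrite expf_neq0 // pnatr_eq0.
have -> : grid_coef h k = (N%:R ^+ n)^-1 * \sum_(q <- F) q.1 *
    \sum_(f : index) cis (dot (q.2 - k) (grid_point R f)).
  rewrite /grid_coef /h /= /peval; congr (_ * _).
  under eq_bigr do rewrite mulr_suml.
  rewrite exchange_big /=; apply: eq_bigr => q _; rewrite mulr_sumr.
  by apply: eq_bigr => f _; rewrite dotDl dotNl cisD mulrA.
rewrite /g mulr_sumr big_seq [RHS]big_seq; apply: eq_bigr => q qF.
rewrite grid_sum; have [->|kq] := eqVneq k q.2.
  case: ifPn => [_|]; first by rewrite mulrCA mulVf ?mulr1.
  by case/forallP => j; rewrite subrr mxE dvdn0.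
case: ifPn => [/forallP H|_]; last by rewrite !mulr0.
case/eqP: kq; apply/rowP => j; have := H j; rewrite !mxE.
have /zboxP/(_ j) := kK; have /zboxP/(_ j) := FK q qF.
set u := q.2 0 j; set v := k 0 j => uK vK /dvdnP[l].
case: l => [|l]; first by rewrite mul0n; lia.
rewrite mulSn => E; have : (K.*2.+1 <= `|(u - v)%R|)%N by rewrite E leq_addr.
by lia.
Qed.

End GridBump.

(** * Stabilization of the kernels of the powers of V *)

Section BeurlingPollard.
Variables (R : realType) (X : completeNormedModType R[i]) (n : nat).
Variables (U : 'rV[int]_n -> X -> X) (s : 'I_n -> R) (C0 : R) (B : nat).
Hypotheses (C0_ge0 : 0 <= C0) (s_ge0 : forall j, 0 <= s j).
Hypothesis sB : forall j, s j + 3 <= B%:R.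
Hypothesis Ub : forall k, bounded_op (U k) (C0 * weight s k).
Hypothesis UD : forall k l x, U (k + l) x = U k (U l x).
Hypothesis U0 : forall x, U 0 x = x.
Local Notation S := (bump_op U B).
Variables (I : choiceType) (c : I -> R[i]) (ix : I -> 'rV[int]_n) (La : R).
Hypothesis cLa : forall A : {fset I}, \sum_(i <- A) cnorm (c i) * weight s (ix i) <= La.
Local Notation V := (Vop U c ix).
Local Notation g := (symbol (R := R) c ix).
Variables (E : set 'rV[R]_n) (Lg : R).
Hypothesis E_spectral : forall z : 'rV[R]_n, (forall j, `|z 0 j| <= 2 * pi - 1 / 2) -> ~ E z ->
  exists2 C : R, 0 <= C & forall x, exists y : 'I_n -> X, (forall j, rnorm (y j) <= C * rnorm x) /\
     x = \sum_j (U (delta_mx 0 j) (y j) - cis (z 0 j) *: y j).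
Hypothesis Lg_ge0 : 0 <= Lg.
Hypothesis g_lip : forall (t u : 'rV[R]_n) (h : R), 0 <= h ->
  (forall j, `|t 0 j - u 0 j| <= h) -> cnorm (g t - g u) <= Lg * h.

Let Vb := Vop_bounded C0_ge0 Ub cLa.

Let small_pow (eta d : R) : 0 < d -> exists i : nat, eta / 2 ^+ i <= d.
Proof.
move=> d0; have ed : 0 < d / (1 + `|eta|) by rewrite divr_gt0 // ltr_wpDr.
have /cvgrPdist_le /(_ _ ed)[l _ Hl] : (2^-1 : R) ^+ k @[k --> \oo] --> (0 : R).
  by apply: cvg_expr; rewrite ger0_norm ?invr_ge0 // invf_lt1 // ltr1n.
exists l; have := Hl l (leqnn _).
rewrite /= sub0r normrN ger0_norm ?exprn_ge0 ?invr_ge0 // exprVn => h.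
apply: le_trans (ler_norm _) _; rewrite normrM (@ger0_norm _ (_ ^-1)) ?invr_ge0 ?exprn_ge0 //.
apply: le_trans (ler_wpM2l (normr_ge0 eta) h) _.
by rewrite mulrA ler_pdivrMr ?ltr_wpDr // mulrC ler_wpM2l ?(ltW d0) // lerDr.
Qed.

(** Near the z found by bisection, nonzero bumps persist at arbitrarily small scales. This
    contradicts [spectral_null] if z is outside [E], and [symbol_null] if g z is nonzero. *)
Lemma kernel_support (l : nat) (x : X) (eta : R) (p : 'rV[R]_n) :
  iter l V x = 0 -> 0 < eta -> B%:R * eta <= 1 -> eta <= 1 -> (forall j, `|p 0 j| <= pi) ->
  S eta p x <> 0 ->
  exists z : 'rV[R]_n, [/\ forall j, `|p 0 j - z 0 j| <= B%:R * eta, E z & g z = 0].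
Proof.
move=> Vx eta0 Beta eta1 ppi Sx.
have [z [pz H]] := bump_op_support C0_ge0 s_ge0 sB Ub eta0 eta1 Sx.
have e0 i : 0 < eta / 2 ^+ i by rewrite divr_gt0 // exprn_gt0.
have e1 i : eta / 2 ^+ i <= 1.
  by rewrite ler_pdivrMr ?exprn_gt0 // mul1r (le_trans eta1) // exprn_ege1 // ler1n.
exists z; split=> //.
  apply: contrapT => nEz; have [|C C1 surj] := E_spectral _ nEz.
    (* |z_j| <= pi + B eta <= pi + 1, which stays below 2 pi - 1/2. *)
    move=> j; rewrite -[z 0 j](subrK (p 0 j)) (le_trans (ler_normD _ _)) //.
    by have := pz j; have := ppi j; rewrite distrC; have := pi_ge2 R; lra.
  have [d [d0 dP]] := spectral_null C0_ge0 s_ge0 sB Ub UD U0 C1 surj.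
  have [i ei] := small_pow eta d0; have [p' [p'z]] := H i.
  by case; exact: dP.
apply/eqP; apply/negP => /negP gz.
have [d [d0 dP]] := symbol_null C0_ge0 s_ge0 sB Ub UD U0 cLa gz.
have [i ei] := small_pow eta d0; have [p' [p'z]] := H i; case.
have Sb := bump_op_bounded C0_ge0 s_ge0 sB Ub p' (e0 i) (e1 i).
have : S (eta / 2 ^+ i) p' (iter l V x) = 0 by rewrite Vx (bop0 Sb).
(* [symbol_null] strips the factors V one at a time. *)
by elim: l {Vx} => [|l IH] //= SV; apply: IH; exact: dP SV.
Qed.

(** Multiplying coefficients by the bump is not compatible with products of polynomials. Powers are
    therefore compared as functionals on arbitrary families [Phi] growing like the weight; smoothing
    is the case of the bump times U_k x. *)
Definition pair_with (F : seq (R[i] * 'rV[int]_n)) (Phi : 'rV[int]_n -> X) : X :=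
  \sum_(q <- F) q.1 *: Phi q.2.

Lemma pair_mul P Q Phi :
  pair_with (pmul P Q) Phi = pair_with P (fun k => pair_with Q (fun l => Phi (k + l))).
Proof.
rewrite /pair_with big_pmul; apply: eq_bigr => p _; rewrite scaler_sumr.
by apply: eq_bigr => q _; rewrite scalerA.
Qed.

Lemma pair_le F Phi (M : R) : (forall k, rnorm (Phi k) <= M * weight s k) ->
  rnorm (pair_with F Phi) <= M * pnorm s F.
Proof.
move=> PM; apply: le_trans (ler_rnorm_sum _ _ _) _; rewrite /pnorm mulr_sumr.
by apply: ler_sum => q _; rewrite rnormZ mulrCA ler_wpM2l ?cnorm_ge0.
Qed.

Let La0 : 0 <= La. Proof. exact: La_ge0 cLa. Qed.

Let trunc_norm (A : {fset I}) : pnorm s (trunc c ix A) <= La.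
Proof. by rewrite /pnorm big_map. Qed.

Let pexp_norm (A : {fset I}) m : pnorm s (pexp (trunc c ix A) m) <= La ^+ m.
Proof.
elim: m => [|m IH]; first by rewrite pnorm_one.
rewrite /pexp iterS (le_trans (pnorm_mul _ _ s_ge0)) // exprS.
by rewrite ler_pM ?pnorm_ge0.
Qed.

(** Telescoping over the factors of the power. [Phi] enters only through M, so for smoothed
    operators the bound is uniform in eta. *)
Lemma pair_exp_diff (A D : {fset I}) (e : R) m Phi (M : R) : 0 <= M -> 0 <= e -> (A `<=` D)%fset ->
  \sum_(i <- (D `\` A)%fset) cnorm (c i) * weight s (ix i) <= e ->
  (forall k, rnorm (Phi k) <= M * weight s k) ->
  rnorm (pair_with (pexp (trunc c ix D) m) Phi - pair_with (pexp (trunc c ix A) m) Phi)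
    <= M * (m%:R * La ^+ m.-1 * e).
Proof.
move=> M0 e0 AD De; elim: m Phi M M0 => [|m IH] Phi M M0 PM.
  by rewrite subrr rnorm0 !mul0r mulr0.
rewrite /pexp !iterS -!/(pexp _ m) !pair_mul.
set P := trunc c ix A; set Q := trunc c ix D.
have shift k l : rnorm (Phi (k + l)) <= M * weight s k * weight s l.
  by apply: le_trans (PM _) _; rewrite -mulrA ler_wpM2l // weightD.
have w0 k : 0 <= M * weight s k by rewrite mulr_ge0 ?weight_ge0.
pose f F k := pair_with (pexp F m) (fun l => Phi (k + l)).
have -> : pair_with Q (f Q) - pair_with P (f P) =
    pair_with P (fun k => f Q k - f P k) + pair_with (trunc c ix (D `\` A)%fset) (f Q).
  have -> : pair_with Q (f Q) = pair_with P (f Q) + pair_with (trunc c ix (D `\` A)%fset) (f Q).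
    by rewrite /pair_with !big_map (big_fsetD _ AD).
  rewrite addrAC; congr (_ + _); rewrite /pair_with -sumrB.
  by apply: eq_bigr => q _; rewrite scalerBr.
apply: le_trans (ler_rnormD _ _) _.
apply: (@le_trans _ _ (M * (m%:R * La ^+ m.-1 * e) * La + M * La ^+ m * e)).
  apply: lerD.
    apply: le_trans (pair_le (M := M * (m%:R * La ^+ m.-1 * e)) _ _) _.
      move=> k; rewrite mulrAC; exact: IH.
    by apply: ler_wpM2l; [rewrite !mulr_ge0 ?exprn_ge0|exact: trunc_norm].
  apply: le_trans (pair_le (M := M * La ^+ m) _ _) _.
    move=> k; rewrite mulrAC; apply: le_trans (pair_le _ (shift k)) _.
    by apply: ler_wpM2l; [exact: w0|exact: pexp_norm].
  by rewrite ler_wpM2l ?mulr_ge0 ?exprn_ge0 // /pnorm big_map.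
rewrite le_eqVlt; apply/orP; left; apply/eqP; case: m {IH f} => [|m] /=.
  by rewrite !mul0r !mulr0 expr0; ring.
by rewrite -[m.+2%:R]natr1 exprS; ring.
Qed.

Lemma Vop_exp_diff (A : {fset I}) (e : R) m x : 0 <= e ->
  (forall x, rnorm (V x - pop U (trunc c ix A) x) <= C0 * e * rnorm x) ->
  rnorm (iter m V x - iter m (pop U (trunc c ix A)) x) <= m%:R * (C0 * La) ^+ m.-1 * (C0 * e) * rnorm x.
Proof.
move=> e0 VA; elim: m => [|m IH]; first by rewrite subrr rnorm0 !mul0r.
rewrite !iterS; set P := pop U _; set y := iter m V x; set z := iter m P x.
have CL : 0 <= C0 * La by rewrite mulr_ge0.
have Pb : bounded_op P (C0 * La).
  by apply: (bop_le (pop_bounded Ub _)); rewrite ler_wpM2l.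
have zb : rnorm z <= (C0 * La) ^+ m * rnorm x := (bounded_op_iter m CL Pb).2 x.
rewrite -(subrKA (V z)); apply: le_trans (ler_rnormD _ _) _.
rewrite -(bopB Vb).
apply: le_trans (lerD (le_trans (Vb.2 _) (ler_wpM2l CL IH)) (le_trans (VA z) (ler_wpM2l _ zb))) _.
  by rewrite mulr_ge0.
rewrite le_eqVlt; apply/orP; left; apply/eqP; case: m {IH y z zb} => [|m] /=.
  by rewrite !mul0r !mulr0 expr0; ring.
by rewrite -[m.+2%:R]natr1 exprS; ring.
Qed.

Lemma pop_exp P m x : pop U (pexp P m) x = iter m (pop U P) x.
Proof.
elim: m => [|m IH]; first exact: pop_one.
by rewrite /pexp iterS (pop_mul Ub UD) IH.
Qed.

Definition smoothed (eta : R) (F : seq (R[i] * 'rV[int]_n)) (x : X) : X :=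
  \sum_(q <- F) (q.1 * (sinc_bump eta B q.2)%:C) *: U q.2 x.

Lemma smoothedE (eta : R) F x : smoothed eta F x = pair_with F (fun k => (sinc_bump eta B k)%:C *: U k x).
Proof. by apply: eq_bigr => q _; rewrite scalerA. Qed.

Lemma sinc_bump_sub1 (eta : R) (k : 'rV[int]_n) : 0 <= eta ->
  `|sinc_bump eta B k - 1| <= (B%:R * \sum_j `|(k 0 j)%:~R|) * eta.
Proof.
move=> eta0.
have prod1 (J : Type) (r : seq J) (f : J -> R) : (forall j, `|f j| <= 1) ->
    `|\prod_(j <- r) f j| <= 1 /\ `|\prod_(j <- r) f j - 1| <= \sum_(j <- r) `|f j - 1|.
  move=> f1; elim: r => [|j r [IH1 IH2]].
    by rewrite !big_nil subrr normr0 normr1.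
  rewrite !big_cons; split; first by rewrite normrM -[leRHS]mulr1 ler_pM.
  have -> : f j * \prod_(j <- r) f j - 1 = f j * (\prod_(j <- r) f j - 1) + (f j - 1) by ring.
  rewrite addrC (le_trans (ler_normD _ _)) // lerD2l normrM.
  by rewrite (le_trans _ IH2) // ler_piMl.
have sB1 (j : 'I_n) := prod1 'I_B (index_enum _) (fun _ => sinc ((k 0 j)%:~R * eta)) (fun _ => sinc_norm_le1 _).
have powE (j : 'I_n) : \prod_(i < B) sinc ((k 0 j)%:~R * eta) = sinc ((k 0 j)%:~R * eta) ^+ B.
  by rewrite prodr_const card_ord.
have [|_ h] := prod1 'I_n (index_enum _) (fun j => sinc ((k 0 j)%:~R * eta) ^+ B).
  by move=> j; have [] := sB1 j; rewrite powE.
apply: le_trans h _; rewrite mulr_sumr mulr_suml; apply: ler_sum => j _.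
have [_] := sB1 j; rewrite powE => /le_trans; apply.
rewrite sumr_const card_ord -[leLHS]mulr_natl -[leRHS]mulrA ler_wpM2l //.
by rewrite (le_trans (sinc_sub1_le _)) // normrM (ger0_norm eta0).
Qed.

(** The constant depends on [F], so a truncation has to be fixed before eta. *)
Lemma smoothed_lim F x : exists2 C : R, 0 <= C & forall eta : R, 0 <= eta ->
  rnorm (pop U F x - smoothed eta F x) <= C * eta.
Proof.
exists (\sum_(q <- F) cnorm q.1 * (B%:R * \sum_j `|(q.2 0 j)%:~R|) * rnorm (U q.2 x)).
  by apply: sumr_ge0 => q _; rewrite !mulr_ge0 ?cnorm_ge0 ?rnorm_ge0 ?sumr_ge0.
move=> eta eta0; rewrite /pop /smoothed -sumrB mulr_suml.
apply: le_trans (ler_rnorm_sum _ _ _) _; apply: ler_sum => q _.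
have -> : q.1 *: U q.2 x - (q.1 * (sinc_bump eta B q.2)%:C) *: U q.2 x =
    (q.1 * (1 - sinc_bump eta B q.2)%:C) *: U q.2 x.
  by rewrite -scalerBl rmorphB /= rmorph1 mulrBr mulr1.
rewrite rnormZ cnormM cnormR distrC [leRHS]mulrAC ler_wpM2r ?rnorm_ge0 // -[leRHS]mulrA.
by rewrite ler_wpM2l ?cnorm_ge0 // sinc_bump_sub1.
Qed.

Variables (mm : nat) (c' N1 d1 : R).
Hypotheses (N1_ge0 : 0 <= N1) (d1_gt0 : 0 < d1).
Hypothesis E_cover : forall delta : R, 0 < delta -> delta <= d1 ->
  exists m (y : 'I_m -> 'rV[R]_n),
    (forall z : 'rV[R]_n, E z -> exists i, forall j, `|z 0 j - y i 0 j| <= delta) /\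
    m%:R <= N1 * delta^-1 `^ c'.

Let alpha := \sum_j s j.

Let grid_point_le_pi (K : nat) (f : {ffun 'I_n -> 'I_(K.*2.+1)}) j : `|grid_point R f 0 j| <= pi.
Proof.
rewrite !mxE normrM; have N0 : 0 < K.*2.+1%:R :> R by rewrite ltr0n.
have p0 : 0 < (pi : R) := pi_gt0 R.
rewrite ger0_norm; last by rewrite divr_ge0 ?mulr_ge0 ?(ltW p0).
have k0 : `|(centered (f j))%:~R| <= K%:R :> R.
  by rewrite -intr_norm -[K%:R]/(K%:Z%:~R) ler_int; have := centered_le (f j); lia.
apply: le_trans (ler_wpM2l _ k0) _; first by rewrite divr_ge0 ?mulr_ge0 ?(ltW p0).
rewrite mulrAC ler_pdivrMr // [2 * pi]mulrC -mulrA ler_pM2l //.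
by rewrite -natrM ler_nat mul2n.
Qed.

(** (B + 2) eta collects B eta from the grid point to z, eta from z to a centre of the cover, and
    the 1/N of [count_cube], which is at most eta. *)
Let card_support (K : nat) (eta : R) (W : pred {ffun 'I_n -> 'I_(K.*2.+1)}) :
  0 < eta -> eta <= d1 -> K.*2.+1%:R^-1 <= eta ->
  (forall f, W f -> exists2 z : 'rV[R]_n, E z & forall j, `|grid_point R f 0 j - z 0 j| <= B%:R * eta) ->
  (K.*2.+1%:R ^+ n)^-1 * #|W|%:R <= N1 * eta^-1 `^ c' * ((B%:R + 2) * eta) ^+ n.
Proof.
move=> eta0 etad KN WE; have [m [y [Ey mN]]] := E_cover eta0 etad.
pose h := (B%:R + 1) * eta; have h0 : 0 <= h by rewrite mulr_ge0 ?addr_ge0 // ltW.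
pose Q i := [pred f : {ffun 'I_n -> 'I_(K.*2.+1)} | [forall j, `|grid_point R f 0 j - y i 0 j| <= h]].
have cardE (T : finType) (P : pred T) : #|P| = (\sum_(t : T) P t)%N.
  by rewrite -sum1_card big_mkcond /=; apply: eq_bigr => t _; rewrite unfold_in; case: (P t).
have WQ : (#|W| <= \sum_(i < m) #|Q i|)%N.
  under [leqRHS]eq_bigr do rewrite cardE.
  rewrite cardE exchange_big /=; apply: leq_sum => f _.
  case Wf : (W f) => //; have [z Ez fz] := WE f Wf; have [i zi] := Ey z Ez.
  rewrite (bigD1 i) //=; suff -> : [forall j, `|grid_point R f 0 j - y i 0 j| <= h] by [].
  apply/forallP => j; rewrite -(subrKA (z 0 j)) (le_trans (ler_normD _ _)) //.
  by rewrite /h mulrDl mul1r lerD.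
have N0 : 0 < K.*2.+1%:R ^+ n :> R by rewrite exprn_gt0 // ltr0n.
have Q1 i : (K.*2.+1%:R ^+ n)^-1 * #|Q i|%:R <= ((B%:R + 2) * eta) ^+ n.
  apply: le_trans (count_cube K (y i) h0) _.
  rewrite lerXn2r ?nnegrE ?addr_ge0 ?mulr_ge0 ?addr_ge0 ?invr_ge0 ?(ltW eta0) //.
  by rewrite /h -[2]/(1 + 1) addrA [leRHS]mulrDl mul1r lerD2l.
apply: (@le_trans _ _ (m%:R * ((B%:R + 2) * eta) ^+ n)).
  apply: (@le_trans _ _ (\sum_(i < m) (K.*2.+1%:R ^+ n)^-1 * #|Q i|%:R)).
    by rewrite -mulr_sumr ler_wpM2l ?invr_ge0 ?(ltW N0) // -natr_sum ler_nat.
  apply: (le_trans (ler_sum _ (fun i _ => Q1 i))).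
  by rewrite sumr_const card_ord mulr_natl.
by rewrite ler_wpM2r // exprn_ge0 // mulr_ge0 ?addr_ge0 // ltW.
Qed.

Let big_zbox (F : seq (R[i] * 'rV[int]_n)) : exists K0, forall K, (K0 <= K)%N ->
  forall q, q \in F -> q.2 \in zbox n K.
Proof.
elim: F => [|q F [K1 IH]]; first by exists 0%N.
have [K2 H2] := sub_zbox [fset q.2]%fset.
exists (maxn K1 K2) => K; rewrite geq_max => /andP[h1 h2] p.
rewrite inE => /predU1P[->|]; last exact: IH.
have /zboxP H := fsubsetP H2 q.2 (fset11 _).
by apply/zboxP => j; apply: leq_trans h2.
Qed.

(** Only grid points with S_p x nonzero contribute to the average; [kernel_support] makes the
    polynomial small there and [card_support] makes them few. The constant does not depend on l, x,
    eta or the truncation: whatever does is attached to 1/(1 + K) and disappears as the grid is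
    refined. *)
Lemma smoothed_le : exists2 Cst : R, 0 <= Cst & forall (l : nat) (x : X) (eta : R) (A : {fset I}),
  iter l V x = 0 -> 0 < eta -> eta <= 1 -> B%:R * eta <= 1 -> eta <= d1 ->
  (forall t, cnorm (g t - peval (trunc c ix A) t) <= eta) ->
  rnorm (smoothed eta (pexp (trunc c ix A) mm) x) <=
    C0 * rnorm x * (Cst * eta^-1 `^ (c' / 2 + alpha - mm%:R)).
Proof.
(* Within B eta of a zero of g one has |g| <= Lg B eta, and the truncation adds at most eta. *)
pose L := Lg * B%:R + 1; have L0 : 0 <= L by rewrite addr_ge0 ?mulr_ge0.
pose cst1 := N1 * (B%:R + 2) ^+ n * (L ^+ mm) ^+ 2.
pose cst2 : R := (3 * 2 ^+ (B * 2)) ^+ n.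
have cst1_ge0 : 0 <= cst1.
  by do ?[exact: L0|apply: mulr_ge0|apply: exprn_ge0|apply: addr_ge0].
have cst2_ge0 : 0 <= cst2 by rewrite exprn_ge0 ?mulr_ge0 ?exprn_ge0.
exists ((cst1 + cst2) / 2); first by rewrite divr_ge0 ?addr_ge0.
move=> l x eta A Vx eta0 eta1 Beta etad gA.
set F := pexp _ mm; pose rho := (L * eta) ^+ mm.
have rho0 : 0 <= rho by rewrite exprn_ge0 ?mulr_ge0 // ltW.
pose t := eta^-1; have t0 : 0 < t by rewrite invr_gt0.
pose q (a : R) := t `^ a.
have qD a b : q (a + b) = q a * q b by rewrite /q powRD // (gt_eqF t0) implybT.
have q0 a : 0 < q a by rewrite powR_gt0.
have qN a : (q a)^-1 = q (- a) by rewrite /q powRN.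
have qn k : q (- k%:R) = eta ^+ k.
  by rewrite -qN /q powR_mulrn ?(ltW t0) // -exprVn /t invrK.
(* the weight of the AM-GM form of Cauchy-Schwarz in [grid_bump_le] that balances
   its two terms *)
pose theta := q (n%:R + alpha + mm%:R - c' / 2).
have total : (theta * (N1 * q c' * ((B%:R + 2) * eta) ^+ n * rho ^+ 2) +
    theta^-1 * bump_mass2 s B eta) / 2 = (cst1 + cst2) / 2 * q (c' / 2 + alpha - mm%:R).
  rewrite [RHS]mulrAC; congr (_ / 2); rewrite [RHS]mulrDl; congr (_ + _).
    rewrite /cst1 /rho !exprMn -!qn /theta.
    transitivity (N1 * (B%:R + 2) ^+ n * (L ^+ mm) ^+ 2 * (q (n%:R + alpha + mm%:R - c' / 2) * q c' * q (- n%:R) * (q (- mm%:R) * q (- mm%:R)))); first by ring.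
    by rewrite -!qD; congr (_ * q _); field.
  rewrite /bump_mass2 -/cst2 -/t big_split /= -/alpha /theta qN.
  have -> : t ^+ n = q n%:R by rewrite /q powR_mulrn // ltW.
  rewrite -/(q (alpha + alpha)) -qD mulrCA -qD; congr (_ * q _); by field.
set mass := bump_mass s B eta; have mass0 : 0 <= mass by apply: bump_mass_ge0.
set c1 := \sum_(p <- F) cnorm p.1.
have c1_ge0 : 0 <= c1 by apply: sumr_ge0 => p _; exact: cnorm_ge0.
have Fle K (f : {ffun 'I_n -> 'I_(K.*2.+1)}) : S eta (grid_point R f) x != 0 ->
    exists2 z : 'rV[R]_n, E z & (forall j, `|grid_point R f 0 j - z 0 j| <= B%:R * eta) /\
      cnorm (peval F (grid_point R f)) <= rho.
  move=> /eqP Sx.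
  have [z [pz Ez gz]] := kernel_support Vx eta0 Beta eta1 (grid_point_le_pi f) Sx.
  exists z => //; split=> //; rewrite peval_exp cnormX; have Le0 : 0 <= L * eta by rewrite mulr_ge0 // ltW.
  suff Le : cnorm (peval (trunc c ix A) (grid_point R f)) <= L * eta.
    by rewrite lerXn2r // nnegrE cnorm_ge0.
  set p := grid_point R f.
  have -> : peval (trunc c ix A) p = (g p - g z) - (g p - peval (trunc c ix A) p).
    by rewrite gz subr0 opprB addrC subrK.
  apply: le_trans (ler_cnormB _ _) _; rewrite /L mulrDl mul1r -mulrA; apply: lerD => //.
  by apply: g_lip => //; rewrite mulr_ge0 // ltW.
apply/ler_addgt0Pr => e e0.
have [K0 HK0] := big_zbox F.
pose err := C0 * rnorm x * (2 * c1 * mass + rho * mass).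
have err0 : 0 <= err.
  by do ?[exact: mass0|exact: c1_ge0|exact: rho0|exact: rnorm_ge0|apply: mulr_ge0|apply: addr_ge0].
(* Three demands on the grid: its box holds the frequencies of [F], the error [err] over 1 + K is at
   most e, and 1/N is at most eta. *)
pose K := (maxn K0 (maxn (Num.bound (err / e)) (Num.bound t))).
have K0K : (K0 <= K)%N by rewrite leq_maxl.
have eK : err / (1 + K%:R) <= e.
  rewrite ler_pdivrMr ?ltr_wpDr // mulrC -ler_pdivrMr //.
  apply: le_trans (ltW (archi_boundP _)) _; first by rewrite divr_ge0 // ltW.
  apply: (@le_trans _ _ K%:R); last by rewrite lerDr.
  by rewrite ler_nat /K !leq_max leqnn !orbT.
have tK : K.*2.+1%:R^-1 <= eta.
  rewrite -[eta]invrK lef_pV2 ?posrE ?ltr0n //.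
  apply: le_trans (ltW (archi_boundP (ltW t0))) _; rewrite ler_nat.
  apply: (@leq_trans K); first by rewrite /K !leq_max leqnn !orbT.
  by rewrite -addnn -addnS leq_addr.
have FK := HK0 K K0K.
have := grid_average C0_ge0 s_ge0 sB Ub eta0 eta1 x FK.
rewrite -/c1 -/mass -/(smoothed eta F x).
pose W : pred {ffun 'I_n -> 'I_(K.*2.+1)} := fun f => S eta (grid_point R f) x != 0.
have -> : \sum_(f : {ffun 'I_n -> 'I_(K.*2.+1)}) peval F (grid_point R f) *: S eta (grid_point R f) x =
    \sum_(f | W f) peval F (grid_point R f) *: S eta (grid_point R f) x.
  rewrite [RHS]big_mkcond; apply: eq_bigr => f _; rewrite /W.
  by case: eqP => //= ->; rewrite scaler0.
have := @grid_bump_le R X n U s C0 B C0_ge0 s_ge0 sB Ub eta eta0 eta1 K W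
  (fun f => peval F (grid_point R f)) rho theta x rho0 (q0 _).
have hW f : W f -> cnorm (peval F (grid_point R f)) <= rho by move=> /Fle[z _ []].
move=> /(_ hW); set Y := _^-1 *: _ => hY hD.
have cW : (K.*2.+1%:R ^+ n)^-1 * #|W|%:R <= N1 * q c' * ((B%:R + 2) * eta) ^+ n.
  by apply: card_support => // f /Fle[z Ez [fz _]]; exists z.
rewrite -(subrK Y (smoothed _ _ _)); apply: le_trans (ler_rnormD _ _) _.
apply: le_trans (lerD hD hY) _.
apply: (@le_trans _ _ (C0 * rnorm x * ((cst1 + cst2) / 2 * q (c' / 2 + alpha - mm%:R)) + err / (1 + K%:R))); last first.
  by rewrite lerD2l.
rewrite -total /err -/mass.
have x0 : 0 <= C0 * rnorm x by rewrite mulr_ge0 ?rnorm_ge0.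
apply: (@le_trans _ _ (C0 * rnorm x * (2 * c1 * mass / (1 + K%:R)) + C0 * rnorm x *
  ((theta * (N1 * q c' * ((B%:R + 2) * eta) ^+ n * rho ^+ 2) + theta^-1 * bump_mass2 s B eta) / 2 +
    rho * mass / (1 + K%:R)))).
  have th0 : 0 < theta := q0 _.
  rewrite lerD2l ler_wpM2l // lerD2r ler_pM2r ?invr_gt0 // lerD2r ler_pM2l //.
  by apply: ler_wpM2r; [exact: exprn_ge0|exact: cW].
by rewrite le_eqVlt; apply/orP; left; apply/eqP; ring.
Qed.

(** The order of choices matters. A truncation [A0] is fixed first; eta is then chosen from
    [smoothed_lim] for [A0]; but [smoothed_le] needs a truncation accurate to eta, so [A0] is
    enlarged to [A]. The passage from [A0] to [A] after smoothing is harmless because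
    [pair_exp_diff] is uniform in eta. *)
Lemma kernel_stable (l : nat) (x : X) : c' / 2 + alpha < mm%:R -> iter l V x = 0 -> iter mm V x = 0.
Proof.
move=> kap Vx; apply: rnorm_le0_eq0 => e e0.
have [Cst Cst0 HC] := smoothed_le.
pose k := mm%:R - (c' / 2 + alpha); have k0 : 0 < k by rewrite subr_gt0.
(* The joint coefficient of e1 in the two truncation errors, before and after smoothing. *)
pose b1 := mm%:R * (C0 * La) ^+ mm.-1 * C0 * rnorm x + C0 * rnorm x * (mm%:R * La ^+ mm.-1).
have b10 : 0 <= b1.
  by do ?[exact: La0|exact: C0_ge0|exact: rnorm_ge0|apply: mulr_ge0|apply: addr_ge0|apply: exprn_ge0].
pose e1 := e / 3 / (1 + b1); have e10 : 0 < e1 by rewrite !divr_gt0 // ltr_wpDr.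
have [A0 HA0] := trunc_tail C0_ge0 s_ge0 Ub cLa e10.
pose F0 := pexp (trunc c ix A0) mm.
have [C2 C20 HC2] := smoothed_lim F0 x.
pose e3 := e / 3; have e30 : 0 < e3 by rewrite divr_gt0.
pose M := C0 * rnorm x * Cst.
have M0 : 0 <= M by rewrite !mulr_ge0 ?rnorm_ge0.
have [eta [eta0 [eta1 Beta etad] [C2e Me]]] : exists eta : R, [/\ 0 < eta,
    [/\ eta <= 1, B%:R * eta <= 1 & eta <= d1] & C2 * eta <= e3 /\ M * eta^-1 `^ (- k) <= e3].
  (* Solves u^k = e3/(1 + M), where k > 0 is the gap between [mm] and c'/2 + alpha. *)
  pose u := (e3 / (1 + M)) `^ k^-1; have u0 : 0 < u by rewrite powR_gt0 // divr_gt0 // ltr_wpDr.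
  pose eta := Num.min (Num.min (1 + B%:R)^-1 d1) (Num.min (e3 / (1 + C2)) u).
  have B1 : 0 < 1 + B%:R :> R by rewrite ltr_wpDr.
  have C21 : 0 < 1 + C2 by rewrite ltr_wpDr.
  have M1 : 0 < 1 + M by rewrite ltr_wpDr.
  have eta0 : 0 < eta by rewrite !lt_min invr_gt0 B1 d1_gt0 divr_gt0.
  have [h1 h2 h3 h4] : [/\ eta <= (1 + B%:R)^-1, eta <= d1, eta <= e3 / (1 + C2) & eta <= u].
    by rewrite /eta !ge_min !lexx !orbT.
  exists eta; split=> //.
    split=> //; first by rewrite (le_trans h1) // invf_le1 // lerDl.
    apply: le_trans (ler_wpM2l (ler0n _ _) h1) _.
    by rewrite ler_pdivrMr // mul1r lerDr.
  split.
    apply: le_trans (ler_wpM2l C20 h3) _; rewrite mulrA ler_pdivrMr // mulrC.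
    by rewrite ler_wpM2l ?(ltW e30) // lerDr.
  have -> : eta^-1 `^ (- k) = eta `^ k.
    by rewrite -powR_inv1 ?(ltW eta0) // -powRrM mulrNN mul1r.
  have : eta `^ k <= e3 / (1 + M).
    apply: (@le_trans _ _ (u `^ k)); first by apply: ge0_ler_powR; rewrite ?nnegrE ?(ltW k0) ?(ltW eta0) ?(ltW u0).
    by rewrite /u -powRrM mulVf ?gt_eqF // powRr1 // divr_ge0 ?(ltW e30) ?(ltW M1).
  move=> h; apply: le_trans (ler_wpM2l M0 h) _; rewrite mulrA ler_pdivrMr // mulrC.
  by rewrite ler_wpM2l ?(ltW e30) // lerDr.
have [A1 HA1] := trunc_tail C0_ge0 s_ge0 Ub cLa eta0.
pose A := (A0 `|` A1)%fset; have A0A : (A0 `<=` A)%fset by exact: fsubsetUl.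
have [_ symA _] := HA1 A (fsubsetUr A0 A1).
have [_ _ tailA] := HA0 A A0A.
have [VA0 _ _] := HA0 A0 (fsubset_refl _).
pose F := pexp (trunc c ix A) mm.
have h1 := Vop_exp_diff mm x (ltW e10) VA0; rewrite -pop_exp -/F0 in h1.
have h2 := HC2 eta (ltW eta0).
have h3 : rnorm (smoothed eta F x - smoothed eta F0 x) <= C0 * rnorm x * (mm%:R * La ^+ mm.-1 * e1).
  rewrite !smoothedE; apply: pair_exp_diff => //; first by rewrite mulr_ge0 ?rnorm_ge0.
    exact: ltW.
  move=> m; rewrite rnormZ cnormR; apply: (@le_trans _ _ (1 * rnorm (U m x))).
    rewrite ler_wpM2r ?rnorm_ge0 // normr_prod; apply: prodr_ile1 => j _.
    by rewrite normr_ge0 normrX exprn_ile1 // sinc_norm_le1.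
  by rewrite mul1r mulrAC; exact: (Ub m).2.
have h4 := HC l x eta A Vx eta0 eta1 Beta etad symA; rewrite -/F in h4.
have {}h4 : rnorm (smoothed eta F x) <= e3.
  apply: le_trans h4 _; apply: le_trans Me; rewrite /M -!mulrA.
  by rewrite (_ : - k = c' / 2 + alpha - mm%:R) // /k opprB.
have {}h2 := le_trans h2 C2e.
rewrite rdistC in h3.
have -> : iter mm V x = (iter mm V x - pop U F0 x) + ((pop U F0 x - smoothed eta F0 x) +
   ((smoothed eta F0 x - smoothed eta F x) + smoothed eta F x)).
  by rewrite !(addrA, subrK).
apply: le_trans (ler_rnormD _ _) _.
apply: le_trans (lerD h1 (le_trans (ler_rnormD _ _) (lerD h2 (le_trans (ler_rnormD _ _) (lerD h3 h4))))) _.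
have : b1 * e1 <= e / 3.
  rewrite /e1 mulrA ler_pdivrMr ?ltr_wpDr // mulrC ler_wpM2l ?(ltW e30) //.
  by rewrite lerDr.
rewrite /b1 mulrDl /e3 => h; apply: (@le_trans _ _ (e / 3 + e / 3 + e / 3)); last by lra.
by move: h; rewrite !mulrA; lra.
Qed.

End BeurlingPollard.

(** * Balanced coverings *)

Section Dimension.
Variables (R : realType) (n : nat).
Implicit Types (x y : 'rV[R]_n) (S : set 'rV[R]_n).

Lemma enorm_le_sum x : enorm x <= \sum_j `|x 0 j|.
Proof.
have h (r : seq 'I_n) : 0 <= \sum_(j <- r) `|x 0 j| /\
    \sum_(j <- r) x 0 j ^+ 2 <= (\sum_(j <- r) `|x 0 j|) ^+ 2.
  elim: r => [|j r [IH0 IH]]; first by rewrite !big_nil expr0n.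
  rewrite !big_cons addr_ge0 //; split=> //.
  rewrite sqrrD real_normK ?num_real // -addrA lerD2l (le_trans IH) // lerDr.
  by rewrite mulrn_wge0 // mulr_ge0.
have [s0 s2] := h (index_enum 'I_n).
by rewrite -[leRHS](ger0_norm s0) -sqrtr_sqr ler_sqrt ?sqr_ge0.
Qed.

Lemma coord_le_enorm x j : `|x 0 j| <= enorm x.
Proof.
rewrite -sqrtr_sqr ler_sqrt; last by apply: sumr_ge0 => i _; exact: sqr_ge0.
by rewrite (bigD1 j) //= lerDl sumr_ge0 // => i _; exact: sqr_ge0.
Qed.

Lemma diam_gt0 S : 0 < diam S -> S !=set0 /\
  forall x y, S x -> S y -> enorm (x - y) <= diam S.
Proof.
rewrite /diam; set D := [set _ | _ in _ & _ in _] => D0.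
have hs : has_sup D by apply: contrapT => /sup_out h; rewrite h ltxx in D0.
split=> [|x y Sx Sy]; first by have [[_ [x Sx _]] _] := hs; exists x.
by apply: sup_upper_bound => //; exists x => //; exists y.
Qed.

(** Here the balance of the coverings enters: the lower bound delta/P on the diameters turns the
    bound on their c-th powers into a bound on the number of pieces, while the upper bound makes a
    point of each piece a centre. *)
Lemma balanced_coverings_centers S (c : R) : balanced_coverings S c -> 0 < c ->
  exists N1 d1 : R, [/\ 0 <= N1, 0 < d1 & forall delta, 0 < delta -> delta <= d1 ->
    exists m (y : 'I_m -> 'rV[R]_n),
      (forall z, S z -> exists i, forall j, `|z 0 j - y i 0 j| <= delta) /\
      m%:R <= N1 * delta^-1 `^ c].
Proof.
move=> [N [P [N0 P0]]] [d /= d0 H] c0.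
exists (N * P `^ c), (d / 2); split; first by rewrite mulr_ge0 ?powR_ge0 // ltW.
  by rewrite divr_gt0.
move=> delta delta0 dd; have [|//|m [beta [Sb _ bd bN]]] := H delta.
  by rewrite /= sub0r normrN gtr0_norm //; lra.
have b0 j : 0 < diam (beta j).
  by have /andP[h _] := bd j; apply: lt_trans h; rewrite divr_gt0.
have [y yb] := choice (fun j => (diam_gt0 (b0 j)).1).
exists m, y; split=> [z /Sb[i _ bz]|].
  exists i => j; have := coord_le_enorm (z - y i) j; rewrite !mxE => /le_trans; apply.
  have /andP[_ /ltW h] := bd i; apply: le_trans h.
  exact: (diam_gt0 (b0 i)).2.
have q0 : 0 < (delta / P) `^ c by rewrite powR_gt0 // divr_gt0.
have : m%:R * (delta / P) `^ c <= N.
  apply: le_trans bN; rewrite mulr_natl -[m in leLHS]card_ord -sumr_const.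
  apply: ler_sum => i _; have /andP[/ltW h _] := bd i.
  by rewrite ge0_ler_powR ?nnegrE ?(ltW c0) ?(ltW (b0 i)) // ltW // divr_gt0.
rewrite -ler_pdivlMr // => /le_trans; apply; rewrite -mulrA ler_wpM2l ?(ltW N0) //.
have powRV (u : R) : 0 < u -> u^-1 `^ c = (u `^ c)^-1.
  by move=> u0; rewrite -(powR_inv1 (ltW u0)) -powRrM mulN1r powRN.
rewrite powRM ?(ltW delta0) ?invr_ge0 ?(ltW P0) // invfM !powRV //.
by rewrite invrK mulrC.
Qed.

(** Shows that a bounded set has an admissible exponent, so that the dimension is a genuine infimum.
    The pieces are half-open cubes, which are pairwise disjoint. *)
Lemma bounded_balanced_coverings S (a : R) : (0 < n)%N -> 0 <= a ->
  (forall z j, S z -> `|z 0 j| <= a) -> balanced_coverings S n%:R.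
Proof.
move=> n0 a0 Sa; have nR : 0 < n%:R :> R by rewrite ltr0n.
exists ((4 * a * n%:R + 1) ^+ n), (8 * n%:R); split.
- by rewrite exprn_gt0 // ltr_wpDl // !mulr_ge0.
- by rewrite mulr_gt0.
exists 1 => //= delta; rewrite /ball_ /= sub0r normrN => delta1 delta0.
rewrite gtr0_norm // in delta1.
(* Cubes of side delta/(2n) have diameter at most delta/2 and at least h/2 = delta/(4n), above
   delta/(8n). There are L^n of them with L delta <= 4 a n + 1, which explains the constants chosen
   above. *)
pose h := delta / (2 * n%:R); have h0 : 0 < h by rewrite divr_gt0 ?mulr_gt0.
have nh : n%:R * h = delta / 2 by rewrite /h; field; rewrite gt_eqF.
pose L := (Num.truncn (2 * a / h)).+1.
pose cell (f : {ffun 'I_n -> 'I_L}) : set 'rV[R]_n :=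
  [set z | forall j, (f j)%:R * h <= z 0 j + a < (f j).+1%:R * h].
have cell_dist f x y j : cell f x -> cell f y -> `|x 0 j - y 0 j| <= h.
  move=> /(_ j) + /(_ j); rewrite -natr1 !mulrDl !mul1r ler_norml.
  move=> /andP[x1 x2] /andP[y1 y2]; apply/andP; split; lra.
have cell_enorm f x y : cell f x -> cell f y -> enorm (x - y) <= delta / 2.
  move=> fx fy; apply: le_trans (enorm_le_sum _) _; rewrite -nh.
  rewrite mulr_natl -[n in leRHS]card_ord -sumr_const; apply: ler_sum => j _.
  by rewrite !mxE; exact: cell_dist fx fy.
pose p f : 'rV[R]_n := \row_j ((f j : 'I_L)%:R * h - a).
have fp f : cell f (p f).
  by move=> j; rewrite mxE subrK lexx /= ltr_pM2r // ltr_nat.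
pose p' f : 'rV[R]_n := \row_j ((f j : 'I_L)%:R * h - a + h / 2).
have fp' f : cell f (p' f).
  move=> j; rewrite mxE addrAC subrK -[(f j).+1%:R]natr1 mulrDl mul1r lerDl ltrD2l.
  by apply/andP; split; [rewrite divr_ge0 // ltW|lra].
have pp' f : h / 2 <= enorm (p f - p' f).
  have := coord_le_enorm (p f - p' f) (Ordinal n0).
  by rewrite !mxE opprD addrA subrr sub0r normrN gtr0_norm // divr_gt0.
have diam_cell f : h / 2 <= diam (cell f) <= delta / 2.
  pose D := [set enorm (x - y) | x in cell f & y in cell f].
  have ubD : ubound D (delta / 2) by move=> _ [x fx [y fy <-]]; exact: cell_enorm fx fy.
  have Dpp : D (enorm (p f - p' f)) by exists (p f) => //; exists (p' f).
  apply/andP; split.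
    apply: le_trans (pp' f) _; apply: sup_upper_bound => //.
    by split; [exists (enorm (p f - p' f))|exists (delta / 2)].
  by apply: ge_sup => //; exists (enorm (p f - p' f)).
exists #|{ffun 'I_n -> 'I_L}|, (fun i => cell (enum_val i)); split.
- move=> z Sz; have za j : 0 <= z 0 j + a <= 2 * a.
    by have := Sa z j Sz; rewrite ler_norml => /andP[]; lra.
  have zL (j : 'I_n) : (Num.truncn ((z 0%R j + a) / h)%R < L)%N.
    have /andP[z1 z2] := za j; rewrite ltnS le_truncn // ler_pM2r ?invr_gt0 //.
  exists (enum_rank [ffun j => Ordinal (zL j)]) => //; rewrite enum_rankK => j.
  rewrite ffunE /=; have /andP[z1 z2] := za j.
  have /truncn_itv : 0 <= (z 0 j + a) / h by rewrite divr_ge0 // ltW.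
  by rewrite ler_pdivlMr // ltr_pdivrMr.
- move=> i k _ _ [z [zi zk]]; apply: enum_val_inj; apply/ffunP => j; apply/val_inj.
  have /andP[i1 i2] := zi j; have /andP[k1 k2] := zk j.
  have := le_lt_trans i1 k2; have := le_lt_trans k1 i2.
  rewrite !ltr_pM2r // !ltr_nat !ltnS => u v; apply/eqP; rewrite eqn_leq u v //.
- move=> i; have /andP[d1 d2] := diam_cell (enum_val i); apply/andP; split.
    apply: lt_le_trans d1; rewrite /h -[_ / _ / 2]mulrA ltr_pM2l //.
    rewrite -invfM ltf_pV2 ?posrE ?mulr_gt0 //; nra.
  by apply: le_lt_trans d2 _; lra.
apply: (@le_trans _ _ (\sum_(i < #|{ffun 'I_n -> 'I_L}|) delta ^+ n)).
  apply: ler_sum => i _; rewrite powR_mulrn; last first.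
    have /andP[d1 _] := diam_cell (enum_val i); apply: le_trans d1.
    by rewrite divr_ge0 // ltW.
  have /andP[d1 d2] := diam_cell (enum_val i).
  rewrite lerXn2r ?nnegrE ?(ltW delta0) //; last by lra.
  by apply: le_trans d1; rewrite divr_ge0 // ltW.
rewrite sumr_const card_ord card_ffun !card_ord.
rewrite -[leLHS]mulr_natl natrX -exprMn.
have L1 : L%:R <= 2 * a / h + 1.
  by rewrite /L -natr1 lerD2r truncn_le divr_ge0 ?mulr_ge0 // ltW.
rewrite lerXn2r ?nnegrE ?mulr_ge0 ?addr_ge0 ?mulr_ge0 ?(ltW delta0) ?(ltW nR) //.
apply: le_trans (ler_wpM2r (ltW delta0) L1) _; rewrite mulrDl mul1r lerD ?(ltW delta1) //.
have -> : 2 * a / h * delta = 4 * a * n%:R; last by [].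
by rewrite /h; field; rewrite !gt_eqF.
Qed.

End Dimension.

(** * The functional calculus *)

Lemma cnorm_imag (R : realType) (t : R) : cnorm (t *i) = `|t|.
Proof.
have -> : t *i = t%:C * 'i by apply/eqP; rewrite eq_complex /=; apply/andP; split; apply/eqP; ring.
rewrite cnormM cnormR -[RHS]mulr1; congr (_ * _).
apply/eqP; rewrite -(eqrXn2 (n := 2)) ?cnorm_ge0 // cnorm_sqr /=; apply/eqP; ring.
Qed.

(* A negative order forces the space to be trivial: applying the group at [t]
   and [-t] gives [rnorm x <= C^2 (1 + t)^(2 s) rnorm x] for all t >= 0. *)
Lemma generalized_scalar_neg (R : realType) (X : completeNormedModType R[i])
    (A : X -> X) (a s : R) (x : X) : 0 <= a -> bounded_op A a ->
  generalized_scalar A s -> s < 0 -> x = 0.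
Proof.
move=> a0 Aa [C HC] s0.
pose w : R := (2 * (`|C| + 1))^-1.
have C1 : 0 < `|C| + 1 by rewrite ltr_wpDl.
have w0 : 0 < w by rewrite invr_gt0 mulr_gt0.
have w1 : w <= 1 by rewrite invf_le1 ?mulr_gt0 // mulrDr mulr1; have := normr_ge0 C; lra.
(* Chosen so that u^s = w: at |t| = u - 1 both e^{itA} and e^{-itA} have norm at most 1/2, although
   they are inverse to each other. As w <= 1 and s < 0, u is at least 1. *)
pose u := w `^ s^-1.
have u1 : 1 <= u.
  by rewrite -(powRr0 w) ger_powR ?w0 ?w1 // invr_le0 ltW.
have us : u `^ s = w by rewrite -powRrM mulVf ?lt_eqF // powRr1 // ltW.
have step (t : R) y : `|t| = u - 1 -> rnorm (expop (fun y => (t *i) *: A y) y) <= 1 / 2 * rnorm y.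
  move=> tu; apply: le_trans (HC t y) _; rewrite tu addrC subrK us ler_wpM2r ?rnorm_ge0 //.
  rewrite ler_pdivrMr ?mulr_gt0 //; have := ler_norm C; lra.
have tb (t : R) : bounded_op (fun y => (t *i) *: A y) (cnorm (t *i) * a).
  exact: bounded_op_scale.
have e : expop (fun y => ((u - 1) *i) *: A y) (expop (fun y => ((- (u - 1)) *i) *: A y) x) = x.
  rewrite -(expopD _ _ _ (tb _) (tb _)) ?mulr_ge0 ?cnorm_ge0 //.
    rewrite (_ : (fun _ => _) = (fun => 0)) ?expop0 //; apply/funext => y.
    rewrite -scalerDl (_ : _ + _ = 0 :> R[i]) ?scale0r //.
    by apply/eqP; rewrite eq_complex /=; apply/andP; split; apply/eqP; ring.
  by move=> y; rewrite !(bopZ Aa) !scalerA mulrC.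
have u10 : 0 <= u - 1 by rewrite subr_ge0.
have := step _ (expop (fun y => ((- (u - 1)) *i) *: A y) x) (ger0_norm u10).
have := step (- (u - 1)) x; rewrite normrN e => /(_ (ger0_norm u10)) h1 h2.
by apply: rnorm0_eq0; apply/le_anti; rewrite rnorm_ge0 andbT; lra.
Qed.

(** * The group exp(i k.T/M) *)

Section Group.
Variables (R : realType) (X : completeNormedModType R[i]) (n : nat).
Variables (T : 'I_n -> X -> X) (a : R) (s C : 'I_n -> R) (M : nat).
Hypotheses (a0 : 0 <= a) (Ta : forall j, bounded_op (T j) a).
Hypothesis Tcomm : commutative_family T.
Hypotheses (s_ge0 : forall j, 0 <= s j) (C_ge0 : forall j, 0 <= C j) (M_gt0 : (0 < M)%N).
Hypothesis Ts : forall j t x,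
  rnorm (expop (fun y => (t *i) *: T j y) x) <= C j * (1 + `|t|) `^ s j * rnorm x.

(** The sum runs over a list, so that an induction can split off one operator at a time by
    [expopD]. *)
Definition generator (t : 'I_n -> R) (r : seq 'I_n) (x : X) : X :=
  \sum_(j <- r) ((t j) *i) *: T j x.

Lemma generator_bounded t r : bounded_op (generator t r) (\sum_(j <- r) `|t j| * a).
Proof.
apply: (@bounded_op_sum _ _ _ _ xpredT) => j _.
by rewrite -(cnorm_imag (t j)); exact: bounded_op_scale.
Qed.

Lemma generator_bound_ge0 (t : 'I_n -> R) (r : seq 'I_n) : 0 <= \sum_(j <- r) `|t j| * a.
Proof. by apply: sumr_ge0 => j _; rewrite mulr_ge0. Qed.

Let TZ (j : 'I_n) c x : T j (c *: x) = c *: T j x.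
Proof. exact: (bopZ (Ta j)). Qed.

Lemma generator_comm t u r q x :
  generator t r (generator u q x) = generator u q (generator t r x).
Proof.
rewrite /generator.
transitivity (\sum_(j <- r) \sum_(i <- q) (((t j) *i) * ((u i) *i)) *: T j (T i x)).
  apply: eq_bigr => j _; rewrite (bop_sum (Ta j)) scaler_sumr; apply: eq_bigr => i _.
  by rewrite TZ scalerA.
rewrite exchange_big /=; apply: eq_bigr => i _; rewrite (bop_sum (Ta i)) scaler_sumr.
by apply: eq_bigr => j _; rewrite TZ scalerA mulrC Tcomm.
Qed.

Lemma expop_generator_le t r x :
  rnorm (expop (generator t r) x) <= \prod_(j <- r) (C j * (1 + `|t j|) `^ s j) * rnorm x.
Proof.
elim: r x => [|j r IH] x.
  rewrite big_nil mul1r (_ : generator _ _ = fun=> 0) ?expop0 //.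
  by apply/funext => y; rewrite /generator big_nil.
rewrite (_ : generator t (j :: r) = fun y => ((t j) *i) *: T j y + generator t r y); last first.
  by apply/funext => y; rewrite /generator big_cons.
have tj : bounded_op (fun y => ((t j) *i) *: T j y) (cnorm ((t j) *i) * a) by exact: bounded_op_scale.
rewrite (expopD _ _ _ tj (generator_bounded t r)) ?mulr_ge0 ?cnorm_ge0 ?generator_bound_ge0 //.
  apply: le_trans (Ts _ _ _) _; rewrite big_cons -[leRHS]mulrA ler_wpM2l ?mulr_ge0 ?powR_ge0 //.
move=> y; have := generator_comm t t [:: j] r y; rewrite /generator !big_seq1; exact.
Qed.

Definition expgroup (k : 'rV[int]_n) : X -> X :=
  expop (generator (fun j => (k 0 j)%:~R / M%:R) (index_enum 'I_n)).

Lemma expgroup_bounded k : bounded_op (expgroup k) (\prod_j C j * weight s k).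
Proof.
have [lin _] := expop_bounded (generator_bound_ge0 _ _)
  (generator_bounded (fun j => (k 0 j)%:~R / M%:R) (index_enum 'I_n)).
split=> // x; apply: le_trans (expop_generator_le _ _ _) _.
rewrite ler_wpM2r ?rnorm_ge0 // /weight -big_split /=; apply: ler_prod => j _.
rewrite mulr_ge0 ?powR_ge0 //= ler_wpM2l // ge0_ler_powR ?nnegrE ?addr_ge0 // lerD2l.
rewrite normrM normfV normr_nat ler_pdivrMr ?ltr0n // ler_peMr //.
by rewrite ler1n.
Qed.

Lemma expgroupD k l x : expgroup (k + l) x = expgroup k (expgroup l x).
Proof.
rewrite /expgroup -(expopD _ _ _ (generator_bounded _ _) (generator_bounded _ _)) ?generator_bound_ge0 //.
  congr expop; apply/funext => y; rewrite /generator -big_split /=; apply: eq_bigr => j _.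
  rewrite mxE rmorphD mulrDl -[RHS]scalerDl; congr (_ *: _).
  by apply/eqP; rewrite eq_complex /=; apply/andP; split; apply/eqP; ring.
exact: generator_comm.
Qed.

Lemma expgroup0 x : expgroup 0 x = x.
Proof.
rewrite /expgroup (_ : generator _ _ = fun=> 0) ?expop0 //.
by apply/funext => y; rewrite /generator big1 // => j _; rewrite mxE mul0r scale0r.
Qed.

Lemma expgroup_delta j : expgroup (delta_mx 0 j) = expop (fun x => (M%:R^-1 *i) *: T j x).
Proof.
congr expop; apply/funext => y; rewrite /generator (bigD1 j) //= big1 ?addr0.
  by rewrite mxE !eqxx mul1r.
by move=> i ij; rewrite mxE (negbTE ij) andbF mul0r scale0r.
Qed.

Lemma expgroup_mulrn k :
  expgroup (k *+ M) = expop (fun y => 'i *: \sum_j (k 0 j)%:~R *: T j y).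
Proof.
congr expop; apply/funext => y; rewrite /generator scaler_sumr; apply: eq_bigr => j _.
rewrite mulmxnE rmorphMn /= -mulr_natr mulfK ?pnatr_eq0 -?lt0n // scalerA; congr (_ *: _).
have -> : (k 0 j)%:~R = ((k 0 j)%:~R : R)%:C by rewrite rmorph_int.
by apply/eqP; rewrite eq_complex /=; apply/andP; split; apply/eqP; ring.
Qed.

End Group.

Lemma enorm_ge0 (R : realType) n (x : 'rV[R]_n) : 0 <= enorm x.
Proof. exact: sqrtr_ge0. Qed.

Section Wiener.
Variables (R : realType) (n : nat) (s : 'I_n -> R) (g : 'rV[R]_n -> R[i]) (M : nat).
Hypotheses (s_ge0 : forall j, 0 <= s j) (M_gt0 : (0 < M)%N).
Hypothesis g_A : in_A (\sum_j s j) g.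

(** Passes from the Euclidean weight of [in_A] to the product weight of the group; the dilation by M
    costs only the constant M^alpha. *)
Lemma weight_mulrn_le k : weight s (k *+ M) <=
  M%:R `^ (\sum_j s j) * (1 + enorm (int_point R k)) `^ (\sum_j s j).
Proof.
have M1 : 1 <= M%:R :> R by rewrite ler1n.
have e0 := enorm_ge0 (int_point R k).
have E0 : 0 < M%:R * (1 + enorm (int_point R k)) :> R.
  by rewrite mulr_gt0 ?ltr0n // ltr_wpDr.
rewrite -powRM ?addr_ge0 //.
have -> : (M%:R * (1 + enorm (int_point R k))) `^ (\sum_j s j) =
    \prod_j (M%:R * (1 + enorm (int_point R k))) `^ s j.
  have powD x y : (M%:R * (1 + enorm (int_point R k))) `^ (x + y) =
      (M%:R * (1 + enorm (int_point R k))) `^ x * (M%:R * (1 + enorm (int_point R k))) `^ y.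
    by rewrite powRD ?(gt_eqF E0) ?implybT.
  by rewrite (big_morph _ powD (powRr0 _)).
apply: ler_prod => j _; rewrite powR_ge0 ge0_ler_powR ?nnegrE ?addr_ge0 // ?(ltW E0) //.
rewrite mulmxnE rmorphMn /= normrMn -[_ *+ M]mulr_natl mulrDr mulr1 lerD // ler_wpM2l //.
by have := coord_le_enorm (int_point R k) j; rewrite mxE.
Qed.

Lemma in_A_summable : exists La : R, forall A : {fset 'rV[int]_n},
  \sum_(k <- A) cnorm (fourier_coef g k) * weight s (k *+ M) <= La.
Proof.
have [_ _ + _] := g_A; set F := (X in esum _ X) => fin.
have F0 k : (0 <= F k)%E by rewrite lee_fin mulr_ge0 ?rnorm_ge0 ?powR_ge0.
have efin : esum [set: 'rV[int]_n] F \is a fin_num.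
  by rewrite ge0_fin_numE //; apply: esum_ge0 => k _; exact: F0.
exists (M%:R `^ (\sum_j s j) * fine (esum [set: 'rV[int]_n] F)) => A.
apply: (@le_trans _ _ (M%:R `^ (\sum_j s j) * \sum_(k <- A) fine (F k))).
  rewrite mulr_sumr; apply: ler_sum => k _; rewrite /F /= mulrCA.
  by rewrite ler_wpM2l ?cnorm_ge0 // weight_mulrn_le.
rewrite ler_wpM2l ?powR_ge0 // -lee_fin fineK // -sumEFin.
apply: esum_ge; exists [set` A]; first by split.
by rewrite -fsbig_seq.
Qed.

Lemma in_A_symbol t : symbol (fourier_coef g) (fun k => k *+ M) t = g (M%:R *: t).
Proof.
have [_ _ _ gE] := g_A; rewrite gE.
apply: (congr1 (fun f : _ -> complex_line R => usum f)); apply/funext => k.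
rewrite characterE; congr (_ * cis _); apply: eq_bigr => j _.
by rewrite mulmxnE mxE rmorphMn /= -[_ *+ M]mulr_natr mulrA.
Qed.

End Wiener.

Lemma ascent_le (R : realType) (X : completeNormedModType R[i]) (D : X -> X) (m : nat) :
  (0 < m)%N -> (forall x, iter m D x = 0 <-> iter m.+1 D x = 0) ->
  exists k, is_ascent D k /\ (k <= m)%N.
Proof.
move=> m0 sm.
pose P k := (0 < k)%N && `[< forall x, iter k D x = 0 <-> iter k.+1 D x = 0 >].
have Pm : P m by rewrite /P m0; apply/asboolP.
have exP : exists k, P k by exists m.
case: (ex_minnP exP) => k /andP[k0 /asboolP sk] kmin.
exists k; split; last exact: kmin.
by split=> // l l0 sl; apply: kmin; rewrite /P l0; apply/asboolP.
Qed.

(** * Choice of the scale M and passage to the infimum of the exponents *)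

Section Main.
Variables (R : realType) (X : completeNormedModType R[i]) (n : nat).
Variables (T : 'I_n -> X -> X) (a : R) (s : 'I_n -> R) (g : 'rV[R]_n -> R[i]).
Hypotheses (n_gt0 : (0 < n)%N) (a0 : 0 <= a) (Ta : forall j, bounded_op (T j) a).
Hypothesis T_comm : commutative_family T.
Hypothesis T_scalar : forall j, generalized_scalar (T j) (s j).
Hypothesis s_ge0 : forall j, 0 <= s j.
Hypotheses (g_A : in_A (\sum_j s j) g) (g_lipschitz : lipschitz_fun g).

(** The first bound keeps A_j - i z_j within the reach of [expop_factor] when |z_j| <= 1/2; the
    second makes e^{A_j} - 1 smaller than |1 - e^{i/2}|, which settles larger z_j. *)
Lemma scaling_factor : exists M : nat, [/\ (0 < M)%N, a / M%:R <= 1 / 4 &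
  2 * (a / M%:R) < cnorm (1 - cis (1 / 2 : R))].
Proof.
set c0 := cnorm _; have c0_gt0 : 0 < c0.
  rewrite lt_neqAle cnorm_ge0 andbT eq_sym cnorm_eq0 subr_eq0 eq_sym cis_neq1 //.
  by have pi2 := pi_ge2 R; apply/andP; split; lra.
pose M := (Num.truncn (4 * a + 2 * a / c0)).+1; exists M.
have MR : 4 * a + 2 * a / c0 < M%:R by exact: truncnS_gt.
have M0 : 0 < M%:R :> R by rewrite ltr0n.
have q0 : 0 <= 2 * a / c0 by rewrite divr_ge0 ?mulr_ge0 // ltW.
split=> //; first by rewrite ler_pdivrMr //; lra.
rewrite mulrA ltr_pdivrMr // -ltr_pdivrMl // [ltLHS]mulrC.
by apply: le_lt_trans MR; rewrite lerDr mulr_ge0.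
Qed.

Lemma fcalc_kernel_stable (c : R) (m : nat) (x : X) :
  balanced_coverings (joint_spectrum T) c -> 0 < c -> c / 2 + \sum_j s j < m%:R ->
  iter m (fcalc g T) x = 0 <-> iter m.+1 (fcalc g T) x = 0.
Proof.
move=> Sc c0 cm; have [M [M0 aM aM']] := scaling_factor.
have M1 : 1 <= M%:R :> R by rewrite ler1n.
have MR : 0 < M%:R :> R by rewrite ltr0n.
have [C HC] := choice T_scalar.
have C0 (j : 'I_n) : 0 <= `|C j| by [].
have Ts (j : 'I_n) t y : rnorm (expop (fun y => (t *i) *: T j y) y) <=
    `|C j| * (1 + `|t|) `^ s j * rnorm y.
  apply: le_trans (HC j t y) _; rewrite ler_wpM2r ?rnorm_ge0 // ler_wpM2r ?powR_ge0 //.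
  exact: ler_norm.
have [B sB] : exists B : nat, forall j, s j + 3 <= B%:R.
  exists (Num.truncn (\sum_j s j + 3)).+1 => j; apply: ltW; apply: le_lt_trans (truncnS_gt _).
  by rewrite lerD2r (bigD1 j) //= lerDl sumr_ge0.
have [La cLa] := in_A_summable s_ge0 M0 g_A.
pose U := expgroup T M; pose ix (k : 'rV[int]_n) := k *+ M.
have VE : fcalc g T = Vop U (fourier_coef g) ix.
  apply/funext => y; rewrite /fcalc /Vop; congr usum; apply/funext => k.
  by rewrite /U /ix expgroup_mulrn.
have P0 : 0 <= \prod_j `|C j| by rewrite prodr_ge0.
have Ub : forall k, bounded_op (U k) (\prod_j `|C j| * weight s k)
  by move=> k; exact: (expgroup_bounded a0 Ta T_comm s_ge0 C0 M0 Ts).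
split=> [Vx|]; first by rewrite iterS Vx VE (bop0 (Vop_bounded P0 Ub cLa)).
have [L HL] := g_lipschitz.
have [N1 [d1 [N10 d10 Scov]]] := balanced_coverings_centers Sc c0.
pose E := [set z : 'rV[R]_n | (forall j, `|z 0 j| <= 1 / 2) /\ joint_spectrum T (M%:R *: z)].
(* The symbol is t -> g(M t); its Lipschitz constant for the maximum norm gains M from the dilation
   and n from comparing the Euclidean norm with the maximum. *)
rewrite VE; apply: (kernel_stable P0 s_ge0 sB Ub _ _ cLa (E := E)
  (Lg := `|L| * (n%:R * M%:R)) _ _ _ N10 d10 _ cm).
- exact: (expgroupD M a0 Ta T_comm).
- exact: expgroup0.
- move=> z z1 zE; have [K K0 HK] := exp_family_surj a0 Ta MR aM aM' z1 zE.
  exists K => // y; have [w [wK yw]] := HK y; exists w; split=> //.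
  by rewrite yw; apply: eq_bigr => j _; rewrite /U expgroup_delta.
- by rewrite !mulr_ge0.
- move=> t u h h0 tu; rewrite !(in_A_symbol _ g_A) //.
  apply: le_trans (HL _ _) _; apply: (@le_trans _ _ (`|L| * enorm (M%:R *: t - M%:R *: u))).
    by rewrite ler_wpM2r ?enorm_ge0 // ler_norm.
  rewrite -!mulrA ler_wpM2l // (le_trans (enorm_le_sum _)) //.
  rewrite mulr_natl -[n in leRHS]card_ord -sumr_const; apply: ler_sum => j _.
  by rewrite !mxE -mulrBr normrM normr_nat ler_wpM2l.
- move=> d dp dd; have [k [y [ycov yk]]] := Scov d dp dd.
  (* Division by M maps the cover of the spectrum to one of [E] with radius delta/M <= delta. *)
  exists k, (fun i => M%:R^-1 *: y i); split=> // z [_ /ycov[i yi]].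
  exists i => j; have := yi j; rewrite !mxE => zy.
  have -> : z 0 j - M%:R^-1 * y i 0 j = (M%:R * z 0 j - y i 0 j) / M%:R.
    by field; rewrite gt_eqF.
  by rewrite normrM normfV normr_nat ler_pdivrMr // (le_trans zy) // ler_peMr // ltW.
Qed.

Lemma fcalc_ascent :
  let c := balanced_dim (joint_spectrum T) in
  exists m, is_ascent (fcalc g T) m /\ m%:Z <= Num.floor (c / 2 + \sum_j s j) + 1.
Proof.
move=> c; set D := [set c : R | 0 < c /\ balanced_coverings (joint_spectrum T) c].
have Dinf : has_inf D.
  split; last by exists 0 => u [/ltW].
  exists n%:R; split; first by rewrite ltr0n.
  apply: bounded_balanced_coverings n_gt0 a0 _ => z j.
  exact: joint_spectrum_bounded.
have c0 : 0 <= c by apply: lb_le_inf Dinf.1 _ => u [/ltW].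
have q0 : 0 <= c / 2 + \sum_j s j by rewrite addr_ge0 ?divr_ge0 ?sumr_ge0.
pose m : nat := `|(Num.floor (c / 2 + \sum_j s j) + 1)%R|%N.
have mE : m%:Z = Num.floor (c / 2 + \sum_j s j) + 1.
  by rewrite /m gez0_abs // addr_ge0 // floor_ge0.
have cm : c / 2 + \sum_j s j < m%:R.
  by rewrite -[m%:R]/(m%:Z%:~R) mE floorD1_gt.
(* The infimum c need not be admissible itself. Since m is strictly above c/2 + alpha, an admissible
   u close to c still satisfies u/2 + alpha < m. *)
have [u [u0 Su] uc] : exists2 u, D u & u < c + 2 * (m%:R - (c / 2 + \sum_j s j)).
  by apply: inf_adherent => //; rewrite mulr_gt0 // subr_gt0.
have [|x|k [ak km]] := @ascent_le _ _ (fcalc g T) m.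
- by rewrite -ltz_nat mE ltr_wpDl // floor_ge0.
- by apply: (@fcalc_kernel_stable u m x Su u0); lra.
by exists k; split=> //; rewrite -mE lez_nat.
Qed.

End Main.

Theorem theorem4 (R : realType) (X : completeNormedModType R[i]) (n : nat)
    (T : 'I_n -> {linear X -> X}) (s : 'I_n -> R) (g : 'rV[R]_n -> R[i])
    (n_gt0 : (0 < n)%N)
    (T_bounded : forall i, continuous (T i))
    (T_comm : commutative_family (fun i => T i : X -> X))
    (T_scalar : forall i, generalized_scalar (T i : X -> X) (s i))
    (alpha_ge0 : 0 <= \sum_i s i)
    (g_A : in_A (\sum_i s i) g)
    (g_lipschitz : lipschitz_fun g) :
  let alpha := \sum_i s i in
  let c := balanced_dim (joint_spectrum (fun i => T i : X -> X)) in
  let V := fcalc g (fun i => T i : X -> X) in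
  exists m : nat, is_ascent V m /\ m%:Z <= Num.floor (c / 2 + alpha) + 1.
Proof.
move=> alpha c V.
have [a0 Ta] := choice (fun j => let: ex_intro2 a a0 Ta := continuous_bounded_op (T_bounded j) in
  ex_intro (fun a => 0 <= a /\ bounded_op (T j : X -> X) a) a (conj a0 Ta)).
pose a := \sum_j a0 j.
have a_ge0 : 0 <= a by apply: sumr_ge0 => j _; exact: (Ta j).1.
have {}Ta (j : 'I_n) : bounded_op (T j : X -> X) a.
  apply: (bop_le (Ta j).2); rewrite /a (bigD1 j) //= lerDl sumr_ge0 // => i _.
  exact: (Ta i).1.
have [s_ge0|/existsNP[j /negP]] := pselect (forall j, 0 <= s j).
  exact: fcalc_ascent Ta _ _ _ _ _.
(* A negative order makes X trivial. All kernels are then X, the ascent is 1, and it remains to see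
   that the integer part is nonnegative. *)
rewrite -ltNge => sj.
have X0 (x y : X) : x = y.
  by rewrite (generalized_scalar_neg x a_ge0 (Ta j) (T_scalar j) sj)
    (generalized_scalar_neg y a_ge0 (Ta j) (T_scalar j) sj).
exists 1; split; first by split=> // x; split=> _; exact: X0.
rewrite lerDr floor_ge0 addr_ge0 // divr_ge0 //.
have [D0|D0] := pselect ([set c : R | 0 < c /\ balanced_coverings
    (joint_spectrum (fun i => T i : X -> X)) c] !=set0).
  by apply: lb_le_inf D0 _ => u [/ltW].
(* Without admissible exponents the dimension is 0, the default value of [inf]. *)
by rewrite /c /balanced_dim inf_out // => -[].
Qed.
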